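(* Let $a\in\mathcal C[0,1]$ be strongly degenerate with interior degeneracy point $x_0\in(0,1)$, that is, $a(x_0)=0$, $a(x)>0$ for all $x\in[0,1]\setminus\{x_0\}$ and $\frac1a\notin L^1(0,1)$. Assume that there exists $K\in[1,2)$ such that the function $x\mapsto\frac{|x-x_0|^K}{a(x)}$ is non increasing on the left of $x_0$ (on $[0,x_0)$) and non decreasing on the right of $x_0$ (on $(x_0,1]$). Let $\beta_0,\beta_1>0$ and $\gamma_0,\gamma_1\le0$ be real numbers. Let $X_\mu$ be the Hilbert space, and $A_1u=(au'')''$ with domain $D_s(A_1)\subseteq X_\mu$ the operator with generalized Wentzell boundary conditions, defined in the context. Then $A_1:D_s(A_1)\to X_\mu$ is non negative (i.e. $\langle A_1u,u\rangle_{X_\mu}\ge0$ for all $u\in D_s(A_1)$), self-adjoint, and has dense domain in $X_\mu$. Consequently $-A_1$ generates a (strongly continuous) contraction semigroup on $X_\mu$.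
   Context: All function spaces are real. Space $X_\mu$: the completion of $\mathcal C[0,1]$ with respect to $\|f\|_{X_\mu}^2=\int_0^1|f|^2dx+\frac{a(0)|f(0)|^2}{\beta_0}+\frac{a(1)|f(1)|^2}{\beta_1}$. It is identified with $L^2(0,1)\times\mathbb R\times\mathbb R$: an element $f\in X_\mu$ is a triple $(f|_{(0,1)},f(0),f(1))$ with independent components, $f(0),f(1)\in\mathbb R$ being called its boundary values; the inner product is $\langle f,g\rangle_{X_\mu}=\int_0^1 fg\,dx+\frac{a(0)f(0)g(0)}{\beta_0}+\frac{a(1)f(1)g(1)}{\beta_1}$. A continuous function $u$ on $[0,1]$ is identified with $(u,u(0),u(1))$. Operator: let $\mathcal Z_{s,\mu}(0,1)$ be the set of $u\in H^1(0,1)$ such that $u'$ is locally absolutely continuous in $[0,1]\setminus\{x_0\}$, $\sqrt a\,u''\in L^2(0,1)$, $au''\in H^2(0,1)$ and $(au'')''\in X_\mu$. $D_s(A_1)$ is the set of $u\in\mathcal Z_{s,\mu}(0,1)$ satisfying $(BC)$: $u''(0)=u''(1)=0$, and $(GWBC)_1$: $A_1u(j)+(-1)^{j+1}\frac{\beta_j}{a(j)}(au'')'(j)+\gamma_ju(j)=0$ for $j=0,1$. Here $A_1u=(au'')''$ is regarded as an element of $X_\mu$ with boundary values $A_1u(0),A_1u(1)$, and $(GWBC)_1$ prescribes these boundary values. Concretely: $D_s(A_1)$ consists of the $u\in H^1(0,1)$ with $u'$ locally absolutely continuous in $[0,1]\setminus\{x_0\}$, $\sqrt a\,u''\in L^2(0,1)$,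 $au''\in H^2(0,1)$ and $u''(0)=u''(1)=0$ (embedded in $X_\mu$ by $u\mapsto(u,u(0),u(1))$), and $A_1u$ is the triple with $L^2(0,1)$ component $(au'')''$ and boundary values $A_1u(j)=(-1)^j\frac{\beta_j}{a(j)}(au'')'(j)-\gamma_ju(j)$, $j=0,1$. *)

(* Defs.v *)
From HB Require Import structures.
From mathcomp Require Import all_boot all_order all_algebra.
From mathcomp Require Import all_classical all_reals all_analysis.
From mathcomp Require Import measurable_realfun ess_sup_inf.

Set Implicit Arguments.
Unset Strict Implicit.
Unset Printing Implicit Defensive.

Import Order.TTheory GRing.Theory Num.Theory.
Import numFieldNormedType.Exports.

Local Open Scope classical_set_scope.
Local Open Scope ring_scope.

(* The library defines [LspaceType mu p1] (classes modulo a.e. equality) as a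
   bare type; its vector space structure is induced here from [LfunType]. *)
Section Lspace_lmodType.
Context d (T : measurableType d) (R : realType).
Variables (mu : {measure set T -> \bar R}) (p : \bar R) (p1 : (1 <= p)%E).

Local Notation Lfn := (LfunType mu p1).
Local Notation Lsp := (LspaceType mu p1).

HB.instance Definition _ := gen_eqMixin Lsp.
HB.instance Definition _ := gen_choiceMixin Lsp.

Lemma finite_norm_ae (f g : T -> R) :
  measurable_fun setT f -> measurable_fun setT g ->
  f = g %[ae mu] -> finite_norm mu p g -> finite_norm mu p f.
Proof.
rewrite /finite_norm => mf mg fg.
suff -> : 'N[mu]_p[EFin \o f]%E = 'N[mu]_p[EFin \o g]%E by [].
rewrite unlock /Lnorm; move: (p) p1 => [r|//|//] r1.
  have mN (h : T -> R) : measurable_fun setT h ->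
      measurable_fun [set: T] (fun x => `|(EFin \o h) x| `^ r)%E.
    move=> mh; apply: (@measurableT_comp _ _ _ _ _ _ (fun y : \bar R => y `^ r)%E).
      exact: measurable_poweR.
    by apply: measurableT_comp => //; exact/measurable_EFinP.
  congr poweR; apply: ae_eq_integral => //; [exact: mN|exact: mN|].
  by apply: filterS fg => x /= fgx I; rewrite fgx.
case: ifPn => // _; apply: eq_ess_sup.
by apply: filterS fg => x /= fgx; rewrite fgx.
Qed.

Lemma Lspace_Lfun (f : Lsp) : (f : T -> R) \in Lfun mu p.
Proof.
apply/andP; split; rewrite inE /=.
  exact: (@measurable_funPT _ _ _ _ (repr (f : aeEqMfun _ mu))).
exact: Lebesgue_finite.
Qed.

Definition Lfun_of_Lspace (f : Lsp) : Lfn := Lfun_Sub p1 (Lspace_Lfun f).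

(* [R] and [measurableTypeR R] carry the same sigma-algebra under different
   displays; [LspaceType] is built on the latter. *)
Let mfunR (f : Lfn) : {mfun T >-> measurableTypeR R} :=
  HB.pack_for {mfun T >-> measurableTypeR R} (f : T -> measurableTypeR R)
    (@isMeasurableFun.Build _ _ T (measurableTypeR R) f (measurable_funPT f)).

Let class (f : Lfn) : {mfun_ mu, T >-> measurableTypeR R} :=
  (\pi_(aeEqMfun (measurableTypeR R) mu) (mfunR f))%qT.

Let classE (f : Lfn) : ae_eq mu setT (class f : T -> R) (f : T -> R).
Proof. by have /eqmodP/asboolP := reprK (class f). Qed.

Let class_finite (f : Lfn) : finite_norm mu p (class f).
Proof.
have fin : finite_norm mu p (f : T -> R) by exact: Lfunction_finite.
refine (@finite_norm_ae (class f) f _ _ (classE f) fin).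
  exact: (measurable_funPT (repr (class f))).
exact: measurable_funPT.
Qed.

Definition Lspace_of_Lfun (f : Lfn) : Lsp :=
  @LebesgueSpace.Pack _ _ _ _ _ p1 (class f)
    (LebesgueSpace.Class (isFinLebesgue.Build _ _ _ _ _ p1 _ (class_finite f))).

Lemma Lspace_of_LfunE (f : Lfn) : ae_eq mu setT (Lspace_of_Lfun f : T -> R) f.
Proof. exact: classE. Qed.

Lemma Lspace_eqP (f g : Lsp) :
  f = g <-> ae_eq mu setT (f : T -> R) (g : T -> R).
Proof.
split=> [->|fg]; first exact: ae_eq_refl.
have {fg} : LebesgueSpace.sort f = LebesgueSpace.sort g.
  rewrite -[LHS]reprK -[RHS]reprK; apply/eqmodP/asboolP; exact: fg.
case: f g => [f [[cf]]] [g [[cg]]] /= fg; subst g.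
by rewrite (Prop_irrelevance cf cg).
Qed.

Lemma Lfun_of_LspaceK : cancel Lfun_of_Lspace Lspace_of_Lfun.
Proof. by move=> f; apply/Lspace_eqP/Lspace_of_LfunE. Qed.

Definition Lspace_zero : Lsp := Lspace_of_Lfun 0.
Definition Lspace_opp (f : Lsp) : Lsp := Lspace_of_Lfun (- Lfun_of_Lspace f).
Definition Lspace_add (f g : Lsp) : Lsp :=
  Lspace_of_Lfun (Lfun_of_Lspace f + Lfun_of_Lspace g).
Definition Lspace_scale (k : R) (f : Lsp) : Lsp :=
  Lspace_of_Lfun (k *: Lfun_of_Lspace f).

Lemma Lspace_zeroE : \forall x \ae mu, (Lspace_zero : T -> R) x = 0.
Proof. by apply: filterS (Lspace_of_LfunE 0) => x /(_ I). Qed.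

Lemma Lspace_oppE (f : Lsp) :
  \forall x \ae mu, (Lspace_opp f : T -> R) x = - (f : T -> R) x.
Proof. by apply: filterS (Lspace_of_LfunE (- Lfun_of_Lspace f)) => x /(_ I). Qed.

Lemma Lspace_addE (f g : Lsp) :
  \forall x \ae mu, (Lspace_add f g : T -> R) x = (f : T -> R) x + (g : T -> R) x.
Proof.
have := Lspace_of_LfunE (Lfun_of_Lspace f + Lfun_of_Lspace g).
by apply: filterS => x /(_ I).
Qed.

Lemma Lspace_scaleE (k : R) (f : Lsp) :
  \forall x \ae mu, (Lspace_scale k f : T -> R) x = k * (f : T -> R) x.
Proof.
by apply: filterS (Lspace_of_LfunE (k *: Lfun_of_Lspace f)) => x /(_ I).
Qed.

Lemma Lspace_addA : associative Lspace_add.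
Proof.
move=> f g h; apply/Lspace_eqP.
near=> x => _.
rewrite (near (Lspace_addE f (Lspace_add g h)) x)//.
rewrite (near (Lspace_addE g h) x)//.
rewrite (near (Lspace_addE (Lspace_add f g) h) x)//.
by rewrite (near (Lspace_addE f g) x)// addrA.
Unshelve. all: by end_near. Qed.

Lemma Lspace_addC : commutative Lspace_add.
Proof.
move=> f g; apply/Lspace_eqP; near=> x => _.
rewrite (near (Lspace_addE f g) x)//.
by rewrite (near (Lspace_addE g f) x)// addrC.
Unshelve. all: by end_near. Qed.

Lemma Lspace_add0 : left_id Lspace_zero Lspace_add.
Proof.
move=> f; apply/Lspace_eqP; near=> x => _.
rewrite (near (Lspace_addE Lspace_zero f) x)//.
by rewrite (near Lspace_zeroE x)// add0r.
Unshelve. all: by end_near. Qed.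

Lemma Lspace_addN : left_inverse Lspace_zero Lspace_opp Lspace_add.
Proof.
move=> f; apply/Lspace_eqP; near=> x => _.
rewrite (near (Lspace_addE (Lspace_opp f) f) x)//.
rewrite (near (Lspace_oppE f) x)//.
by rewrite (near Lspace_zeroE x)// addNr.
Unshelve. all: by end_near. Qed.

HB.instance Definition _ := GRing.isZmodule.Build Lsp
  Lspace_addA Lspace_addC Lspace_add0 Lspace_addN.

Lemma Lspace_scaleA (k l : R) (f : Lsp) :
  Lspace_scale k (Lspace_scale l f) = Lspace_scale (k * l) f.
Proof.
apply/Lspace_eqP; near=> x => _.
rewrite (near (Lspace_scaleE k (Lspace_scale l f)) x)//.
rewrite (near (Lspace_scaleE l f) x)//.
by rewrite (near (Lspace_scaleE (k * l) f) x)// mulrA.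
Unshelve. all: by end_near. Qed.

Lemma Lspace_scale1 : left_id 1 Lspace_scale.
Proof.
move=> f; apply/Lspace_eqP; near=> x => _.
by rewrite (near (Lspace_scaleE 1 f) x)// mul1r.
Unshelve. all: by end_near. Qed.

Lemma Lspace_scaleDr : right_distributive Lspace_scale +%R.
Proof.
move=> k f g; apply/Lspace_eqP; near=> x => _.
rewrite (near (Lspace_scaleE k (f + g)) x)//.
rewrite (near (Lspace_addE f g) x)//.
rewrite (near (Lspace_addE (Lspace_scale k f) (Lspace_scale k g)) x)//.
rewrite (near (Lspace_scaleE k f) x)//.
by rewrite (near (Lspace_scaleE k g) x)// mulrDr.
Unshelve. all: by end_near. Qed.

Lemma Lspace_scaleDl (f : Lsp) : {morph Lspace_scale^~ f : k l / k + l}.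
Proof.
move=> k l; apply/Lspace_eqP; near=> x => _.
rewrite (near (Lspace_scaleE (k + l) f) x)//.
rewrite (near (Lspace_addE (Lspace_scale k f) (Lspace_scale l f)) x)//.
rewrite (near (Lspace_scaleE k f) x)//.
by rewrite (near (Lspace_scaleE l f) x)// mulrDl.
Unshelve. all: by end_near. Qed.

HB.instance Definition _ := GRing.Zmodule_isLmodule.Build R Lsp
  Lspace_scaleA Lspace_scale1 Lspace_scaleDr Lspace_scaleDl.

End Lspace_lmodType.

(* A linear operator A : D(A) -> V, D(A) a subspace of V, is given by its graph
   {(x, A x) | x in D(A)}; single-valuedness and linearity of A follow from
   [selfadjoint_op] below, the adjoint of a densely defined A having both. *)
Section operators.
Context (R : realType) (V : lmodType R) (dot : V -> V -> R).
Implicit Types (A : set (V * V)) (S : R -> V -> V).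

Definition dotnorm (x : V) : R := Num.sqrt (dot x x).

Definition op_domain A : set V := [set x | exists y, A (x, y)].

Definition op_opp A : set (V * V) := [set xy | A (xy.1, - xy.2)].

Definition densely_defined A : Prop :=
  forall (x : V) (e : R), 0 < e ->
    exists2 y, op_domain A y & dotnorm (x - y) < e.

Definition nonnegative_op A : Prop :=
  forall x Ax : V, A (x, Ax) -> 0 <= dot Ax x.

Definition op_adjoint A : set (V * V) :=
  [set yz | forall x Ax : V, A (x, Ax) -> dot Ax yz.1 = dot x yz.2].

Definition selfadjoint_op A : Prop :=
  densely_defined A /\ op_adjoint A = A.

(* The values S t for t < 0 are irrelevant. *)
Record contraction_semigroup S : Prop := ContractionSemigroup {
  semigroup_linear : forall t, 0 <= t -> linear (S t) ;
  semigroup0 : forall x, S 0 x = x ;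
  semigroupD : forall s t x, 0 <= s -> 0 <= t -> S (s + t) x = S s (S t x) ;
  semigroup_strongly_continuous :
    forall x, dotnorm (S t x - x) @[t --> 0^'+] --> 0 ;
  semigroup_contraction :
    forall t x, 0 <= t -> dotnorm (S t x) <= dotnorm x }.

Definition semigroup_generator S : set (V * V) :=
  [set xy | dotnorm (t^-1 *: (S t xy.1 - xy.1) - xy.2) @[t --> 0^'+] --> 0].

Definition generates_contraction_semigroup A : Prop :=
  exists2 S, contraction_semigroup S & semigroup_generator S = A.

End operators.

(* Functions on [0, 1] are represented by functions R -> R, whose values outside
   of [0, 1] are irrelevant. *)
Section function_spaces.
Context {R : realType}.
Implicit Types (u v f : R -> R) (c d : R).

Definition mu01 : {measure set (measurableTypeR R) -> \bar R} :=
  mrestr lebesgue_measure (measurable_itv `]0, 1[%R).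

Definition L2_01 : Type := LspaceType2 mu01.

Definition mem_L2_01 f : Prop :=
  exists g : L2_01, \forall x \ae mu01, f x = (g : R -> R) x.

(* A pair p stands for the interval ]p.1, p.2[. *)
Definition abs_continuous c d f : Prop :=
  forall e, 0 < e -> exists2 del : R, 0 < del &
    forall s : seq (R * R),
      all (fun p => [&& c <= p.1, p.1 <= p.2 & p.2 <= d]) s ->
      pairwise (fun p q => (p.2 <= q.1) || (q.2 <= p.1)) s ->
      \sum_(p <- s) (p.2 - p.1) < del ->
      \sum_(p <- s) `|f p.2 - f p.1| < e.

Definition loc_abs_continuous (x0 : R) f : Prop :=
  forall c d, 0 <= c -> c <= d -> d <= 1 -> ~~ (c <= x0 <= d) ->
    abs_continuous c d f.

Definition ae_derivative u v : Prop :=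
  \forall x \ae mu01, is_derive (x : R) (1 : R) u (v x).

(* u is the continuous representative of an element of H^k(0, 1): for k > 0,
   u is absolutely continuous and its derivative has a representative in
   H^(k-1)(0, 1), with H^0(0, 1) = L^2(0, 1). *)
Fixpoint sobolev01 (k : nat) u : Prop :=
  if k is k'.+1 then
    abs_continuous 0 1 u /\ exists2 v, ae_derivative u v & sobolev01 k' v
  else mem_L2_01 u.

End function_spaces.
Arguments mu01 : clear implicits.
Arguments L2_01 : clear implicits.

Section Wentzell_operator.
Context {R : realType}.

(* The completion of C[0, 1]: an element ((f, r0), r1) has the L^2(0, 1)
   component f and the boundary values r0 at 0 and r1 at 1. *)
Definition X_mu : Type := (L2_01 R * R^o * R^o)%type.

Definition X_fun (f : X_mu) : R -> R := f.1.1.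
Definition X_at0 (f : X_mu) : R := f.1.2.
Definition X_at1 (f : X_mu) : R := f.2.

Variables (a : R -> R) (x0 beta0 beta1 gamma0 gamma1 : R).
Implicit Types (u w : R -> R).

Definition X_mu_dot (f g : X_mu) : R :=
  \int[lebesgue_measure]_(x in `]0, 1[) (X_fun f x * X_fun g x)
  + a 0 * X_at0 f * X_at0 g / beta0 + a 1 * X_at1 f * X_at1 g / beta1.

(* f is the continuous function u, seen in X_mu as (u, u(0), u(1)). *)
Definition X_mu_embeds u (f : X_mu) : Prop :=
  [/\ \forall x \ae mu01 R, X_fun f x = u x, X_at0 f = u 0 & X_at1 f = u 1].

(* u lies in D_s(A_1), where u2 is the representative of u'' and w that of
   a u'' which are continuous on [0, 1] minus x0 and on [0, 1] respectively;
   as a(0), a(1) > 0, this fixes the values u''(0) and u''(1). *)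
Record Ds_A1 u (u2 w : R -> R) : Prop := {
  Ds_H1 : sobolev01 1 u ;
  Ds_second_derivative : exists u1, [/\ ae_derivative u u1,
    loc_abs_continuous x0 u1 & ae_derivative u1 u2] ;
  Ds_sqrt : mem_L2_01 (fun x => Num.sqrt (a x) * u2 x) ;
  Ds_flux : forall x, 0 <= x <= 1 -> x != x0 -> w x = a x * u2 x ;
  Ds_H2 : sobolev01 2 w ;
  Ds_BC0 : u2 0 = 0 ;
  Ds_BC1 : u2 1 = 0 }.

(* The graph of A_1; w1 is the absolutely continuous representative of (a u'')',
   and w2 represents (a u'')''. *)
Definition A1 : set (X_mu * X_mu) :=
  [set fg | exists u u2 w w1 w2 : R -> R,
    [/\ Ds_A1 u u2 w, X_mu_embeds u fg.1,
        [/\ ae_derivative w w1, abs_continuous 0 1 w1 & ae_derivative w1 w2] &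
        [/\ \forall x \ae mu01 R, X_fun fg.2 x = w2 x,
            X_at0 fg.2 = beta0 / a 0 * w1 0 - gamma0 * u 0 &
            X_at1 fg.2 = - (beta1 / a 1 * w1 1) - gamma1 * u 1]]].

End Wentzell_operator.
Arguments X_mu : clear implicits.

(* Main.v *)
(* Write w = a u''. Since 1/a <= C |x - x0|^(-K) with K < 2, a function w in H^2
   with w(x0) = 0 has w / a in L^1, and w(x0) = 0 is forced by w^2 / a in L^1 and
   1/a not in L^1. Hence (u, A_1 u) is described by finitely many constants and
   two double primitives: w is a double primitive of the L^2 component of A_1 u
   vanishing at 0, x0 and 1, and u is a double primitive of w / a, up to a
   continuous function which is affine on both sides of x0. Integrating by parts
   twice on [0, 1] gives
     <A_1 u, v> = int w_u w_v / a - sum_j (a(j) gamma_j / beta_j) u(j) v(j),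
   so A_1 is symmetric and non negative. For gamma = 0 its kernel is spanned by 1,
   x and (x - x0)^+, the equation A_1 u = f is solved by explicit integration
   exactly when f is orthogonal to the kernel, with a bound on u, and a
   contraction argument gives the surjectivity of 1 + h A_1; the case gamma <= 0
   is a change of beta. The rest holds for every symmetric non negative A with
   1 + h A onto in a Hilbert space: the resolvents J_h = (1 + h A)^-1 converge
   strongly to 1 as h -> 0, which gives the density of the domain, and the backward
   Euler iterates J_(t / 2^n)^(2^n) converge to the semigroup generated by - A. *)
Require Import Defs.
From mathcomp Require Import all_boot all_order all_algebra.
From mathcomp Require Import all_classical all_reals all_analysis.
From mathcomp Require Import measurable_realfun ess_sup_inf.
From mathcomp Require Import ring lra zify.

Set Implicit Arguments.
Unset Strict Implicit.
Unset Printing Implicit Defensive.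

Import Order.TTheory GRing.Theory Num.Theory.
Import numFieldNormedType.Exports.

Local Open Scope classical_set_scope.
Local Open Scope ring_scope.

(** * Linear combinations in a module *)

(** For gamma = 0 the equation A_1 X = Y is overdetermined in the flux w: w(0) = 0 and the value of
    Y at 0, which fixes w'(0), determine w, while w(x0) = 0, w(1) = 0 and a prescribed w'(1) remain
    to be met. These three conditions match the three dimensions of the kernel, which contains the
    kink (x - x0)^+ because u' may jump where a vanishes: they amount to the orthogonality of Y to
    (x - x0)^+, x and 1. This yields a single h with 1 + h A onto; accretivity then moves h, since x
    + k A x = y is a fixed point problem for a map built from J_h, of Lipschitz constant |1 - h /
    k|.

    For the semigroup, (1 + s A) (1 + t A) = 1 + (s + t) A + s t A^2 shows that on the domain of A^2
    one step of length 2 h and two steps of length h differ by O(h^2), so that halving the step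
    changes the Euler iterate by O(2^-n), which is summable. The domain of A^2 contains the range of
    J_h^2, close to the identity for small h, and contractivity extends the convergence to the whole
    space. *)

Section lincomb.
Context (R : pzRingType) (V : lmodType R).

(** Reflected syntax behind the tactic [lincomb]: an identity between vectors is reduced to one
    identity between scalars for each atom, left to [ring] or [field]. *)
Inductive lincomb : Type :=
  | LVar of nat | LZero | LAdd of lincomb & lincomb | LOpp of lincomb
  | LScale of R & lincomb.

Fixpoint lincomb_eval (s : seq V) (t : lincomb) : V :=
  match t with
  | LVar i => s`_i
  | LZero => 0
  | LAdd t u => lincomb_eval s t + lincomb_eval s u
  | LOpp t => - lincomb_eval s t
  | LScale k t => k *: lincomb_eval s t
  end.

Fixpoint lincomb_coef (i : nat) (t : lincomb) : R :=
  match t with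
  | LVar j => if i == j then 1 else 0
  | LZero => 0
  | LAdd t u => lincomb_coef i t + lincomb_coef i u
  | LOpp t => - lincomb_coef i t
  | LScale k t => k * lincomb_coef i t
  end.

Lemma lincomb_evalE s t :
  lincomb_eval s t = \sum_(i < size s) lincomb_coef i t *: s`_i.
Proof.
elim: t => [j||t IHt u IHu|t IHt|k t IHt] /=.
- case: (ltnP j (size s)) => js.
    rewrite (bigD1 (Ordinal js)) //= eqxx scale1r big1 ?addr0 // => i ij.
    by rewrite (negbTE (_ : nat_of_ord i != j)) ?scale0r.
  rewrite nth_default // big1 // => i _.
  by rewrite ltn_eqF ?scale0r // (leq_trans (ltn_ord i)).
- by rewrite big1 // => i _; rewrite scale0r.
- by rewrite IHt IHu -big_split; apply: eq_bigr => i _; rewrite /= scalerDl.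
- by rewrite IHt -sumrN; apply: eq_bigr => i _; rewrite scaleNr.
- by rewrite IHt scaler_sumr; apply: eq_bigr => i _; rewrite scalerA.
Qed.

Fixpoint lincomb_same (n : nat) (t u : lincomb) : Prop :=
  if n is m.+1 then lincomb_coef m t = lincomb_coef m u /\ lincomb_same m t u
  else True.

Lemma lincomb_eq s t u :
  lincomb_same (size s) t u -> lincomb_eval s t = lincomb_eval s u.
Proof.
move=> tu; rewrite !lincomb_evalE; apply: eq_bigr => i _.
suff -> : lincomb_coef i t = lincomb_coef i u by [].
case: i => i /= +; elim: (size s) tu => // n IH /= [tn tu].
by rewrite ltnS leq_eqVlt => /predU1P[->|/(IH tu)].
Qed.

End lincomb.

Ltac lincomb_index x s :=
  match s with
  | cons x _ => constr:(0%N)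
  | cons _ ?s' => let i := lincomb_index x s' in constr:(S i)
  end.
Ltac lincomb_mem x s :=
  match s with
  | nil => constr:(false)
  | cons x _ => constr:(true)
  | cons _ ?s' => lincomb_mem x s'
  end.
Ltac lincomb_atoms t s :=
  match t with
  | @GRing.zero _ => s
  | @GRing.add _ ?x ?y => let s' := lincomb_atoms x s in lincomb_atoms y s'
  | @GRing.opp _ ?x => lincomb_atoms x s
  | @GRing.scale _ _ _ ?x => lincomb_atoms x s
  | ?x => match lincomb_mem x s with
          | true => s
          | false => constr:(cons x s)
          end
  end.
Ltac lincomb_reify R t s :=
  match t with
  | @GRing.zero _ => constr:(@LZero R)
  | @GRing.add _ ?x ?y =>
      let x' := lincomb_reify R x s in let y' := lincomb_reify R y s in
      constr:(@LAdd R x' y')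
  | @GRing.opp _ ?x => let x' := lincomb_reify R x s in constr:(@LOpp R x')
  | @GRing.scale _ _ ?k ?x =>
      let x' := lincomb_reify R x s in constr:(@LScale R k x')
  | ?x => let i := lincomb_index x s in constr:(@LVar R i)
  end.
Ltac lincomb R V :=
  match goal with
  | |- @eq _ ?t ?u =>
      let s0 := lincomb_atoms t (@nil V) in
      let s := lincomb_atoms u s0 in
      let t' := lincomb_reify R t s in
      let u' := lincomb_reify R u s in
      apply: (@lincomb_eq R V s t' u'); rewrite /=; repeat split
  end.

(** * Maximal non negative operators in a Hilbert space *)

(** The module carries no topology: completeness is stated through Cauchy sequences for the norm
    derived from [dot]. *)
Record hilbert (R : realType) (V : lmodType R) (dot : V -> V -> R) : Prop :=
  Hilbert {
    hdotC : forall x y, dot x y = dot y x ;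
    hdotP : forall k x y z, dot (k *: x + y) z = k * dot x z + dot y z ;
    hdot_ge0 : forall x, 0 <= dot x x ;
    hdot_eq0 : forall x, dot x x = 0 -> x = 0 ;
    hdot_complete : forall u : nat -> V,
      (forall e, 0 < e -> exists N, forall m n, (N <= m)%N -> (N <= n)%N ->
        dotnorm dot (u m - u n) < e) ->
      exists l, forall e, 0 < e -> exists N, forall n, (N <= n)%N ->
        dotnorm dot (u n - l) < e }.

Section hilbert_theory.
Context (R : realType) (V : lmodType R) (dot : V -> V -> R).
Hypothesis hdot : hilbert dot.
Implicit Types (x y z : V) (k e : R).
Local Notation N := (dotnorm dot).
Local Notation dotC := (hdotC hdot).

Lemma dotDl x y z : dot (x + y) z = dot x z + dot y z.
Proof. by rewrite -[x]scale1r (hdotP hdot) scale1r mul1r. Qed.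

Lemma dot0l z : dot 0 z = 0.
Proof.
by have /eqP := dotDl 0 0 z; rewrite addr0 addrC -subr_eq subrr eq_sym => /eqP.
Qed.

Lemma dotZl k x z : dot (k *: x) z = k * dot x z.
Proof. by rewrite -[k *: x]addr0 (hdotP hdot) dot0l addr0. Qed.

Lemma dotNl x z : dot (- x) z = - dot x z.
Proof. by rewrite -scaleN1r dotZl mulN1r. Qed.

Lemma dotBl x y z : dot (x - y) z = dot x z - dot y z.
Proof. by rewrite dotDl dotNl. Qed.

Lemma dotDr x y z : dot z (x + y) = dot z x + dot z y.
Proof. by rewrite dotC dotDl !(dotC _ z). Qed.

Lemma dot0r z : dot z 0 = 0. Proof. by rewrite dotC dot0l. Qed.

Lemma dotZr k x z : dot z (k *: x) = k * dot z x.
Proof. by rewrite dotC dotZl (dotC x). Qed.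

Lemma dotNr x z : dot z (- x) = - dot z x.
Proof. by rewrite dotC dotNl (dotC x). Qed.

Lemma dotBr x y z : dot z (x - y) = dot z x - dot z y.
Proof. by rewrite dotDr dotNr. Qed.

Definition dotE := (dotDl, dotDr, dotNl, dotNr, dotZl, dotZr, dot0l, dot0r).

Lemma dotnorm_ge0 x : 0 <= N x. Proof. exact: sqrtr_ge0. Qed.

Lemma dotnorm_sqr x : N x ^+ 2 = dot x x.
Proof. by rewrite sqr_sqrtr // hdot_ge0. Qed.

Lemma dotnorm0 : N 0 = 0. Proof. by rewrite /dotnorm dot0l sqrtr0. Qed.

Lemma dotnorm_eq0 x : N x = 0 -> x = 0.
Proof.
by move=> x0; apply: (hdot_eq0 hdot); rewrite -dotnorm_sqr x0 expr0n.
Qed.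

Lemma dotnormZ k x : N (k *: x) = `|k| * N x.
Proof. by rewrite /dotnorm !dotE mulrA -expr2 sqrtrM ?sqr_ge0 // sqrtr_sqr. Qed.

Lemma dotnormN x : N (- x) = N x.
Proof. by rewrite /dotnorm !dotE opprK. Qed.

Lemma dotnormBC x y : N (x - y) = N (y - x).
Proof. by rewrite -dotnormN opprB. Qed.

(** Cauchy-Schwarz: expand the square of N(y) x - N(x) y. *)
Lemma dot_le_dotnorm x y : dot x y <= N x * N y.
Proof.
have [y0|y0] := eqVneq (N y) 0; first by rewrite (dotnorm_eq0 y0) dot0r dotnorm0 mulr0.
have [x0|x0] := eqVneq (N x) 0; first by rewrite (dotnorm_eq0 x0) dot0l dotnorm0 mul0r.
have xy0 : 0 < N x * N y by rewrite mulr_gt0 // lt_def ?x0 ?y0 dotnorm_ge0.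
have := hdot_ge0 hdot (N y *: x - N x *: y).
rewrite !dotE -!dotnorm_sqr (dotC y x) => H.
have {}H : N x * N y * dot x y <= N x * N y * (N x * N y) by nra.
by rewrite -(ler_pM2l xy0).
Qed.

Lemma dotnormD x y : N (x + y) <= N x + N y.
Proof.
rewrite -(@ler_pXn2r _ 2) ?nnegrE ?addr_ge0 ?dotnorm_ge0 //.
rewrite dotnorm_sqr !dotE -!dotnorm_sqr (dotC y x).
by have := dot_le_dotnorm x y; lra.
Qed.

Lemma dotnormB x y z : N (x - z) <= N (x - y) + N (y - z).
Proof. by rewrite (le_trans _ (dotnormD _ _)) // addrA subrK. Qed.

Lemma dotnorm_le x c : 0 <= c -> dot x x <= c ^+ 2 -> N x <= c.
Proof.
by move=> c0 xc; rewrite -(@ler_pXn2r _ 2) ?nnegrE ?dotnorm_ge0 // dotnorm_sqr.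
Qed.

Definition dotcvg (u : nat -> V) l := forall e, 0 < e ->
  exists N0, forall n, (N0 <= n)%N -> N (u n - l) < e.

Lemma dotnorm_small x : (forall e, 0 < e -> N x < e) -> x = 0.
Proof.
move=> xe; apply: dotnorm_eq0; apply/eqP; rewrite eq_le dotnorm_ge0 andbT.
by rewrite leNgt; apply/negP => /xe; rewrite ltxx.
Qed.

Lemma dotnorm_small2 c x : (forall e, 0 < e -> N x <= c * e) -> x = 0.
Proof.
move=> xe; apply: dotnorm_small => e e0.
have c1 : 0 < `|c| + 1 by rewrite ltr_wpDl.
have := xe (e / (`|c| + 1)) (divr_gt0 e0 c1); move/le_lt_trans; apply.
rewrite mulrCA gtr_pMr // ltr_pdivrMr // mul1r.
by have := ler_norm c; lra.
Qed.

Lemma geo_small (C k e : R) : 0 <= k < 1 -> 0 < e ->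
  exists N0, forall n, (N0 <= n)%N -> C * k ^+ n < e.
Proof.
move=> /andP[k0 k1] e0.
have k1' : `|k| < 1 by rewrite ger0_norm.
have /cvgrPdist_lt /(_ e e0) [N0 _ HN] :
    (fun n => C * k ^+ n) @ \oo --> C * 0.
  by apply: cvgMr; exact: cvg_expr.
exists N0 => n /HN /=; rewrite mulr0 sub0r normrN.
exact/le_lt_trans/ler_norm.
Qed.

Lemma geo_dotcvg (u : nat -> V) C k : 0 <= k < 1 ->
  (forall n, N (u n.+1 - u n) <= C * k ^+ n) -> exists l, dotcvg u l.
Proof.
move=> k01 uk; have /andP[k0 k1] := k01.
have k1' : 0 < 1 - k by rewrite subr_gt0.
have uD n m : N (u (n + m)%N - u n) <= C / (1 - k) * k ^+ n * (1 - k ^+ m).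
  elim: m => [|m IH].
    by rewrite addn0 subrr dotnorm0 expr0 subrr mulr0.
  rewrite addnS (le_trans (dotnormB _ (u (n + m)%N) _)) //.
  rewrite (le_trans (lerD (uk _) IH)) // le_eqVlt; apply/orP; left; apply/eqP.
  by rewrite exprD exprS; field; rewrite gt_eqF.
have C0 : 0 <= C.
  by have := uk 0; rewrite expr0 mulr1; apply: le_trans; exact: dotnorm_ge0.
apply: (hdot_complete hdot) => e e0.
have e20 : 0 < e / 2 by rewrite divr_gt0.
have [N0 HN] := geo_small (C / (1 - k)) k01 e20.
have uN n : (N0 <= n)%N -> N (u n - u N0) < e / 2.
  move=> n0; rewrite -(subnKC n0) (le_lt_trans (uD _ _)) //.
  apply: le_lt_trans (HN _ (leqnn _)).
  rewrite ler_piMr ?mulr_ge0 ?invr_ge0 ?exprn_ge0 // ?(ltW k1') //.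
  by have := exprn_ge0 (n - N0) k0; lra.
exists N0 => m n mN nN; rewrite (le_lt_trans (dotnormB _ (u N0) _)) //.
by rewrite (splitr e) ltrD ?uN // dotnormBC uN.
Qed.

Lemma contraction_fixpoint (F : V -> V) k : 0 <= k < 1 ->
  (forall x y, N (F x - F y) <= k * N (x - y)) -> exists x, F x = x.
Proof.
move=> k01 Fk; have /andP[k0 k1] := k01; pose u n := iter n F 0.
have [n|l ul] := @geo_dotcvg u (N (F 0)) k k01.
  rewrite /u; elim: n => [|n IH] /=; first by rewrite subr0 expr0 mulr1.
  by rewrite (le_trans (Fk _ _)) // exprS mulrCA ler_wpM2l.
exists l; apply/eqP; rewrite -subr_eq0; apply/eqP.
apply: (@dotnorm_small2 2) => e e0; have [N0 HN] := ul _ e0.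
apply: (le_trans (dotnormB _ (u N0.+1) _)).
have h1 := HN _ (leqnSn N0); have h2 := HN _ (leqnn N0).
rewrite (dotnormBC (F l)); have := Fk (u N0) l; rewrite /= in h1 *.
have : k * N (u N0 - l) <= N (u N0 - l) by rewrite ler_piMl ?dotnorm_ge0 // ltW.
lra.
Qed.

Inductive span (s : seq V) : V -> Prop :=
  | span0 : span s 0
  | span_mem k x y : x \in s -> span s y -> span s (k *: x + y).

Lemma span_linear s k x y : span s x -> span s y -> span s (k *: x + y).
Proof.
move=> sx sy; elim: sx => [|l z w zs _ IH]; first by rewrite scaler0 add0r.
by rewrite scalerDr scalerA -addrA; exact: span_mem.
Qed.

Lemma span_sub s t x : {subset s <= t} -> span s x -> span t x.
Proof.
move=> st; elim=> [|k z w zs _ IH]; first exact: span0.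
by apply: span_mem => //; exact: st.
Qed.

Lemma span_orthogonal s x y : (forall z, z \in s -> dot x z = 0) ->
  span s y -> dot x y = 0.
Proof.
by move=> sx; elim=> [|k z w /sx xz _ xw]; rewrite !dotE // xz xw mulr0 addr0.
Qed.

(** Gram-Schmidt: the head [a] is made orthogonal to the span of the tail by subtracting its
    projection [b], and the projection of x on the tail is corrected along [a - b]. *)
Lemma orthogonal_decomposition s x : exists2 y, span s y &
  forall z, z \in s -> dot (x - y) z = 0.
Proof.
elim: s x => [|a s IH] x; first by exists 0; [exact: span0|].
have [b sb ab] := IH a; have [y sy xy] := IH x.
have sub : {subset s <= a :: s} by move=> z zs; rewrite inE zs orbT.
have {}sub z : span s z -> span (a :: s) z by exact: span_sub.
have sc : span (a :: s) (a - b).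
  rewrite addrC -scaleN1r; apply: span_linear; first exact: sub.
  by have := span_mem 1 (mem_head a s) (span0 _); rewrite scale1r addr0.
(* If [a] already lies in the span of the tail, then [a - b = 0] and division by zero gives
   [k = 0]. *)
pose k := dot (x - y) (a - b) / dot (a - b) (a - b).
exists (k *: (a - b) + y); first by apply: span_linear => //; exact: sub.
have xyb : dot (x - y) b = 0 by exact: span_orthogonal sb.
have abb : dot (a - b) b = 0 by exact: span_orthogonal sb.
have H z : dot (x - (k *: (a - b) + y)) z = dot (x - y) z - k * dot (a - b) z.
  by rewrite !dotE; ring.
move=> z; rewrite inE => /predU1P[->{z}|zs]; rewrite H; last first.
  by rewrite xy // ab // mulr0 subr0.
have -> w : dot w a = dot w (a - b) + dot w b by rewrite dotBr subrK.
rewrite xyb addr0; have -> : dot (a - b) a = dot (a - b) (a - b) by rewrite [RHS]dotBr abb subr0.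
rewrite /k; have [c0|c0] := eqVneq (dot (a - b) (a - b)) 0.
  by rewrite c0 mulr0 (hdot_eq0 hdot c0) dot0r subr0.
by rewrite divfK // subrr.
Qed.

End hilbert_theory.

(** * Range condition and resolvents of a non negative operator *)

Section operators.
Context (R : realType) (V : lmodType R) (dot : V -> V -> R).
Hypothesis hdot : hilbert dot.
Implicit Types (x y z : V) (k h e s t : R) (A : set (V * V)).
Local Notation N := (dotnorm dot).

Definition linear_op A := forall k x y x' y',
  A (x, y) -> A (x', y') -> A (k *: x + x', k *: y + y').

Definition symmetric_op A := forall x y x' y',
  A (x, y) -> A (x', y') -> dot y x' = dot x y'.

Definition range_full A h := forall y, exists x z, A (x, z) /\ x + h *: z = y.

(** Accretivity: in the expansion of N(x + h y)^2 the cross term 2 h <y, x> is non negative.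
    Resolvents are contractions for this reason. *)
Lemma nonnegative_dotnorm A x y h : nonnegative_op dot A -> 0 <= h ->
  A (x, y) -> N x <= N (x + h *: y).
Proof.
move=> A0 h0 /A0 xy; apply: dotnorm_le => //; first exact: dotnorm_ge0.
rewrite dotnorm_sqr // !(dotE hdot) (hdotC hdot x y).
by have := hdot_ge0 hdot y; nra.
Qed.

Lemma linear_sub (F : V -> V) x y : linear F -> F (x - y) = F x - F y.
Proof.
by move=> FL; have := FL (-1) y x; rewrite !scaleN1r ![- _ + _]addrC.
Qed.

Lemma linear_opB A x y x' y' : linear_op A ->
  A (x, y) -> A (x', y') -> A (x - x', y - y').
Proof.
move=> Al Ax Ay; have := Al (-1) _ _ _ _ Ay Ax.
by rewrite !scaleN1r addrC [- y' + _]addrC.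
Qed.

(** With J the resolvent at h, x + k A x = y means x = J ((h / k) y + (1 - h / k) x). As J does not
    expand distances, this map is a contraction when |1 - h / k| < 1, that is when h < 2 k. *)
Lemma range_full_step A h k : linear_op A -> nonnegative_op dot A -> 0 < h ->
  range_full A h -> h < 2 * k -> range_full A k.
Proof.
move=> Al A0 h0 Ah hk y; have k0 : 0 < k by lra.
have {Ah} /choice[J HJ] : forall y, exists x, exists z, A (x, z) /\ x + h *: z = y by [].
pose F x := J ((h / k) *: y + (1 - h / k) *: x).
have hk2 : h / k < 2 by rewrite ltr_pdivrMr.
have hk0 : 0 < h / k by rewrite divr_gt0.
have [|x z|x Fx] := @contraction_fixpoint _ _ _ hdot F `|1 - h / k|.
- by rewrite normr_ge0 ltr_norml; lra.
- rewrite -(dotnormZ hdot) /F.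
  have [z1 [Az1 Ez1]] := HJ ((h / k) *: y + (1 - h / k) *: x).
  have [z2 [Az2 Ez2]] := HJ ((h / k) *: y + (1 - h / k) *: z).
  have := nonnegative_dotnorm A0 (ltW h0) (linear_opB Al Az1 Az2).
  set u := J _ in Ez1 *; set v := J _ in Ez2 *.
  have -> : u - v + h *: (z1 - z2) = (u + h *: z1) - (v + h *: z2).
    by lincomb R V; ring.
  rewrite Ez1 Ez2; suff -> : forall a b c : V, a + b - (a + c) = b - c.
    by rewrite -scalerBr.
  by move=> a b c; lincomb R V; ring.
have [z []] := HJ ((h / k) *: y + (1 - h / k) *: x).
rewrite -/(F x) Fx => Az xz; exists x, z; split => //.
have -> : x + k *: z = (k / h) *: (x + h *: z - (1 - h / k) *: x).
  by lincomb R V; field; rewrite !gt_eqF.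
rewrite xz addrK scalerA.
have -> : k / h * (h / k) = 1 by field; rewrite !gt_eqF.
by rewrite scale1r.
Qed.

(** A single step can lower h by any factor above 1/2 and raise it without limit: 2/3 is iterated
    until the value is below k, and one last step reaches k. *)
Lemma range_full_all A h k : linear_op A -> nonnegative_op dot A -> 0 < h ->
  range_full A h -> 0 < k -> range_full A k.
Proof.
move=> Al A0 h0 Ah k0.
have H n : range_full A (h * (2 / 3) ^+ n).
  elim: n => [|n IH]; first by rewrite expr0 mulr1.
  have p0 : 0 < h * (2 / 3) ^+ n by rewrite mulr_gt0 // exprn_gt0.
  by apply: range_full_step IH _ => //; rewrite exprS; lra.
have [|n Hn] := @geo_small R h (2 / 3) k _ k0; first by lra.
have := Hn _ (leqnn n) => nk.
by apply: range_full_step (H n) _ => //; [rewrite mulr_gt0 // exprn_gt0|lra].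
Qed.

(** [mn_functional] is the injectivity of the resolvents, from which the density of the domain is
    derived. *)
Record maximal_nonnegative A : Prop := MaximalNonnegative {
  mn_linear : linear_op A ;
  mn_symmetric : symmetric_op A ;
  mn_nonnegative : nonnegative_op dot A ;
  mn_functional : forall y, A (0, y) -> y = 0 ;
  mn_range : forall h, 0 < h -> range_full A h }.

Section resolvent.
Variable A : set (V * V).
Hypothesis mA : maximal_nonnegative A.
Let Al := mn_linear mA.
Let A0 := mn_nonnegative mA.

(** The convention J_0 = 1 lets the Euler scheme at time 0 be treated like the others. *)
Definition resolvent h y : V :=
  if 0 < h then xget 0 [set x | exists2 z, A (x, z) & x + h *: z = y] else y.
Local Notation J := resolvent.

Lemma resolvent0 y : J 0 y = y. Proof. by rewrite /J ltxx. Qed.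

Lemma resolvent_ex h y : 0 < h -> exists2 z, A (J h y, z) & J h y + h *: z = y.
Proof.
move=> h0; rewrite /J h0; have [x [z [Az xz]]] := mn_range mA h0 y.
by apply: (@xgetPex _ _ [set x | exists2 z, A (x, z) & _]); exists x, z.
Qed.

Lemma resolvent_uniq h x z : 0 <= h -> A (x, z) -> J h (x + h *: z) = x.
Proof.
rewrite le_eqVlt => /predU1P[<- _|h0 Ax]; first by rewrite resolvent0 scale0r addr0.
have [w Aw E] := resolvent_ex (x + h *: z) h0.
apply/eqP; rewrite -subr_eq0; apply/eqP; apply: (dotnorm_eq0 hdot).
apply/eqP; rewrite eq_le dotnorm_ge0 andbT.
have := nonnegative_dotnorm A0 (ltW h0) (linear_opB Al Aw Ax).
set u := J _ _ in E *; have -> : u - x + h *: (w - z) = (u + h *: w) - (x + h *: z).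
  by lincomb R V; ring.
by rewrite E subrr (dotnorm0 hdot).
Qed.

Lemma resolvent_linear h : 0 <= h -> linear (J h).
Proof.
rewrite le_eqVlt => /predU1P[<- k x y|h0 k x y]; first by rewrite !resolvent0.
have [z Az Ez] := resolvent_ex x h0; have [w Aw Ew] := resolvent_ex y h0.
rewrite -[in LHS]Ez -[in LHS]Ew -(resolvent_uniq (ltW h0) (Al k Az Aw)); congr J.
by lincomb R V; ring.
Qed.

Lemma resolventB h x y : 0 <= h -> J h (x - y) = J h x - J h y.
Proof. by move/resolvent_linear/linear_sub. Qed.

Lemma resolvent_dotnorm h x : 0 <= h -> N (J h x) <= N x.
Proof.
rewrite le_eqVlt => /predU1P[<-|h0]; first by rewrite resolvent0.
have [z Az Ez] := resolvent_ex x h0.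
by rewrite -[in leRHS]Ez; exact: (nonnegative_dotnorm A0 (ltW h0)).
Qed.

(** With v = A J_h x = (x - J_h x) / h, linearity gives A v = (y - v) / h, so v + h A v = y and v =
    J_h y. *)
Lemma resolvent_op h x y : 0 <= h -> A (x, y) -> A (J h x, J h y).
Proof.
rewrite le_eqVlt => /predU1P[<-|h0 Ax]; first by rewrite !resolvent0.
have [v Av Ev] := resolvent_ex x h0; suff -> : J h y = v by [].
have A00 : A (0, 0) by have := linear_opB Al Ax Ax; rewrite !subrr.
have := Al h^-1 (linear_opB Al Ax Av) A00.
rewrite !addr0; have -> : x - J h x = h *: v by rewrite -[X in X - _]Ev addrC addKr.
rewrite scalerA mulVf ?gt_eqF // scale1r => Av2.
rewrite -[RHS](resolvent_uniq (ltW h0) Av2); congr J.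
by lincomb R V; field; rewrite gt_eqF.
Qed.

Lemma resolventE h x y : 0 <= h -> A (x, y) -> J h x + h *: J h y = x.
Proof.
move=> h0 Ax; rewrite -[RHS](resolvent_uniq h0 Ax).
by rewrite addrC -(resolvent_linear h0) addrC.
Qed.

Lemma resolvent_comm s t x : 0 <= s -> 0 <= t -> J s (J t x) = J t (J s x).
Proof.
move=> s0; rewrite le_eqVlt => /predU1P[<-|t0]; first by rewrite !resolvent0.
have [z Az Ez] := resolvent_ex x t0.
rewrite -[in RHS]Ez addrC (resolvent_linear s0) addrC resolvent_uniq //.
  exact: ltW.
exact: resolvent_op.
Qed.

(** From (1 + s A) (1 + t A) = 1 + (s + t) A + s t A^2 follows J_s J_t - J_(s+t) = - s t J_s J_t
    J_(s+t) A^2. This is the local error of the Euler scheme. *)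
Lemma resolvent_mul s t x y z : 0 <= s -> 0 <= t -> A (x, y) -> A (y, z) ->
  N (J s (J t x) - J (s + t) x) <= s * t * N z.
Proof.
move=> s0 t0 Ax Ay; have st0 : 0 <= s + t by rewrite addr_ge0.
pose B := J (s + t).
have [AX AY] : A (B x, B y) /\ A (B y, B z) by split; exact: resolvent_op.
have L u v : 0 <= u -> linear (J u) by exact: resolvent_linear.
have EX := resolventE t0 AX; have EY := resolventE t0 AY.
have JX := resolventE s0 (resolvent_op t0 AX).
have JY := resolventE s0 (resolvent_op t0 AY).
have Ex := resolventE st0 Ax.
have lin u k v w : 0 <= u -> J u (v + k *: w) = J u v + k *: J u w.
  by move=> u0; rewrite addrC resolvent_linear // addrC.
have E1 : J s (J t x) = J s (J t (B x)) + (s + t) *: J s (J t (B y)).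
  by rewrite -(lin s _ (J t (B x))) // -(lin t) // /B Ex.
have E2 : B x = J s (J t (B x)) + s *: J s (J t (B y))
    + t *: (J s (J t (B y)) + s *: J s (J t (B z))) by rewrite JX JY EX.
have -> : J s (J t x) - B x = - (s * t) *: J s (J t (B z)).
  by rewrite E1 [X in _ - X]E2; lincomb R V; ring.
rewrite scaleNr (dotnormN hdot) (dotnormZ hdot) ger0_norm ?mulr_ge0 // ler_wpM2l ?mulr_ge0 //.
by do 3 (apply: le_trans (resolvent_dotnorm _ _) _ => //).
Qed.

Lemma iter_linear (F : V -> V) n : linear F -> linear (iter n F).
Proof.
by move=> FL k x y; elim: n => [//|n IH]; rewrite !iterS IH FL.
Qed.

Lemma iter_dotnorm (F : V -> V) n x : (forall x, N (F x) <= N x) ->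
  N (iter n F x) <= N x.
Proof. by move=> FN; elim: n => [//|n IH]; rewrite iterS (le_trans (FN _)). Qed.

(** Telescoping of F^n - G^n into n terms, each of them F - G composed with commuting
    contractions. *)
Lemma iterB_dotnorm (F G : V -> V) n x : linear F -> linear G ->
  (forall x, N (F x) <= N x) -> (forall x, N (G x) <= N x) ->
  (forall x, F (G x) = G (F x)) ->
  N (iter n F x - iter n G x) <= n%:R * N (F x - G x).
Proof.
move=> FL GL FN GN FG.
have FGn m y : iter m F (G y) = G (iter m F y).
  by elim: m => [//|m IH]; rewrite !iterS IH FG.
elim: n => [|n IH]; first by rewrite subrr (dotnorm0 hdot) mul0r.
rewrite (le_trans (dotnormB hdot _ (iter n F (G x)) _)) // -natr1 mulrDl mul1r addrC.
rewrite lerD //.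
  by rewrite FGn iterS -linear_sub //; exact: le_trans (GN _) IH.
by rewrite iterSr -linear_sub; [exact: iter_dotnorm|exact: iter_linear].
Qed.

Lemma resolvent_near h x y : 0 <= h -> A (x, y) -> N (J h x - x) <= h * N y.
Proof.
move=> h0 Ax; rewrite -[x in _ - x](resolventE h0 Ax) opprD addNKr (dotnormN hdot) (dotnormZ hdot).
by rewrite ger0_norm // ler_wpM2l // resolvent_dotnorm.
Qed.

End resolvent.
End operators.

(** * Surjectivity for an operator with a finite dimensional kernel *)

Section kernel.
Context (R : realType) (V : lmodType R) (dot : V -> V -> R).
Hypothesis hdot : hilbert dot.
Local Notation N := (dotnorm dot).

(* Solve x + 2 C z = y with (x, z) in A: the component of y along the kernel goes
   into x, and z is the fixed point of a map of Lipschitz constant 1 / 2. *)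
Lemma range_full_kernel (A : set (V * V)) (s : seq V) (C : R) : linear_op A ->
  (forall n, n \in s -> A (n, 0)) ->
  (forall y, (forall n, n \in s -> dot y n = 0) -> exists x, A (x, y)) ->
  0 < C ->
  (forall x y, A (x, y) -> (forall n, n \in s -> dot x n = 0) -> N x <= C * N y) ->
  range_full A (2 * C).
Proof.
move=> Al As Asolve C0 AC y.
have A00 : A (0, 0).
  have [x Ax] : exists x, A (x, 0) by apply: Asolve => n _; rewrite (dot0l hdot).
  by have := linear_opB Al Ax Ax; rewrite !subrr.
have Aspan n : span s n -> A (n, 0).
  elim=> [//|k m n' ms _ An']; have := Al k _ _ _ _ (As _ ms) An'.
  by rewrite scaler0 addr0.
have /choice[Q HQ] : forall z, exists q, span s q /\ forall n, n \in s -> dot (z - q) n = 0.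
  by move=> z; have [q sq zq] := orthogonal_decomposition hdot s z; exists q.
(* [G z] is the solution of A x = z - Q z that is orthogonal to the kernel vectors, the one to which
   the bound [AC] applies. *)
have /choice[G HG] : forall z, exists x, A (x, z - Q z) /\ forall n, n \in s -> dot x n = 0.
  move=> z; have [_ zq] := HQ z; have [x Ax] := Asolve _ zq; have [sx xq] := HQ x.
  exists (x - Q x); split => //.
  by have := linear_opB Al Ax (Aspan _ sx); rewrite subr0.
have dotB u v n : dot u n = 0 -> dot v n = 0 -> dot (u - v) n = 0.
  by rewrite (dotBl hdot) => -> ->; rewrite subrr.
have spanB u v : span s u -> span s v -> span s (u - v).
  by move=> su sv; rewrite addrC -scaleN1r; exact: span_linear.
pose F z := (2 * C)^-1 *: (y - Q y - G z).
have C2 : 0 < 2 * C by rewrite mulr_gt0.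
have [|z1 z2|z Fz] := @contraction_fixpoint _ _ _ hdot F 2^-1; first by lra.
  have -> : F z1 - F z2 = (2 * C)^-1 *: (G z2 - G z1) by rewrite /F; lincomb R V; ring.
  rewrite (dotnormZ hdot) gtr0_norm ?invr_gt0 // (dotnormBC hdot).
  have [A1 o1] := HG z1; have [A2 o2] := HG z2.
  have h1 : N (G z1 - G z2) <= C * N (z1 - Q z1 - (z2 - Q z2)).
    apply: AC; first exact: linear_opB.
    by move=> n ns; rewrite dotB ?o1 ?o2.
  have h2 : N (z1 - Q z1 - (z2 - Q z2)) <= N (z1 - z2).
    have [s1 q1] := HQ z1; have [s2 q2] := HQ z2.
    set d := (_ - _ - _); have dn n : n \in s -> dot d n = 0.
      by move=> ns; rewrite /d dotB ?q1 ?q2.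
    have dd : dot d d = dot d (z1 - z2).
      have -> : z1 - z2 = d + (Q z1 - Q z2) by rewrite /d; lincomb R V; ring.
      by rewrite [RHS](dotDr hdot) (span_orthogonal hdot dn (spanB _ _ s1 s2)) addr0.
    have := dot_le_dotnorm hdot d (z1 - z2); rewrite -dd -(dotnorm_sqr hdot d) expr2.
    have [->|d0] := eqVneq (N d) 0; first by rewrite dotnorm_ge0.
    by rewrite ler_pM2l // lt_def d0 dotnorm_ge0.
  rewrite ler_pdivrMl //; apply: le_trans h1 _.
  have : C * N (z1 - Q z1 - (z2 - Q z2)) <= C * N (z1 - z2) by rewrite ler_pM2l.
  lra.
have [AG oG] := HG z; have [sy oy] := HQ y; have [sz oz] := HQ z.
have zE : (2 * C) *: z = y - Q y - G z.
  by rewrite -[in LHS]Fz /F scalerA divff ?gt_eqF // scale1r.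
(* Both [y - Q y] and [G z] are orthogonal to [s], hence so is the fixed point z; being also
   orthogonal to z - Q z, its projection Q z vanishes, and A (G z) = z. *)
have zn n : n \in s -> dot z n = 0.
  move=> ns; have : dot ((2 * C) *: z) n = 0 by rewrite zE dotB ?oy ?oG.
  by rewrite (dotZl hdot) => /eqP; rewrite mulf_eq0 gt_eqF //= => /eqP.
have Qz0 : Q z = 0.
  apply: (hdot_eq0 hdot); have -> : dot (Q z) (Q z) = dot z (Q z) - dot (z - Q z) (Q z).
    by rewrite (dotBl hdot); ring.
  by rewrite (span_orthogonal hdot zn sz) (span_orthogonal hdot oz sz) subrr.
exists (Q y + G z), z; split.
  have := Al 1 _ _ _ _ (Aspan _ sy) AG.
  by rewrite scale1r scaler0 add0r Qz0 subr0.
by rewrite zE; lincomb R V; ring.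
Qed.

End kernel.

(** * Convergence of sequences for the norm *)

Section dotcvg_theory.
Context (R : realType) (V : lmodType R) (dot : V -> V -> R).
Hypothesis hdot : hilbert dot.
Implicit Types (x y z : V) (k h e s t : R) (u v : nat -> V).
Local Notation N := (dotnorm dot).

Lemma dotcvgP k u v x y : dotcvg dot u x -> dotcvg dot v y ->
  dotcvg dot (fun n => k *: u n + v n) (k *: x + y).
Proof.
move=> ux vy e e0; have c0 : 0 < 2 * (`|k| + 1) by rewrite mulr_gt0 // ltr_wpDl.
have [N1 H1] := ux (e / (2 * (`|k| + 1))) (divr_gt0 e0 c0).
have [N2 H2] := vy (e / 2) (divr_gt0 e0 (ltr0n _ 2)).
exists (maxn N1 N2) => n; rewrite geq_max => /andP[/H1 h1 /H2 h2].
have -> : k *: u n + v n - (k *: x + y) = k *: (u n - x) + (v n - y).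
  by lincomb R V; ring.
apply: le_lt_trans (dotnormD hdot _ _) _; rewrite (dotnormZ hdot) (splitr e).
apply: ler_ltD => //; apply: (@le_trans _ _ ((`|k| + 1) * N (u n - x))).
  by rewrite ler_wpM2r ?dotnorm_ge0 // lerDl.
rewrite -ler_pdivlMl ?ltr_wpDl // (le_trans (ltW h1)) // le_eqVlt; apply/orP; left.
by apply/eqP; field; rewrite gt_eqF // ltr_wpDl.
Qed.

Lemma dotcvg_le u x a c : dotcvg dot u x -> (forall n, N (u n - a) <= c) ->
  N (x - a) <= c.
Proof.
move=> ux uc; apply/ler_addgt0Pr => e /ux[n /(_ n (leqnn n))] h.
apply: le_trans (dotnormB hdot _ (u n) _) _.
by rewrite (dotnormBC hdot) addrC lerD // ltW.
Qed.

Lemma dotcvg_unique u x y : dotcvg dot u x -> dotcvg dot u y -> x = y.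
Proof.
move=> ux uy; apply/eqP; rewrite -subr_eq0; apply/eqP; apply: (dotnorm_small hdot) => e e0.
have e20 := divr_gt0 e0 (ltr0n R 2).
have [N1 H1] := ux _ e20; have [N2 H2] := uy _ e20.
apply: le_lt_trans (dotnormB hdot _ (u (maxn N1 N2)) _) _.
by rewrite (splitr e) ltrD // ?(H2 _ (leq_maxr _ _)) // (dotnormBC hdot) H1 // leq_maxl.
Qed.

Lemma dotcvg_dist u v x : dotcvg dot u x -> (forall e, 0 < e ->
  exists n0, forall n, (n0 <= n)%N -> N (v n - u n) < e) -> dotcvg dot v x.
Proof.
move=> ux uv e e0; have e20 := divr_gt0 e0 (ltr0n R 2).
have [N1 H1] := ux _ e20; have [N2 H2] := uv _ e20.
exists (maxn N1 N2) => n; rewrite geq_max => /andP[/H1 h1 /H2 h2].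
by apply: le_lt_trans (dotnormB hdot _ (u n) _) _; rewrite (splitr e) ltrD.
Qed.

Lemma dotcvg_dense (u : nat -> V -> V) x : (forall n, linear (u n)) ->
  (forall n y, N (u n y) <= N y) ->
  (forall e, 0 < e -> exists2 y, N (x - y) < e & exists l, dotcvg dot (u ^~ y) l) ->
  exists l, dotcvg dot (u ^~ x) l.
Proof.
move=> ul uN D; apply: (hdot_complete hdot) => e e0.
have e40 : 0 < e / 4 by rewrite divr_gt0.
have [y xy [l yl]] := D _ e40; have [n0 H] := yl _ e40.
exists n0 => m n /H hm /H hn.
have xyn i : N (u i x - u i y) < e / 4 by rewrite -linear_sub // (le_lt_trans (uN _ _)).
apply: le_lt_trans (dotnormB hdot _ (u m y) _) _.
have := dotnormB hdot (u m y) l (u n x); have := dotnormB hdot l (u n y) (u n x).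
rewrite (dotnormBC hdot l (u n y)) (dotnormBC hdot (u n y) (u n x)).
by have := xyn m; have := xyn n; lra.
Qed.

End dotcvg_theory.

(** * The contraction semigroup *)

Section generation.
Context (R : realType) (V : lmodType R) (dot : V -> V -> R).
Hypothesis hdot : hilbert dot.
Implicit Types (x y z : V) (k h e s t : R).
Local Notation N := (dotnorm dot).
Variable A : set (V * V).
Hypothesis mA : maximal_nonnegative dot A.
Let A0 := mn_nonnegative mA.
Local Notation J := (resolvent A).

(** This is T^2 <= T for T = J_s - J_h = (h - s) J_s A J_h. With w = J_s J_h x, c = A w and d = A c
    one has x = w + (s + h) c + h s d, and the difference of the two sides is (h - s) (<c, w> + 2 s
    <c, c> + h s <c, d>). *)
Lemma resolvent_le s h x : 0 < s -> s <= h ->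
  N (J s x - J h x) ^+ 2 <= dot (J s x - J h x) x.
Proof.
move=> s0 sh; have h0 : 0 < h by exact: lt_le_trans sh.
have [b Ab Eb] := resolvent_ex mA x h0.
have Aw := resolvent_op hdot mA (ltW s0) Ab.
have Ew := resolventE hdot mA (ltW s0) Ab.
have [d Ad Ed] := resolvent_ex mA b s0.
move: Aw Ew Ad Ed; set v := J h x in Ab Eb *; set w := J s v; set c := J s b.
move=> Aw Ew Ad Ed.
have -> : J s x = w + h *: c.
  by rewrite -Eb addrC (resolvent_linear hdot mA (ltW s0)) addrC.
have -> : w + h *: c - v = (h - s) *: c by rewrite -Ew; lincomb R V; ring.
have -> : x = w + s *: c + h *: (c + s *: d) by rewrite Ew Ed Eb.
have cw : 0 <= dot c w by exact: A0 Aw.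
have dc : 0 <= dot c d by rewrite (hdotC hdot); exact: A0 Ad.
have cc := hdot_ge0 hdot c.
rewrite (dotnorm_sqr hdot) !(dotE hdot) -subr_ge0.
have : 0 <= (h - s) * (dot c w + 2 * s * dot c c + h * s * dot c d).
  by rewrite mulr_ge0 ?subr_ge0 ?addr_ge0 ?mulr_ge0 // ltW.
by congr (_ <= _); ring.
Qed.

(** For h_n = 2^-n the numbers <J_(h_n) x, x> increase and are bounded, so [resolvent_le] makes
    J_(h_n) x a Cauchy sequence. Its limit p satisfies J_1 p = lim J_(h_n) J_1 x = J_1 x, because
    J_1 x lies in the domain, and J_1 is injective. *)
Lemma resolvent_dense x e : 0 < e -> exists2 h, 0 < h & N (J h x - x) < e.
Proof.
pose h n : R := 2^-1 ^+ n; have h0 n : 0 < h n by rewrite exprn_gt0 ?invr_gt0.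
have hd m n : (m <= n)%N -> h n <= h m.
  by move=> mn; rewrite ler_wiXn2l ?invr_ge0 ?invf_le1 ?ler1n.
pose t n := dot (J (h n) x) x.
have tmn m n : (m <= n)%N -> N (J (h n) x - J (h m) x) ^+ 2 <= t n - t m.
  by move=> mn; rewrite (le_trans (resolvent_le _ _ _)) // ?hd // (dotBl hdot).
have tnd : {homo t : m n / (m <= n)%N >-> m <= n}.
  by move=> m n mn; rewrite -subr_ge0 (le_trans _ (tmn _ _ mn)) ?sqr_ge0.
have tb n : t n <= N x * N x.
  rewrite (le_trans (dot_le_dotnorm hdot _ _)) // ler_wpM2r ?dotnorm_ge0 //.
  by apply: resolvent_dotnorm => //; exact: ltW.
have /cvg_ex[l /cvgrPdist_lt tl] : cvgn t.
  apply: nondecreasing_is_cvgn => //.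
  by exists (N x * N x) => _ [n _ <-]; exact: tb.
have [p pl] : exists p, dotcvg dot (fun n => J (h n) x) p.
  apply: (hdot_complete hdot) => d d0; have d20 : 0 < d ^+ 2 / 2 by rewrite divr_gt0 ?exprn_gt0.
  have [n0 _ /= Hn] := tl _ d20; exists n0 => m n.
  wlog mn : m n / (m <= n)%N => [H m0 n0'|m0 n0'].
    case: (leqP m n) => [|/ltnW] mn; first exact: H.
    by rewrite (dotnormBC hdot); exact: H.
  rewrite (dotnormBC hdot) -(@ltr_pXn2r _ 2) ?nnegrE ?dotnorm_ge0 ?(ltW d0) //.
  rewrite (le_lt_trans (tmn _ _ mn)) //.
  by have := Hn _ m0; have := Hn _ n0'; rewrite !ltr_norml; lra.
suff px : p = x.
  by move=> e0; rewrite px in pl; have [n /(_ n (leqnn n)) H] := pl _ e0; exists (h n).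
have J1p : dotcvg dot (fun n => J (h n) (J 1 x)) (J 1 p).
  move=> d d0; have [n0 Hn] := pl _ d0; exists n0 => n /Hn; apply: le_lt_trans.
  rewrite (resolvent_comm hdot mA) ?(ltW (h0 _)) //.
  rewrite -(resolventB hdot mA) ?ler01 //; exact: resolvent_dotnorm.
have J1x : dotcvg dot (fun n => J (h n) (J 1 x)) (J 1 x).
  have [b Ab _] := resolvent_ex mA x (ltr01).
  move=> d d0.
  have k01 : 0 <= (2^-1 : R) < 1 by lra.
  have [n0 Hn] := geo_small (N b) k01 d0; exists n0 => n /Hn.
  apply: le_lt_trans; rewrite mulrC; apply: resolvent_near => //; exact: ltW.
have : J 1 (p - x) = 0.
  by rewrite (resolventB hdot mA) // (dotcvg_unique hdot J1p J1x) subrr.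
have [z] := resolvent_ex mA (p - x) ltr01.
move=> + /[swap] J0; rewrite J0 scale1r add0r => /(mn_functional mA) -> /esym/eqP.
by rewrite subr_eq0 => /eqP.
Qed.

(** J_h J_h x lies in the domain of A^2, where the Euler scheme has its quadratic error bound. *)
Lemma resolvent2_dense x e : 0 < e ->
  exists2 y, N (x - y) < e & exists z w, A (y, z) /\ A (z, w).
Proof.
move=> e0; have [h h0 H] := resolvent_dense x (divr_gt0 e0 (ltr0n R 2)).
exists (J h (J h x)).
  rewrite (dotnormBC hdot); apply: le_lt_trans (dotnormB hdot _ (J h x) _) _.
  rewrite (splitr e) ler_ltD //.
  rewrite -(resolventB hdot mA _ _ (ltW h0)).
  exact: le_trans (resolvent_dotnorm hdot mA _ (ltW h0)) (ltW H).
have [b Ab _] := resolvent_ex mA x h0; have [c Ac _] := resolvent_ex mA b h0.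
exists (J h b), c; split => //; exact: (resolvent_op hdot mA (ltW h0) Ab).
Qed.

Lemma maximal_nonnegative_dense : densely_defined dot A.
Proof.
move=> x e /(resolvent2_dense x)[y xy [z [_ [Ay _]]]].
by exists y => //; exists z.
Qed.

(** For (y, z) in the adjoint put p + A p = y + z and x + A x = y - p. By symmetry <y - p, y - p> =
    <x + A x, y - p> = <x, (y + z) - (p + A p)> = 0, so y = p lies in the domain. *)
Lemma maximal_nonnegative_selfadjoint : selfadjoint_op dot A.
Proof.
split; first exact: maximal_nonnegative_dense.
apply/seteqP; split=> -[y z] /=; last first.
  by move=> Ay x Ax AxP; exact: (mn_symmetric mA AxP Ay).
move=> adj; have [q Aq Eq] := resolvent_ex mA (y + z) ltr01.
set p := J 1 _ in Aq Eq; rewrite scale1r in Eq.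
have [c Ac Ec] := resolvent_ex mA (y - p) ltr01.
set x := J 1 _ in Ac Ec; rewrite scale1r in Ec.
have yp : y = p.
  apply/eqP; rewrite -subr_eq0; apply/eqP; apply: (hdot_eq0 hdot).
  rewrite -{1}Ec !(dotE hdot) (adj _ _ Ac) (mn_symmetric mA Ac Aq).
  suff : dot x (y + z) = dot x (p + q) by rewrite !(dotE hdot); lra.
  by rewrite Eq.
by move: Eq; rewrite -yp => /addrI <-; rewrite yp.
Qed.

End generation.

(** * Convergence of the Euler scheme and its generator *)

Section semigroup.
Context (R : realType) (V : lmodType R) (dot : V -> V -> R).
Hypothesis hdot : hilbert dot.
Implicit Types (x y z : V) (k h e s t : R).
Local Notation N := (dotnorm dot).
Variable A : set (V * V).
Hypothesis mA : maximal_nonnegative dot A.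
Local Notation J := (resolvent A).

Lemma cvg_at0P (f : R -> R) : (forall t, 0 <= f t) ->
  (f t @[t --> 0^'+] --> 0) <->
  (forall e, 0 < e -> exists2 d, 0 < d & forall t, 0 < t -> t < d -> f t < e).
Proof.
move=> f0; split.
  move=> /cvgrPdist_lt f_ e e0; have := f_ e e0.
  case => d /= d0 H; exists d => // t t0 td.
  have := H t; rewrite /= sub0r normrN gtr0_norm // sub0r normrN ger0_norm //.
  exact.
move=> H; apply/cvgrPdist_lt => e /H[d d0 Hd]; exists d => //= t /=.
rewrite sub0r normrN => + t0; rewrite gtr0_norm // sub0r normrN ger0_norm //.
exact: Hd.
Qed.

(* The backward Euler approximation of exp (- t A) with 2 ^ n time steps. *)
Definition euler t n : V -> V := iter (2 ^ n) (J (t / 2 ^+ n)).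

Section euler_theory.
Variable t : R.
Hypothesis t0 : 0 <= t.

Lemma euler_step_ge0 n : 0 <= t / 2 ^+ n.
Proof. by rewrite divr_ge0 // exprn_ge0. Qed.

Lemma euler_linear n : linear (euler t n).
Proof. apply: iter_linear; exact: (resolvent_linear hdot mA (euler_step_ge0 n)). Qed.

Lemma euler_dotnorm n x : N (euler t n x) <= N x.
Proof. by apply: iter_dotnorm => y; apply: (resolvent_dotnorm hdot mA _ (euler_step_ge0 n)). Qed.

(** Replacing J_(2h) by J_h J_h costs h^2 N(A^2 x) per step; with 2^n steps and h = t / 2^(n+1) the
    total is of order t^2 2^-n, summable in n. *)
Lemma euler_refine n x y z : A (x, y) -> A (y, z) ->
  N (euler t n.+1 x - euler t n x) <= t ^+ 2 * N z * 2^-1 ^+ n.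
Proof.
move=> Ax Ay; set h := t / 2 ^+ n.+1.
have h0 : 0 <= h by exact: euler_step_ge0.
have hh : t / 2 ^+ n = h + h by rewrite /h exprS; field; rewrite expf_neq0.
have -> : euler t n.+1 x = iter (2 ^ n) (fun u => J h (J h u)) x.
  rewrite /euler -/h expnS mul2n -addnn.
  elim: (2 ^ n)%N x {Ax} => [//|m IH] x.
  by rewrite addSn addnS !iterSr IH.
have hh0 : 0 <= h + h by rewrite addr_ge0.
have JL s : 0 <= s -> linear (J s) by exact: (resolvent_linear hdot mA).
have JN s u : 0 <= s -> N (J s u) <= N u by exact: (resolvent_dotnorm hdot mA).
rewrite /euler hh.
apply: le_trans (iterB_dotnorm hdot _ _ _ _ _ _ _) _.
- by move=> k u v; rewrite !JL.
- exact: JL.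
- by move=> u; rewrite (le_trans (JN _ _ h0)) // JN.
- by move=> u; exact: JN.
- by move=> u; rewrite (resolvent_comm hdot mA _ h0) // (resolvent_comm hdot mA _ h0).
apply: (@le_trans _ _ ((2 ^ n)%:R * (h * h * N z))).
  by rewrite ler_wpM2l //; exact: (resolvent_mul hdot mA h0 h0 Ax Ay).
have -> : (2 ^ n)%:R * (h * h * N z) = 4^-1 * (t ^+ 2 * N z * 2^-1 ^+ n).
  by rewrite /h natrX exprS exprVn; field; rewrite expf_neq0.
rewrite ler_piMl ?mulr_ge0 ?sqr_ge0 ?dotnorm_ge0 ?exprn_ge0 ?invr_ge0 //.
by rewrite invf_le1 ?ler1n.
Qed.

Lemma euler_cvg x : exists l, dotcvg dot (euler t ^~ x) l.
Proof.
apply: (dotcvg_dense hdot euler_linear euler_dotnorm) => e /(resolvent2_dense hdot mA x).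
move=> [y xy [z [w [Ay Az]]]]; exists y => //.
apply: (geo_dotcvg hdot (k := 2^-1)) => [|n]; first by lra.
exact: euler_refine Ay Az.
Qed.

(** With h = t / 2^n the vector on the left is h times a sum of 2^n vectors y - J_h^i y. As y need
    not lie in the domain, it is compared with an element y' of the domain, at the cost of 2 N(y -
    y'). The bound does not depend on n, hence passes to the limit. *)
Lemma euler_expansion n x y y' z' : A (x, y) -> A (y', z') ->
  N (euler t n x - x + t *: y) <= t * (2 * N (y - y') + t * N z').
Proof.
move=> Ax Ay'; rewrite /euler; set h := t / 2 ^+ n.
have h0 : 0 <= h by exact: euler_step_ge0.
have th : t = (2 ^ n)%:R * h by rewrite /h natrX; field; rewrite expf_neq0.
pose c := 2 * N (y - y') + t * N z'.
have JL m : linear (iter m (J h)) by apply: iter_linear; exact: (resolvent_linear hdot mA).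
have JN m u : N (iter m (J h) u) <= N u by apply: iter_dotnorm => v; exact: (resolvent_dotnorm hdot mA).
have J' m : N (iter m (J h) y' - y') <= m%:R * (h * N z').
  elim: m => [|m IH]; first by rewrite subrr (dotnorm0 hdot) mul0r.
  apply: le_trans (dotnormB hdot _ (iter m (J h) y') _) _.
  rewrite -natr1 mulrDl mul1r addrC lerD // iterSr -linear_sub //.
  by apply: le_trans (JN _ _) _; exact: (resolvent_near hdot mA).
have Jc m : (m <= 2 ^ n)%N -> N (y - iter m (J h) y) <= c.
  move=> mn; have : N (iter m (J h) y' - iter m (J h) y) <= N (y - y').
    by rewrite -linear_sub // (dotnormBC hdot y).
  have := dotnormB hdot y y' (iter m (J h) y).
  have := dotnormB hdot y' (iter m (J h) y') (iter m (J h) y).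
  have : m%:R * (h * N z') <= t * N z'.
    by rewrite mulrA th ler_wpM2r ?dotnorm_ge0 // ler_wpM2r // ler_nat.
  by have := J' m; rewrite (dotnormBC hdot (iter m (J h) y') y') /c; lra.
suff H m : (m <= 2 ^ n)%N ->
    N (iter m (J h) x - x + (m%:R * h) *: y) <= m%:R * h * c.
  by have := H _ (leqnn _); rewrite -th.
elim: m => [_|m IH mn].
  by rewrite !mul0r subrr add0r scale0r (dotnorm0 hdot).
have -> : iter m.+1 (J h) x - x + (m.+1%:R * h) *: y =
    (iter m (J h) x - x + (m%:R * h) *: y) + h *: (y - iter m.+1 (J h) y).
  rewrite -[in iter m (J h) x](resolventE hdot mA h0 Ax) [J h x + _]addrC (JL m) -!iterSr.
  by rewrite -natr1; lincomb R V; ring.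
apply: le_trans (dotnormD hdot _ _) _; rewrite -natr1 !mulrDl mul1r.
rewrite lerD ?IH ?(ltnW mn) // (dotnormZ hdot) ger0_norm // ler_wpM2l //.
exact: Jc.
Qed.

End euler_theory.

Definition semigroup t x : V :=
  if 0 <= t then xget 0 (dotcvg dot (euler t ^~ x)) else x.
Local Notation S := semigroup.

Lemma semigroupP t x : 0 <= t -> dotcvg dot (euler t ^~ x) (S t x).
Proof.
move=> t0; rewrite /S t0; apply: xgetPex; exact: euler_cvg.
Qed.

Lemma semigroup_lin t : 0 <= t -> linear (S t).
Proof.
move=> t0 k x y; apply: (dotcvg_unique hdot (semigroupP _ t0)).
have -> : euler t ^~ (k *: x + y) = fun n => k *: euler t n x + euler t n y.
  by apply/funext => n; exact: euler_linear.
by apply: dotcvgP => //; exact: semigroupP.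
Qed.

Lemma semigroup_dotnorm t x : 0 <= t -> N (S t x) <= N x.
Proof.
move=> t0; rewrite -[S t x]subr0; apply: (dotcvg_le hdot (semigroupP x t0)) => n.
by rewrite subr0; exact: euler_dotnorm.
Qed.

Lemma semigroup_dense t s r x : 0 <= t -> 0 <= s -> 0 <= r ->
  (forall y, (exists z w, A (y, z) /\ A (z, w)) -> S t y = S s (S r y)) ->
  S t x = S s (S r x).
Proof.
move=> t0 s0 r0 H; apply/eqP; rewrite -subr_eq0; apply/eqP.
apply: (dotnorm_small2 hdot (c := 2)) => e /(resolvent2_dense hdot mA x)[y xy Ay].
have lt := semigroup_lin t0; have ls := semigroup_lin s0; have lr := semigroup_lin r0.
apply: le_trans (dotnormB hdot _ (S t y) _) _.
rewrite [S t y in X in _ + X](H _ Ay) -!linear_sub // mulr2n mulrDl mul1r.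
rewrite lerD ?(le_trans (semigroup_dotnorm _ t0) (ltW xy)) //.
apply: le_trans (semigroup_dotnorm _ s0) _.
by rewrite (le_trans (semigroup_dotnorm _ r0)) // (dotnormBC hdot) ltW.
Qed.

(** Both sides are approximated with the same number 2^n of steps: commuting resolvents interleave
    into powers of J_u J_v with u = s / 2^n and v = t / 2^n, and [resolvent_mul] bounds the distance
    to the powers of J_(u+v) by 2^n u v N(A^2 y) = s t N(A^2 y) 2^-n. *)
Lemma semigroup_add s t x : 0 <= s -> 0 <= t -> S (s + t) x = S s (S t x).
Proof.
move=> s0 t0; have st0 : 0 <= s + t by rewrite addr_ge0.
apply: semigroup_dense => // y [z [w [Ay Az]]].
apply: (dotcvg_unique hdot (u := fun n => euler s n (euler t n y))); last first.
  apply: (dotcvg_dist hdot (semigroupP (S t y) s0)) => e e0.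
  have [n0 Hn] := semigroupP y t0 e0; exists n0 => n /Hn.
  apply: le_lt_trans; rewrite -linear_sub; last exact: euler_linear.
  exact: euler_dotnorm.
apply: (dotcvg_dist hdot (semigroupP y st0)) => e e0.
have k01 : 0 <= (2^-1 : R) < 1 by lra.
have [n0 Hn] := geo_small (s * t * N w) k01 e0; exists n0 => n /Hn.
apply: le_lt_trans; set u := s / 2 ^+ n; set v := t / 2 ^+ n.
have u0 : 0 <= u by exact: euler_step_ge0.
have v0 : 0 <= v by exact: euler_step_ge0.
have JL r : 0 <= r -> linear (J r) by exact: (resolvent_linear hdot mA).
have JN r p : 0 <= r -> N (J r p) <= N p by exact: (resolvent_dotnorm hdot mA).
have JC := resolvent_comm hdot mA.
have uv0 : 0 <= u + v by rewrite addr_ge0.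
have -> : euler s n (euler t n y) = iter (2 ^ n) (fun p => J u (J v p)) y.
  rewrite /euler -/u -/v; move: (2 ^ n)%N => m.
  have JCm p i : J v (iter i (J u) p) = iter i (J u) (J v p).
    by elim: i => [//|i IH]; rewrite !iterS -IH JC.
  by elim: m => [//|m IH]; rewrite 3!iterS -JCm IH.
rewrite /euler mulrDl -/u -/v.
apply: le_trans (iterB_dotnorm hdot _ _ _ _ _ _ _) _.
- by move=> k p q; rewrite !JL.
- exact: JL.
- by move=> p; rewrite (le_trans (JN _ _ u0)) // JN.
- by move=> p; exact: JN.
- by move=> p; rewrite (JC _ _ _ v0) // (JC _ _ _ u0).
apply: (@le_trans _ _ ((2 ^ n)%:R * (u * v * N w))).
  by rewrite ler_wpM2l //; exact: (resolvent_mul hdot mA u0 v0 Ay Az).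
rewrite le_eqVlt; apply/orP; left; apply/eqP.
by rewrite /u /v natrX exprVn; field; rewrite expf_neq0.
Qed.

Lemma semigroup_expansion t x y y' z' : 0 <= t -> A (x, y) -> A (y', z') ->
  N (S t x - x + t *: y) <= t * (2 * N (y - y') + t * N z').
Proof.
move=> t0 Ax Ay'; have -> : S t x - x + t *: y = S t x - (x - t *: y).
  by lincomb R V; ring.
apply: (dotcvg_le hdot (semigroupP x t0)) => n.
have -> : euler t n x - (x - t *: y) = euler t n x - x + t *: y.
  by lincomb R V; ring.
exact: euler_expansion Ay'.
Qed.

Lemma semigroup_contraction_semigroup : contraction_semigroup dot S.
Proof.
split => //.
- exact: semigroup_lin.
- move=> x; apply: (dotcvg_unique hdot (semigroupP x (lexx 0))) => e e0.
  exists 0%N => n _; rewrite /euler mul0r.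
  by elim: (2 ^ n)%N => [|m IH]; rewrite ?subrr ?(dotnorm0 hdot) // iterS resolvent0.
- by move=> s t x; exact: semigroup_add.
- move=> x; apply/cvg_at0P => [t|e e0]; first exact: dotnorm_ge0.
  have e40 : 0 < e / 4 by rewrite divr_gt0.
  have [y xy [z [w [Ay Az]]]] := resolvent2_dense hdot mA x e40.
  pose c := 2 * N z + N w + 1.
  have c0 : 0 < c by rewrite ltr_wpDl // addr_ge0 ?mulr_ge0 ?dotnorm_ge0.
  exists (Num.min 1 (e / 4 / c)); first by rewrite lt_min ltr01 divr_gt0.
  move=> t t0; rewrite lt_min => /andP[t1]; rewrite ltr_pdivlMr // => tc.
  have tge0 := ltW t0.
  have E : N (S t y - y) < e / 4 + t * N z.
    have := semigroup_expansion tge0 Ay Az; rewrite subrr (dotnorm0 hdot) mulr0 add0r.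
    have := dotnormB hdot (S t y - y) (- (t *: z)) 0.
    rewrite !subr0 opprK (dotnormN hdot) (dotnormZ hdot) ger0_norm //.
    have := dotnorm_ge0 dot z; have := dotnorm_ge0 dot w.
    by rewrite /c in tc; nra.
  have := dotnormB hdot (S t x) (S t y) x; have := dotnormB hdot (S t y) y x.
  have : N (S t x - S t y) <= N (x - y).
    by rewrite -linear_sub; [exact: semigroup_dotnorm|exact: semigroup_lin].
  rewrite (dotnormBC hdot y x).
  have := dotnorm_ge0 dot z; have := dotnorm_ge0 dot w.
  by rewrite /c in tc; nra.
- by move=> t x; exact: semigroup_dotnorm.
Qed.

(** The expansion at 0 shows that the generator extends [op_opp A]. Conversely, a pair (x, y) of the
    generator is compared with the p such that p + A p = x - y: for w = x - p the quotient (S t w -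
    w) / t is close to w, while contractivity gives <S t w - w, w> <= 0. This forces w = 0. *)
Lemma semigroup_generatorE : semigroup_generator dot S = op_opp A.
Proof.
have sub x y : A (x, y) -> semigroup_generator dot S (x, - y).
  move=> Ax; apply/cvg_at0P => [t|e e0]; first exact: dotnorm_ge0.
  have e40 : 0 < e / 4 by rewrite divr_gt0.
  have [y' yy' [z' [_ [Ay' _]]]] := resolvent2_dense hdot mA y e40.
  have c0 : 0 < N z' + 1 by rewrite ltr_wpDl ?dotnorm_ge0.
  exists (e / 4 / (N z' + 1)); first by rewrite divr_gt0.
  move=> t t0; rewrite ltr_pdivlMr // => tc /=.
  have -> : t^-1 *: (S t x - x) - - y = t^-1 *: (S t x - x + t *: y).
    by lincomb R V; field; rewrite gt_eqF.
  rewrite (dotnormZ hdot) gtr0_norm ?invr_gt0 // mulrC ltr_pdivrMr //.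
  have := semigroup_expansion (ltW t0) Ax Ay'; move/le_lt_trans; apply.
  by rewrite mulrC ltr_pM2r //; have := dotnorm_ge0 dot z'; nra.
apply/seteqP; split => -[x y]; last first.
  by rewrite /op_opp /= => /sub; rewrite opprK.
move=> Sx; rewrite /op_opp /=.
have [q Aq Eq] := resolvent_ex mA (x - y) ltr01.
set p := J 1 _ in Aq Eq; rewrite scale1r in Eq; have Sp := sub _ _ Aq.
suff xp : x = p by move: Eq; rewrite -xp => /addrI <-; rewrite xp.
apply/eqP; rewrite -subr_eq0; apply/eqP; apply: (dotnorm_small2 hdot (c := 2)) => e e0.
have H (P : V * V) : semigroup_generator dot S P -> exists2 d, 0 < d &
    forall t, 0 < t -> t < d -> N (t^-1 *: (S t P.1 - P.1) - P.2) < e.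
  by move/cvg_at0P => H; apply: H => // t; exact: dotnorm_ge0.
have [d1 d10 H1] := H _ Sx; have [d2 d20 H2] := H _ Sp.
pose t := Num.min d1 d2 / 2.
have m0 : 0 < Num.min d1 d2 by rewrite lt_min d10.
have t0 : 0 < t by rewrite divr_gt0.
have tm : t < Num.min d1 d2 by rewrite /t; lra.
have {tm}[t1 t2] : t < d1 /\ t < d2 by move: tm; rewrite lt_min => /andP[].
have {H1 H2} := (H1 _ t0 t1, H2 _ t0 t2) => /= -[H1 H2].
pose w := x - p; pose r := t^-1 *: (S t w - w) - w.
have rw : N r <= 2 * e.
  have -> : r = (t^-1 *: (S t x - x) - y) - (t^-1 *: (S t p - p) - - q).
    have -> : q = x - y - p by rewrite -Eq addrC addKr.
    rewrite /r /w (linear_sub _ _ (semigroup_lin (ltW t0))).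
    by lincomb R V; ring.
  have := dotnormD hdot (t^-1 *: (S t x - x) - y) (- (t^-1 *: (S t p - p) - - q)).
  by rewrite (dotnormN hdot); lra.
have Sw : dot (S t w) w <= N w * N w.
  rewrite (le_trans (dot_le_dotnorm hdot _ _)) // ler_wpM2r ?dotnorm_ge0 //.
  exact: semigroup_dotnorm (ltW t0).
have : dot w w <= - dot r w.
  have -> : dot r w = t^-1 * (dot (S t w) w - dot w w) - dot w w.
    have E a b : dot (t^-1 *: (a - b) - b) b = t^-1 * (dot a b - dot b b) - dot b b.
      by rewrite !(dotE hdot).
    exact: E.
  have : t^-1 * (dot (S t w) w - dot w w) <= 0.
    by rewrite pmulr_rle0 ?invr_gt0 // subr_le0 -(dotnorm_sqr hdot w) expr2.
  lra.
rewrite -(dotNl hdot) -(dotnorm_sqr hdot).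
move=> /le_trans/(_ (dot_le_dotnorm hdot _ _)); rewrite (dotnormN hdot) -/w.
have [->|w0] := eqVneq (N w) 0; first by move=> _; rewrite mulr_ge0 // ltW.
have w00 : 0 < N w by rewrite lt_def w0 dotnorm_ge0.
by rewrite expr2 ler_pM2r // => /le_trans; apply.
Qed.

Theorem maximal_nonnegative_generates :
  generates_contraction_semigroup dot (op_opp A).
Proof.
exists S; [exact: semigroup_contraction_semigroup|exact: semigroup_generatorE].
Qed.

End semigroup.

(** * Absolutely continuous functions and integration on [0, 1] *)

Section real_induction.
Context {R : realType}.
Implicit Types (c d x y z : R) (f : R -> R).

(** The supremum of the points where Q holds can only be d. The step goes from a point on the left
    of y to one on its right, the form in which a derivative at y, or a neighbourhood of y, provides
    information. *)
Lemma real_induction c d (Q : R -> Prop) : c <= d -> Q c ->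
  (forall y, c <= y <= d -> exists2 r, 0 < r & forall x z,
    c <= x <= y -> y <= z <= d -> y - r < x -> z < y + r -> Q x -> Q z) ->
  Q d.
Proof.
move=> cd Qc step; pose S : set R := [set x | c <= x <= d /\ Q x].
have Sc : S c by split=> //; rewrite lexx.
have Sd : ubound S d by move=> x [/andP[]].
have hS : has_sup S by split; [exists c|exists d].
have yc : c <= sup S by apply: ub_le_sup => //; exists d.
have yd : sup S <= d by apply: ge_sup => //; exists c.
have [|r r0 H] := step (sup S); first by rewrite yc.
have [x [/andP[cx xd] Qx] xS] := sup_adherent r0 hS.
have xs : x <= sup S by apply: ub_le_sup; [exists d|split => //; rewrite cx].
pose z := Num.min d (sup S + r / 2).
have sz : sup S <= z by rewrite le_min yd lerDl divr_ge0 // ltW.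
have zd : z <= d by rewrite ge_min lexx.
have zr : z < sup S + r by rewrite gt_min; apply/orP; right; lra.
have Qz : Q z by apply: (H x z) => //; [rewrite cx|rewrite sz].
have : z <= sup S by apply: ub_le_sup; [exists d|split => //; rewrite zd (le_trans yc)].
rewrite ge_min => /orP[ds|]; last by rewrite gerDl leNgt divr_gt0.
suff -> : d = z by [].
by apply/eqP; rewrite eq_le zd andbT (le_trans ds).
Qed.

Lemma is_derive_near f x l e : is_derive x (1 : R) f l -> 0 < e ->
  exists2 r, 0 < r & forall z, `|z - x| < r ->
    `|f z - f x - l * (z - x)| <= e * `|z - x|.
Proof.
move=> [df <-] e0; have /cvgrPdist_le /(_ e e0) [r r0 H] := df.
exists r => // z zx; have [->|zx0] := eqVneq z x.
  by rewrite !subrr mulr0 subrr normr0 mulr0.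
have zx0' : z - x != 0 by rewrite subr_eq0.
have := H (z - x); rewrite /= sub0r normrN => /(_ zx zx0').
rewrite -[(z - x) *: (1 : R)]/((z - x) * 1) mulr1 subrK.
rewrite -[_^-1 *: _]/(_^-1 * _) => h.
have -> : f z - f x - 'D_1 f x * (z - x) =
    - ('D_1 f x - (z - x)^-1 * (f z - f x)) * (z - x) by field.
by rewrite normrM normrN ler_wpM2r.
Qed.

End real_induction.

(** * An absolutely continuous function with zero derivative is constant *)

Section absolute_continuity.
Context {R : realType}.
Implicit Types (c d x y z : R) (f : R -> R).
Local Notation mu := (@lebesgue_measure R).

Lemma abs_continuousS c d c' d' f : c <= c' -> d' <= d ->
  abs_continuous c d f -> abs_continuous c' d' f.
Proof.
move=> cc dd fA e /fA[del del0 H]; exists del => // s sc; apply: H.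
by apply: sub_all sc => p /and3P[h1 h2 h3]; rewrite (le_trans cc h1) h2 (le_trans h3).
Qed.

(* Real induction on b: [c, b] is covered by short intervals around points where
   f' = 0, on which f varies by at most k (z - x), and by intervals contained in an
   open set U of small measure, which absolute continuity controls. *)
Lemma abs_continuous_derivative0 c d f : abs_continuous c d f ->
  {ae mu, forall x, c < x < d -> is_derive x (1 : R) f 0} ->
  forall x, c <= x <= d -> f x = f c.
Proof.
move=> fA [N [mN N0 fN]] b /andP[cb bd].
apply/eqP; rewrite -subr_eq0 -normr_eq0 eq_le normr_ge0 andbT.
apply/ler_addgt0Pr => e e0; rewrite add0r.
have [del del0 H] := fA _ (divr_gt0 e0 (ltr0n R 2)).
pose E := N `|` [set c] `|` [set d].
have mE : measurable E by do 2 (apply: measurableU => //).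
have E0 : (mu E <= 0)%E.
  have n1 z : mu.-negligible [set z].
    by apply/negligibleP => //; exact: lebesgue_measure_set1.
  rewrite measure_negligible //; do 2 (apply: negligibleU => //).
  exists N; split; [exact: mN|exact: N0|exact: subset_refl].
have [|U [oU EU mU]] := lebesgue_regularity_outer mE _ del0.
  by rewrite (le_lt_trans E0).
have {}mU : (mu U < del%:E)%E.
  rewrite -[U](setDUK EU) (le_lt_trans (measureU2 _ _ _)) //.
    by apply: measurableD => //; exact: open_measurable.
  by rewrite (le_lt_trans _ mU) // -[leRHS]add0e leeD2r.
(* Chosen so that k (b - c) <= e / 2; the added 1 covers b = c. *)
pose k := e / 2 / (b - c + 1).
have k0 : 0 < k by rewrite !divr_gt0 // ltr_wpDl ?subr_ge0.
(* The hypothesis on the lengths is stated with the measure of U on the left of x, rather than with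
   [del], so that it can be carried along the induction. *)
pose Q x := exists s : seq (R * R), [/\
  all (fun p => [&& c <= p.1, p.1 <= p.2 & p.2 <= x]) s,
  pairwise (fun p q => (p.2 <= q.1) || (q.2 <= p.1)) s,
  ((\sum_(p <- s) (p.2 - p.1))%:E <= mu (U `&` `]c, x]))%E &
  `|f x - f c| <= k * (x - c) + \sum_(p <- s) `|f p.2 - f p.1| ].
have mUx (x y : R) : measurable (U `&` `]x, y] : set (measurableTypeR R)).
  by apply: measurableI => //; exact: open_measurable.
have Uxy x y : c <= x -> x <= y ->
    mu (U `&` `]c, y]) = (mu (U `&` `]c, x]) + mu (U `&` `]x, y]))%E.
  move=> cx xy; rewrite -measureU //.
    rewrite -setIUr; congr (mu (_ `&` _)).
    by rewrite -itv_bndbnd_setU // bnd_simp.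
  apply/seteqP; split => // w /= [[_ +] [_]].
  by rewrite !in_itv /= => /andP[_ wx] /andP[/(le_lt_trans wx)]; rewrite ltxx.
have [s [sc sp sm sf]] : Q b.
  apply: (@real_induction _ c) => //.
    exists [::]; split => //=; rewrite ?big_nil ?measure_ge0 //.
    by rewrite !subrr normr0 mulr0 addr0.
  move=> y /andP[cy yb]; have [Uy|Uy] := pselect (U y).
    have [r r0 Ur] : exists2 r : R, 0 < r & ball y r `<=` U.
      by have /nbhs_ballP[r r0 Ur] := open_nbhs_nbhs (conj oU Uy); exists r.
    exists r => // x z /andP[cx xy] /andP[yz zb] rx zr [s [sc sp sm sf]].
    have xz := le_trans xy yz.
    exists ((x, z) :: s); split => /=.
    - rewrite cx xz lexx /=; apply: sub_all sc => p /and3P[-> -> px] /=.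
      exact: le_trans xz.
    - rewrite sp andbT; apply: sub_all sc => p /and3P[h1 h2 px].
      by apply/orP; right.
    - rewrite big_cons /= EFinD (Uxy _ _ cx xz) addeC leeD //.
      have -> : U `&` `]x, z] = `]x, z]%classic.
        apply/setIidPr => w /=; rewrite in_itv /= => /andP[xw wz].
        by apply: Ur; rewrite /ball /= ltr_norml; apply/andP; split; lra.
      rewrite lebesgue_measure_itv /= lte_fin; case: ltP => // zx.
      by rewrite lee_fin subr_le0.
    - rewrite big_cons /=; have := ler_distD (f x) (f z) (f c).
      have : k * (x - c) <= k * (z - c) by rewrite ler_pM2l // lerD2r.
      lra.
  have ny : c < y < d /\ ~ N y.
    split; last by move=> Ny; apply: Uy; apply: EU; left; left.
    rewrite !lt_def; apply/andP; split; apply/andP; split => //.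
    - by apply/eqP => yc; apply: Uy; apply: EU; left; right.
    - by apply/eqP => yc; apply: Uy; apply: EU; right.
    - exact: le_trans bd.
  have dy : is_derive y (1 : R) f 0.
    by apply: contrapT => nd; apply: ny.2; apply: fN => /= /(_ ny.1).
  have [r r0 Hr] := is_derive_near dy k0.
  exists r => // x z /andP[cx xy] /andP[yz zb] rx zr [s [sc sp sm sf]].
  have xz := le_trans xy yz.
  exists s; split => //.
  - by apply: sub_all sc => p /and3P[-> -> px]; exact: le_trans xz.
  - by rewrite (le_trans sm) // (Uxy _ _ cx xz) leeDl.
  - have := Hr x; rewrite mul0r subr0 (distrC x) (distrC (f x)) ger0_norm ?subr_ge0 // => Hx.
    have := Hr z; rewrite mul0r subr0 ger0_norm ?subr_ge0 // => Hz.
    have := Hx ltac:(lra); have := Hz ltac:(lra).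
    have := ler_distD (f y) (f z) (f c); have := ler_distD (f x) (f y) (f c).
    lra.
have sum_del : \sum_(p <- s) (p.2 - p.1) < del.
  rewrite -lte_fin (le_lt_trans sm) // (le_lt_trans _ mU) // le_measure ?inE //.
  exact: open_measurable.
have := H s _ sp sum_del.
have -> : all (fun p => [&& c <= p.1, p.1 <= p.2 & p.2 <= d]) s.
  by apply: sub_all sc => p /and3P[-> -> pb]; exact: le_trans bd.
move=> /(_ isT); suff : k * (b - c) <= e / 2 by lra.
rewrite /k mulrAC ler_pdivrMr ?ltr_wpDl ?subr_ge0 // ler_pM2l ?divr_gt0 //.
by rewrite lerDl.
Qed.

End absolute_continuity.

(** * Primitives of integrable functions on ]0, 1[ *)

Section primitive.
Context {R : realType}.
Implicit Types (c d x y z k : R) (f g : R -> R).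
Local Notation mu := (@lebesgue_measure R).
Local Notation I01 := (`]0, 1[%classic : set (measurableTypeR R)).

Lemma ae_mu01P (P : R -> Prop) :
  (\forall x \ae mu01 R, P x) <-> {ae mu, forall x, 0 < x < 1 -> P x}.
Proof.
split=> -[B [mB B0 PB]].
  exists (B `&` I01); split; [exact: measurableI|exact: B0|].
  move=> x /= /not_implyP[x01 nP]; split; last by rewrite /= in_itv.
  exact: PB.
exists (B `|` ~` I01); split.
- by apply: measurableU => //; exact: measurableC.
- rewrite /mu01 /= /mrestr setIUl setICl setU0.
  apply/eqP; rewrite eq_le measure_ge0 andbT.
  rewrite -[leRHS]B0 le_measure // inE //; exact: measurableI.
- move=> x /= nP; have [x01|x01] := pselect (0 < x < 1).
    by left; apply: PB => /= /(_ x01).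
  by right; rewrite /= in_itv.
Qed.

Definition L1_01 f : Prop := mu.-integrable I01 (EFin \o f).

Definition cut01 f : R -> R := f \_ I01.

(** Cutting f off outside ]0, 1[ makes the primitive a function on the whole line, zero on the left
    of 0, constant on the right of 1 and absolutely continuous everywhere, without side conditions
    at the end points. *)
Definition prim f x : R := \int[mu]_(t in `]-oo, x]) cut01 f t.

Definition L1_norm01 f : R := \int[mu]_(t in I01) `|f t|.

Lemma cut01E f x : 0 < x < 1 -> cut01 f x = f x.
Proof. by move=> x01; rewrite /cut01 patchE mem_set // /= in_itv. Qed.

Lemma cut010 f x : ~~ (0 < x < 1) -> cut01 f x = 0.
Proof. by move=> x01; rewrite /cut01 patchE memNset // /= in_itv /=; apply/negP. Qed.

Lemma cut01_integrable f (D : set (measurableTypeR R)) : measurable D ->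
  L1_01 f -> mu.-integrable D (EFin \o cut01 f).
Proof.
move=> mD f1; apply: (@integrableS _ _ _ _ setT) => //.
rewrite /cut01 -restrict_EFin; by apply: (iffLR (integrable_mkcond _ _)) f1.
Qed.

Lemma prim_itv f x y : L1_01 f -> x <= y ->
  prim f y - prim f x = \int[mu]_(t in `]x, y]) cut01 f t.
Proof.
move=> f1 xy; rewrite /prim; apply: Rintegral_itvB; last 2 first.
- by [].
- by rewrite bnd_simp.
exact: cut01_integrable.
Qed.

Lemma prim_le0 f x : x <= 0 -> prim f x = 0.
Proof.
move=> x0; rewrite /prim (_ : 0 = \int[mu]_(t in `]-oo, x]) (cst 0 t)) ; last first.
  by rewrite Rintegral_cst // mul0r.
apply: eq_Rintegral => t; rewrite inE /= in_itv /= => tx.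
by rewrite cut010 // negb_and -leNgt (le_trans tx).
Qed.

Lemma prim_cst0 x : prim (cst 0) x = 0.
Proof.
transitivity (\int[mu]_(t in `]-oo, x]) (cst 0 t)); last first.
  by rewrite Rintegral_cst // mul0r.
apply: eq_Rintegral => t _.
by case/boolP: (0 < t < 1) => t01; [rewrite cut01E|rewrite cut010].
Qed.

Lemma prim_ge1 f x : 1 <= x -> prim f x = \int[mu]_(t in I01) f t.
Proof.
move=> x1; rewrite /prim Rintegral_mkcond [RHS]Rintegral_mkcond.
apply: eq_Rintegral => t _; rewrite [LHS]patchE; case: ifPn => //.
rewrite notin_setE /= in_itv /= => /negP; rewrite -ltNge => xt.
rewrite patchE memNset //= in_itv /= => /andP[_ t1].
by have := lt_trans t1 (le_lt_trans x1 xt); rewrite ltxx.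
Qed.

Lemma L1P k f g : L1_01 f -> L1_01 g -> L1_01 (fun x => k * f x + g x).
Proof.
move=> f1 g1; apply: (@integrableD _ _ _ mu I01 _ (EFin \o (fun x => k * f x)) (EFin \o g)) => //.
exact: integrableZl f1.
Qed.

Lemma primP k f g x : L1_01 f -> L1_01 g ->
  prim (fun x => k * f x + g x) x = k * prim f x + prim g x.
Proof.
move=> f1 g1; rewrite /prim -RintegralZl //; last exact: cut01_integrable.
rewrite -RintegralD //.
- apply: eq_Rintegral => t _; case/boolP: (0 < t < 1) => t01.
    by rewrite !cut01E.
  by rewrite !cut010 // mulr0 addr0.
- apply: (@integrableZl _ _ _ mu _ _ k (EFin \o cut01 f)) => //; exact: cut01_integrable.
- exact: cut01_integrable.
Qed.

Lemma L1_ae f g : (\forall x \ae mu01 R, f x = g x) -> measurable_fun I01 g ->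
  L1_01 f -> L1_01 g.
Proof.
move=> /ae_mu01P fg mg /integrableP[mf fi]; apply/integrableP; split.
  exact/measurable_EFinP.
suff -> : (\int[mu]_(x in I01) `|(EFin \o g) x| = \int[mu]_(x in I01) `|(EFin \o f) x|)%E by [].
apply: ae_eq_integral => //.
- by apply/measurableT_comp => //; exact/measurable_EFinP.
- exact: measurableT_comp.
- apply: filterS fg; first exact: (ae_filter_ringOfSetsType mu).
  by move=> x /= fg xI; rewrite fg //; move: xI; rewrite /= in_itv.
Qed.

Lemma prim_ae f g x : (\forall x \ae mu01 R, f x = g x) ->
  L1_01 f -> L1_01 g -> prim f x = prim g x.
Proof.
move=> /ae_mu01P fg f1 g1; congr fine; apply: ae_eq_integral => //.
- by have /integrableP[] := cut01_integrable (measurable_itv `]-oo, x]) f1.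
- by have /integrableP[] := cut01_integrable (measurable_itv `]-oo, x]) g1.
apply: filterS fg; first exact: (ae_filter_ringOfSetsType mu).
move=> t /= fg _; case/boolP: (0 < t < 1) => t01.
  by rewrite !cut01E // fg.
by rewrite !cut010.
Qed.

Lemma L1_measurable f : L1_01 f -> measurable_fun I01 f.
Proof. by case/integrableP => /measurable_EFinP. Qed.

Lemma L1_le f g : measurable_fun I01 f -> (forall x, 0 < x < 1 -> `|f x| <= g x) ->
  L1_01 g -> L1_01 f.
Proof.
move=> mf fg; apply: le_integrable => //; first exact/measurable_EFinP.
move=> x /=; rewrite in_itv /= => /fg xg; rewrite lee_fin.
exact: le_trans xg (ler_norm _).
Qed.

Lemma L1_abs f : L1_01 f -> L1_01 (fun x => `|f x|).
Proof. exact: integrable_norm. Qed.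

Lemma lebesgue_measure_I01 : mu I01 = 1%E.
Proof. by rewrite lebesgue_measure_itv /= lte_fin ltr01 oppr0 adde0. Qed.

Lemma L1_cst k : L1_01 (cst k).
Proof.
apply: measurable_bounded_integrable => //.
- by apply: le_lt_trans (ltry 1); rewrite -lebesgue_measure_I01.
- by exists `|k|; split; [exact: normr_real|move=> M kM x _ /=; exact: ltW].
Qed.

Lemma L1_bounded f k : measurable_fun I01 f ->
  (forall x, 0 < x < 1 -> `|f x| <= k) -> L1_01 f.
Proof. by move=> mf fk; exact: (L1_le mf fk (L1_cst k)). Qed.

Lemma L1M f g k : L1_01 f -> measurable_fun I01 g ->
  (forall x, 0 < x < 1 -> `|g x| <= k) -> L1_01 (fun x => f x * g x).
Proof.
move=> f1 mg gk; have f1a := L1_abs f1.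
apply: (@L1_le _ (fun x => k * `|f x| + 0)).
- exact: measurable_funM (L1_measurable f1) mg.
- by move=> x x01; rewrite addr0 normrM mulrC ler_wpM2r ?gk.
- exact: (L1P k f1a (L1_cst 0)).
Qed.

Lemma L1_norm_ge0 f : 0 <= L1_norm01 f.
Proof. by apply: Rintegral_ge0. Qed.

Lemma prim_le f g x y : L1_01 f -> L1_01 g ->
  (forall x, 0 < x < 1 -> `|f x| <= g x) -> x <= y ->
  `|prim f y - prim f x| <= prim g y - prim g x.
Proof.
move=> f1 g1 fg xy; rewrite !prim_itv //.
apply: le_trans (le_normr_Rintegral _ _) _ => //; first exact: cut01_integrable.
apply: le_Rintegral => //; last 2 first.
- exact: cut01_integrable.
- move=> t _; case/boolP: (0 < t < 1) => t01; first by rewrite !cut01E // fg.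
  by rewrite !cut010 // normr0.
apply: (@integrable_norm _ _ _ mu _ (cut01 f)); exact: cut01_integrable.
Qed.

Lemma prim_homo g x y : L1_01 g -> (forall x, 0 < x < 1 -> 0 <= g x) -> x <= y ->
  prim g x <= prim g y.
Proof.
move=> g1 g0 xy; rewrite -subr_ge0 prim_itv // Rintegral_ge0 // => t _.
case/boolP: (0 < t < 1) => t01; last by rewrite cut010.
by rewrite cut01E // g0.
Qed.

Lemma prim_normr f x y : L1_01 f -> x <= y ->
  `|prim f y - prim f x| <= L1_norm01 f.
Proof.
move=> f1 xy; have fa := L1_abs f1; pose g t := `|f t|.
have g0 t : 0 < t < 1 -> 0 <= g t by rewrite normr_ge0.
apply: (@le_trans _ _ (prim g y - prim g x)); first exact: prim_le.
have x0 : 0 <= prim g x.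
  by rewrite -(@prim_le0 g (Num.min x 0)) ?prim_homo // ge_min lexx ?orbT.
have y1 : prim g y <= L1_norm01 f.
  apply: (@le_trans _ _ (prim g (Num.max y 1))).
    by rewrite prim_homo // le_max lexx.
  by rewrite prim_ge1 // le_max lexx orbT.
lra.
Qed.

Import HBSimple.

Lemma L1_split_bounded f e : L1_01 f -> 0 < e -> exists g k,
  [/\ L1_01 g, forall x, 0 < x < 1 -> `|g x| <= k &
      L1_norm01 (fun x => f x - g x) < e].
Proof.
move=> f1 e0.
have [//|s_ [si _ sf]] := @approximation_sfun_integrable _ _ _ mu I01 _ _ f1.
have /fine_cvgP[fs /cvgrPdist_lt /(_ e e0) se] := sf.
near \oo => n; have sn : L1_01 (s_ n) by exact: si.
have [k [_ ks]] := simple_bounded (s_ n).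
exists (s_ n), (k + 1); split => //.
  by move=> x _; apply: ks => //; rewrite ltrDl.
have : `|0 - fine (\int[mu]_(z in I01) `|(EFin \o f) z - (s_ n z)%:E|)| < e.
  by near: n.
rewrite sub0r normrN; apply: le_lt_trans; exact: ler_norm.
Unshelve. all: by end_near. Qed.

Lemma L1_norm_sum f (s : seq (R * R)) : L1_01 f ->
  all (fun p => p.1 <= p.2) s ->
  pairwise (fun p q => (p.2 <= q.1) || (q.2 <= p.1)) s ->
  \sum_(p <- s) (prim (fun x => `|f x|) p.2 - prim (fun x => `|f x|) p.1) <= L1_norm01 f.
Proof.
move=> f1; have fa := L1_abs f1; pose g t := `|f t|; rewrite -/g => sl sp.
have E (p : R * R) : p.1 <= p.2 ->
   (prim g p.2 - prim g p.1)%:E = (\int[mu]_(t in `]p.1, p.2]) (cut01 g t)%:E)%E.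
  move=> pl; rewrite prim_itv // /Rintegral fineK //.
  by apply: integrable_fin_num => //; exact: cut01_integrable.
pose U (s : seq (R * R)) : set (measurableTypeR R) :=
   \big[setU/set0]_(p <- s) `]p.1, p.2]%classic.
have mU s' : measurable (U s') by apply: bigsetU_measurable.
have Uin s' x : U s' x -> exists2 p, p \in s' & p.1 < x <= p.2.
  rewrite /U; elim: s' => [|p s' IH]; first by rewrite big_nil.
  rewrite big_cons => -[|/IH[q qs xq]].
    by rewrite /= in_itv /= => xp; exists p => //; rewrite mem_head.
  by exists q => //; rewrite inE qs orbT.
have mg (D : set (measurableTypeR R)) : measurable D ->
    measurable_fun D (EFin \o cut01 g).
  by move=> mD; have /integrableP[] := cut01_integrable mD fa.
have g0 x : (0 <= (cut01 g x)%:E)%E.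
  rewrite lee_fin; case/boolP: (0 < x < 1) => x01; last by rewrite cut010.
  by rewrite cut01E // normr_ge0.
have sum s' : all (fun p => p.1 <= p.2) s' ->
  pairwise (fun p q => (p.2 <= q.1) || (q.2 <= p.1)) s' ->
  (\sum_(p <- s') (prim g p.2 - prim g p.1))%:E = (\int[mu]_(t in U s') (cut01 g t)%:E)%E.
  elim: s' => [_ _|p s' IH /= /andP[pl sl'] /andP[ps sp']].
    by rewrite big_nil /U big_nil integral_set0.
  rewrite big_cons EFinD E // IH // /U big_cons ge0_integral_setU //.
  - exact: mU.
  - by apply: mg; apply: measurableU => //; exact: mU.
  rewrite disj_set2E; apply/eqP/seteqP; split => // x [].
  rewrite /= in_itv /= => /andP[px xp] /Uin[q qs /andP[qx xq]].
  have /orP[h|h] := allP ps _ qs.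
    by have := lt_le_trans (le_lt_trans h qx) xp; rewrite ltxx.
  by have := lt_le_trans (le_lt_trans h px) xq; rewrite ltxx.
rewrite -lee_fin sum //.
have -> : (L1_norm01 f)%:E = (\int[mu]_t (cut01 g t)%:E)%E.
  rewrite /L1_norm01 /Rintegral fineK.
    by rewrite integral_mkcond; apply: eq_integral => t _; rewrite restrict_EFin.
  by apply: integrable_fin_num => //; exact: fa.
by apply: ge0_subset_integral => //; exact: mg.
Qed.

End primitive.

(** * Absolute continuity, differentiability and uniqueness of primitives *)

Section primitive_ac.
Context {R : realType}.
Implicit Types (c d x y z k : R) (f g F G : R -> R).
Local Notation mu := (@lebesgue_measure R).
Local Notation I01 := (`]0, 1[%classic : set (measurableTypeR R)).

Lemma prim_lipschitz f k x y : L1_01 f -> (forall x, 0 < x < 1 -> `|f x| <= k) ->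
  x <= y -> `|prim f y - prim f x| <= k * (y - x).
Proof.
move=> f1 fk xy; rewrite prim_itv //.
have k0 : 0 <= k by rewrite (le_trans (normr_ge0 _) (fk (1 / 2) _)) //; lra.
have mxy : (mu `]x, y] = (y - x)%:E)%E.
  rewrite lebesgue_measure_itv /= lte_fin; case: ltP => // yx.
  by have -> : x = y by [apply/eqP; rewrite eq_le xy]; rewrite subrr.
have int1 : mu.-integrable `]x, y] (EFin \o cut01 f) by exact: cut01_integrable.
apply: le_trans (le_normr_Rintegral _ int1) _ => //.
have -> : k * (y - x) = \int[mu]_(t in `]x, y]) (cst k t).
  by rewrite Rintegral_cst //= mxy.
apply: le_Rintegral => //.
- exact: integrable_norm int1.
- apply: measurable_bounded_integrable => //.
    by apply: le_lt_trans (ltry (y - x)); rewrite -mxy.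
  by exists `|k|; split; [exact: normr_real|move=> M kM t _ /=; exact: ltW].
- move=> t _; case/boolP: (0 < t < 1) => t01; first by rewrite cut01E // fk.
  by rewrite cut010 // normr0.
Qed.

Lemma abs_continuousP k c d F G : abs_continuous c d F -> abs_continuous c d G ->
  abs_continuous c d (fun x => k * F x + G x).
Proof.
move=> FA GA e e0; have k1 : 0 < 2 * (`|k| + 1) by rewrite mulr_gt0 // ltr_wpDl.
have [d1 d10 H1] := FA _ (divr_gt0 e0 k1).
have [d2 d20 H2] := GA _ (divr_gt0 e0 (ltr0n R 2)).
exists (Num.min d1 d2); first by rewrite lt_min d10.
move=> s s1 s2; rewrite lt_min => /andP[/(H1 _ s1 s2) h1 /(H2 _ s1 s2) h2].
apply: (@le_lt_trans _ _ (\sum_(p <- s) (`|k| * `|F p.2 - F p.1| + `|G p.2 - G p.1|))).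
  apply: ler_sum => p _; rewrite -normrM.
  have -> : k * F p.2 + G p.2 - (k * F p.1 + G p.1) =
    k * (F p.2 - F p.1) + (G p.2 - G p.1) by ring.
  exact: ler_normD.
rewrite big_split -mulr_sumr /= (splitr e) ler_ltD //.
have : \sum_(p <- s) `|F p.2 - F p.1| * (2 * (`|k| + 1)) <= e.
  by rewrite -mulr_suml -ler_pdivlMr // ltW.
have : 0 <= \sum_(p <- s) `|F p.2 - F p.1| by apply: sumr_ge0.
by rewrite -mulr_suml; have := normr_ge0 k; nra.
Qed.

(** Split f into a function bounded by k and a remainder of L^1 norm below e / 2: the first
    contributes at most k times the total length of the intervals, the second at most its norm, the
    intervals being disjoint. *)
Lemma prim_abs_continuous f c d : L1_01 f -> abs_continuous c d (prim f).
Proof.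
move=> f1 e e0; have e20 : 0 < e / 2 by rewrite divr_gt0.
have [g [k [g1 gk fg]]] := L1_split_bounded f1 e20.
have k0 : 0 <= k by rewrite (le_trans (normr_ge0 _) (gk (1 / 2) _)) //; lra.
exists (e / 2 / (k + 1)); first by rewrite divr_gt0 // ltr_wpDl.
move=> s s1 s2; rewrite ltr_pdivlMr ?ltr_wpDl // => sl.
pose h x := -1 * g x + f x.
have h1 : L1_01 h by exact: L1P.
have sl1 : all (fun p => p.1 <= p.2) s by apply: sub_all s1 => p /and3P[].
have L : \sum_(p <- s) `|prim f p.2 - prim f p.1| <=
  \sum_(p <- s) (k * (p.2 - p.1) + (prim (fun x => `|h x|) p.2 - prim (fun x => `|h x|) p.1)).
  rewrite big_seq [leRHS]big_seq; apply: ler_sum => p ps.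
  have pl := allP sl1 _ ps.
  have -> : prim f p.2 - prim f p.1 =
    (prim g p.2 - prim g p.1) + (prim h p.2 - prim h p.1).
    by rewrite /h !(primP _ _ g1 f1); ring.
  apply: le_trans (ler_normD _ _) _; rewrite lerD //; first exact: prim_lipschitz.
  by apply: prim_le => //; exact: L1_abs.
apply: le_lt_trans L _; rewrite big_split /= -mulr_sumr (splitr e).
apply: ler_ltD; last first.
  apply: le_lt_trans (L1_norm_sum h1 sl1 s2) _.
  by apply: le_lt_trans fg; rewrite le_eqVlt; apply/orP; left; apply/eqP;
    apply: eq_Rintegral => x _; rewrite /h mulN1r addrC.
have : 0 <= \sum_(p <- s) (p.2 - p.1).
  by rewrite big_seq; apply: sumr_ge0 => p /(allP sl1); rewrite subr_ge0.
nra.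
Qed.

Lemma prim_ae_derivative f : L1_01 f -> ae_derivative (prim f) f.
Proof.
move=> f1; apply/ae_mu01P.
have loc : locally_integrable setT (cut01 f).
  by apply: integrable_locally_restrict => //; exact: f1.
have := FTC1Ny (fun y => cut01_integrable (measurable_itv `]-oo, y]) f1) loc.
apply: filterS; first exact: (ae_filter_ringOfSetsType mu).
move=> x /= [dx dE] x01; split => //.
by rewrite -derive1E dE cut01E.
Qed.

Lemma abs_continuous_continuous F x : (forall c d, abs_continuous c d F) ->
  {for x, continuous F}.
Proof.
move=> FA; apply/cvgrPdist_lt => e /(FA (x - 1) (x + 1))[del del0 H].
exists (Num.min 1 del); first by rewrite /= lt_min ltr01.
move=> y /=; rewrite lt_min => /andP[xy1 xyd].
have [xy|yx] := leP x y.
  have := H [:: (x, y)]; rewrite !big_seq1 /= distrC; apply => //.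
    rewrite xy !andbT lerBlDr lerDl ler01 /=.
    by move: xy1; rewrite distrC ger0_norm ?subr_ge0 //; lra.
  by move: xyd; rewrite distrC ger0_norm ?subr_ge0.
have := H [:: (y, x)]; rewrite !big_seq1 /=; apply => //.
  rewrite (ltW yx) !andbT lerDl ler01 andbT.
  by move: xy1; rewrite gtr0_norm ?subr_gt0 //; lra.
by move: xyd; rewrite gtr0_norm ?subr_gt0.
Qed.

Lemma prim_continuous f : L1_01 f -> continuous (prim f).
Proof.
by move=> f1 x; apply: abs_continuous_continuous => c d; exact: prim_abs_continuous.
Qed.

Lemma prim_unique F f c d : 0 <= c -> d <= 1 -> abs_continuous c d F ->
  {ae mu, forall x, c < x < d -> is_derive x (1 : R) F (f x)} -> L1_01 f ->
  forall x, c <= x <= d -> F x = F c + (prim f x - prim f c).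
Proof.
move=> c0 d1 FA Ff f1 x xcd; have pA := prim_abs_continuous c d f1.
have /ae_mu01P pf := prim_ae_derivative f1.
have H := @abs_continuous_derivative0 _ c d _ (abs_continuousP (-1) pA FA) _ x xcd.
have {}H : -1 * prim f x + F x = -1 * prim f c + F c.
  apply: H.
  apply: filterS2 pf Ff; first exact: (ae_filter_ringOfSetsType mu).
  move=> y /= py Fy /andP[cy yd].
  have {}py : is_derive y (1 : R) (prim f) (f y).
    by apply: py; rewrite (le_lt_trans c0 cy) (lt_le_trans yd).
  have {}Fy : is_derive y (1 : R) F (f y) by apply: Fy; rewrite cy.
  rewrite (_ : (fun x => _) = (-1) \*: prim f + F) //.
  by apply: is_derive_eq; rewrite scaleN1r addNr.
lra.
Qed.

Lemma prim_unique01 F f : abs_continuous 0 1 F -> ae_derivative F f -> L1_01 f ->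
  forall x, 0 <= x <= 1 -> F x = F 0 + prim f x.
Proof.
move=> FA /ae_mu01P Ff f1 x x01.
by rewrite (prim_unique _ _ FA Ff f1 x01) // (prim_le0 f (lexx 0)) subr0.
Qed.

Lemma continuous_measurable01 F : continuous F -> measurable_fun I01 F.
Proof.
by move=> cF; apply: measurable_funTS; exact: continuous_measurable_fun.
Qed.

End primitive_ac.

(** * Integration by parts on [0, 1] *)

Section integration_by_parts.
Context {R : realType}.
Implicit Types (c d x y z k : R) (f g F G : R -> R).
Local Notation mu := (@lebesgue_measure R).
Local Notation I01 := (`]0, 1[%classic : set (measurableTypeR R)).

(** Absolute continuity on [0, 1] with almost everywhere derivative f, in integral form;
    [ac_isprim], [isprim_abs_continuous] and [isprim_derivative] translate. Values outside [0, 1]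
    stay unconstrained. *)
Record isprim F f : Prop := IsPrim {
  isprim_L1 : L1_01 f ;
  isprimE : forall x, 0 <= x <= 1 -> F x = F 0 + prim f x }.

Lemma isprim_prim f : L1_01 f -> isprim (prim f) f.
Proof. by move=> f1; split=> // x _; rewrite (prim_le0 f (lexx 0)) add0r. Qed.

Lemma isprim_bounded F f x : isprim F f -> 0 <= x <= 1 ->
  `|F x| <= `|F 0| + L1_norm01 f.
Proof.
move=> [f1 Ff] /andP[x0 x1]; rewrite Ff ?x0 //.
apply: le_trans (ler_normD _ _) _; rewrite lerD2l.
by have := prim_normr f1 x0; rewrite (prim_le0 f (lexx 0)) subr0.
Qed.

Lemma isprim_abs_continuous F f : isprim F f -> abs_continuous 0 1 F.
Proof.
move=> [f1 Ff] e e0; have [del del0 H] := @prim_abs_continuous _ _ 0 1 f1 e e0.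
exists del => // s s1 s2 s3; rewrite (le_lt_trans _ (H s s1 s2 s3)) //.
rewrite big_seq [leRHS]big_seq; apply: ler_sum => p /(allP s1) /and3P[p0 p12 p1].
have h1 : 0 <= p.1 <= 1 by rewrite p0 (le_trans p12).
have h2 : 0 <= p.2 <= 1 by rewrite p1 (le_trans p0).
by rewrite (Ff _ h1) (Ff _ h2) opprD addrACA subrr add0r.
Qed.

Lemma isprim_derivative F f : isprim F f -> ae_derivative F f.
Proof.
move=> [f1 Ff]; have /ae_mu01P pf := prim_ae_derivative f1; apply/ae_mu01P.
apply: filterS pf; first exact: (ae_filter_ringOfSetsType mu).
move=> x /= px x01; have {}px := px x01.
have : is_derive x (1 : R) (cst (F 0) + prim f) (f x).
  by apply: is_derive_eq; rewrite add0r.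
apply: near_eq_is_derive => //.
have : x \in `]0, 1[ by rewrite in_itv.
move/near_in_itvoo; apply: filterS => y; rewrite in_itv /= => /andP[y0 y1].
by rewrite [RHS]Ff // (ltW y0) (ltW y1).
Qed.

Lemma ac_isprim F f : abs_continuous 0 1 F -> ae_derivative F f -> L1_01 f ->
  isprim F f.
Proof. by move=> FA Ff f1; split => // x; exact: prim_unique01. Qed.

Lemma isprim_measurable F f : isprim F f -> measurable_fun I01 F.
Proof.
move=> [f1 Ff]; apply: (@eq_measurable_fun _ _ _ _ _ (fun x => F 0 + prim f x)).
  by move=> x; rewrite inE /= in_itv /= => /andP[x0 x1]; rewrite [RHS]Ff // !ltW.
apply: measurable_funD => //; apply: continuous_measurable01; exact: prim_continuous.
Qed.

Lemma isprim_L1M F f g : isprim F f -> L1_01 g -> L1_01 (fun x => g x * F x).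
Proof.
move=> Ff g1; apply: (L1M g1 (isprim_measurable Ff)) => x /andP[x0 x1].
by apply: (isprim_bounded Ff); rewrite !ltW.
Qed.

Lemma abs_continuousM c d F G M : (forall x, c <= x <= d -> `|F x| <= M) ->
  (forall x, c <= x <= d -> `|G x| <= M) ->
  abs_continuous c d F -> abs_continuous c d G ->
  abs_continuous c d (fun x => F x * G x).
Proof.
move=> FM GM FA GA e e0; pose k := 2 * (`|M| + 1).
have k1 : 0 < k by rewrite mulr_gt0 // ltr_wpDl.
have [d1 d10 H1] := FA _ (divr_gt0 e0 k1).
have [d2 d20 H2] := GA _ (divr_gt0 e0 k1).
exists (Num.min d1 d2); first by rewrite lt_min d10.
move=> s s1 s2; rewrite lt_min => /andP[/(H1 _ s1 s2) h1 /(H2 _ s1 s2) h2].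
apply: (@le_lt_trans _ _ (\sum_(p <- s) (`|M| * `|F p.2 - F p.1| + `|M| * `|G p.2 - G p.1|))).
  rewrite big_seq [leRHS]big_seq; apply: ler_sum => p /(allP s1) /and3P[p0 p12 p1].
  have -> : F p.2 * G p.2 - F p.1 * G p.1 =
    G p.2 * (F p.2 - F p.1) + F p.1 * (G p.2 - G p.1) by ring.
  apply: le_trans (ler_normD _ _) _; rewrite !normrM.
  rewrite lerD // ler_wpM2r // (le_trans _ (ler_norm M)) //.
    by rewrite GM // (le_trans p0).
  by rewrite FM // p0 (le_trans p12).
rewrite big_split -!mulr_sumr /=.
move: h1 h2; rewrite !ltr_pdivlMr // /k.
have : 0 <= \sum_(p <- s) `|F p.2 - F p.1| by apply: sumr_ge0.
have : 0 <= \sum_(p <- s) `|G p.2 - G p.1| by apply: sumr_ge0.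
have := normr_ge0 M; set A := \sum_(p <- s) _; set B := \sum_(p <- s) _; nra.
Qed.

(** The factors are bounded on [0, 1], so the product is absolutely continuous, and the product rule
    holds almost everywhere. The value at 1 is integration by parts. *)
Lemma isprimM F G f g : isprim F f -> isprim G g ->
  isprim (fun x => F x * G x) (fun x => f x * G x + g x * F x).
Proof.
move=> Ff Gg; have f1 := isprim_L1M Gg (isprim_L1 Ff).
have g1 := isprim_L1M Ff (isprim_L1 Gg).
apply: ac_isprim.
- pose M := Num.max (`|F 0| + L1_norm01 f) (`|G 0| + L1_norm01 g).
  apply: (@abs_continuousM _ _ _ _ M).
  + by move=> x /(isprim_bounded Ff) h; rewrite le_max h.
  + by move=> x /(isprim_bounded Gg) h; rewrite le_max h orbT.
  + exact: isprim_abs_continuous Ff.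
  + exact: isprim_abs_continuous Gg.
- have /ae_mu01P dF := isprim_derivative Ff; have /ae_mu01P dG := isprim_derivative Gg.
  apply/ae_mu01P; apply: filterS2 dF dG; first exact: (ae_filter_ringOfSetsType mu).
  move=> x /= dF dG x01; have {}dF := dF x01; have {}dG := dG x01.
  apply: (is_derive_eq (is_deriveM dF dG)).
  by rewrite -[_ *: g x]/(_ * _) -[_ *: f x]/(_ * _); ring.
- rewrite (_ : (fun _ => _) = fun x => 1 * (f x * G x) + g x * F x); first exact: L1P.
  by apply/funext => x; rewrite mul1r.
Qed.

Lemma integralD01 f g : L1_01 f -> L1_01 g ->
  \int[mu]_(x in I01) (f x + g x) =
  \int[mu]_(x in I01) f x + \int[mu]_(x in I01) g x.
Proof. by move=> f1 g1; rewrite RintegralD. Qed.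

Lemma integration_by_parts01 F G f g : isprim F f -> isprim G g ->
  \int[mu]_(x in I01) (f x * G x) =
  F 1 * G 1 - F 0 * G 0 - \int[mu]_(x in I01) (g x * F x).
Proof.
move=> Ff Gg; have f1 := isprim_L1M Gg (isprim_L1 Ff).
have g1 := isprim_L1M Ff (isprim_L1 Gg).
have /isprimE /(_ 1) := isprimM Ff Gg; rewrite lexx ler01 => /(_ isT).
by rewrite prim_ge1 // integralD01 // => ->; ring.
Qed.

End integration_by_parts.

(** * Integrability of powers up to a singular end point *)

Section improper_integral.
Context {R : realType}.
Local Notation mu := (@lebesgue_measure R).

(** Monotone convergence along compact intervals that exhaust ]l, r[: on each of them the
    fundamental theorem of calculus bounds the integral by 2 B. *)
Lemma derivative_integrable (l r B : R) (f F : R -> R) : l < r ->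
  (forall x, l < x < r -> {for x, continuous f}) ->
  (forall x, l < x < r -> 0 <= f x) ->
  (forall x, l < x < r -> is_derive x (1 : R) F (f x)) ->
  (forall x, l < x < r -> `|F x| <= B) ->
  mu.-integrable `]l, r[ (EFin \o f).
Proof.
move=> lr cf f0 dF FB.
(* With n + 3 the margin is at most a third of r - l, so the compact intervals are never
   degenerate. *)
pose d n := (r - l) / (n.+3)%:R.
have d0 n : 0 < d n by rewrite divr_gt0 // subr_gt0.
have dle n : d n <= (r - l) / 3.
  by rewrite ler_pM2l ?subr_gt0 // lef_pV2 ?posrE // ler_nat.
pose S n : set (measurableTypeR R) := `[l + d n, r - d n]%classic.
have Sin n x : S n x -> l < x < r.
  rewrite /S /= in_itv /= => /andP[lx xr].
  by rewrite (lt_le_trans _ lx) ?ltrDl //= (le_lt_trans xr) // gtrBl.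
have mS n : measurable (S n) by exact: measurable_itv.
have cfS n : {within S n, continuous f}.
  by apply: continuous_in_subspaceT => x; rewrite inE => /Sin; exact: cf.
have mfS n : measurable_fun (S n) (EFin \o f).
  by apply/measurable_EFinP; apply: subspace_continuous_measurable_fun; [exact: mS|exact: cfS].
have US : \bigcup_n S n = `]l, r[%classic.
  apply/seteqP; split => x; first by move=> [n _ /Sin]; rewrite /= in_itv.
  rewrite /= in_itv /= => /andP[lx xr].
  pose m := Num.min (x - l) (r - x).
  have m0 : 0 < m by rewrite lt_min !subr_gt0 lx.
  pose n := Num.truncn ((r - l) / m).
  have dn : d n <= m.
    rewrite /d ler_pdivrMr // -ler_pdivrMl // mulrC.
    rewrite (le_trans (ltW (truncnS_gt _))) // ler_nat //.
    by do 2 apply: leqW.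
  move: dn; rewrite le_min => /andP[dn1 dn2]; exists n => //.
  by rewrite /S /= in_itv /= -lerBrDl dn1 lerBrDl -lerBrDr.
have ndS : nondecreasing_seq S.
  move=> m n mn; apply/subsetPset => x; rewrite /S /= !in_itv /= => /andP[lx xr].
  have dmn : d n <= d m by rewrite ler_pM2l ?subr_gt0 // lef_pV2 ?posrE // ler_nat.
  by apply/andP; split; lra.
have SB n : (\int[mu]_(x in S n) (f x)%:E <= (2 * B)%:E)%E.
  have ab : l + d n < r - d n by have := dle n; lra.
  have In x : l + d n <= x <= r - d n -> l < x < r.
    by move=> h; apply: (@Sin n); rewrite /S /= in_itv.
  have Fd x : l < x < r -> {for x, continuous F}.
    by move=> /dF dx; apply/differentiable_continuous/derivable1_diffP.
  have Ia : l < l + d n < r by apply: In; rewrite lexx ltW.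
  have Ib : l < r - d n < r by apply: In; rewrite lexx ltW.
  rewrite (@continuous_FTC2 _ f F) //.
  - rewrite -EFinB lee_fin; have := FB _ Ia; have := FB _ Ib.
    by rewrite !ler_norml; lra.
  - exact: (cfS n).
  - split; last 2 first.
    + by apply: cvg_at_right_filter; exact: Fd.
    + by apply: cvg_at_left_filter; exact: Fd.
    move=> x; rewrite in_itv /= => /andP[ax xb].
    have xlr : l < x < r by apply: In; rewrite (ltW ax) (ltW xb).
    by have [] := dF x xlr.
  - move=> x; rewrite in_itv /= => /andP[ax xb].
    have xlr : l < x < r by apply: In; rewrite (ltW ax) (ltW xb).
    by rewrite derive1E; have [_ ->] := dF x xlr.
have fS0 n x : S n x -> (0 <= (EFin \o f) x)%E by move=> /Sin /f0.
apply/integrableP; split.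
  rewrite -US; apply/measurable_fun_bigcup => //.
have -> : (\int[mu]_(x in `]l, r[) `|(EFin \o f) x| = \int[mu]_(x in \bigcup_n S n) (EFin \o f) x)%E.
  rewrite US; apply: eq_integral => x; rewrite inE /= in_itv /= => /f0 fx.
  by rewrite ger0_norm.
apply: le_lt_trans (ltry (2 * B)).
have cvg := ge0_nondecreasing_set_cvg_integral ndS mS mfS fS0.
rewrite -(cvg_lim _ (cvg mu)) //; apply: lime_le; last exact: nearW.
by apply/cvg_ex; eexists; exact: (cvg mu).
Qed.

Lemma is_derive_powR_affine (s t p x : R) : 0 < s * x + t ->
  is_derive x (1 : R) (fun x => (s * x + t) `^ p) (p * (s * x + t) `^ (p - 1) * s).
Proof.
move=> st0; have h1 := is_derive1_powR p st0.
have h2 : is_derive x (1 : R) (s \*: id + cst t) s.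
  by apply: is_derive_eq; rewrite addr0 -[_ *: _]/(_ * _) mulr1.
exact: (@is_derive1_comp _ (fun y => y `^ p) (s \*: id + cst t)).
Qed.

Lemma powR_affine_integrable (s t p l r : R) : s != 0 -> l < r -> -1 < p ->
  (forall x, l < x < r -> 0 < s * x + t) ->
  mu.-integrable `]l, r[ (fun x => ((s * x + t) `^ p)%:E).
Proof.
move=> s0 lr p1 st; have q0 : 0 < p + 1 by lra.
have q0' : p + 1 != 0 by rewrite gt_eqF.
pose F x := (s * (p + 1))^-1 * (s * x + t) `^ (p + 1).
pose M := `|s| * (`|l| + `|r|) + `|t|.
apply: (@derivative_integrable _ _ (`|(s * (p + 1))^-1| * M `^ (p + 1)) _ F) => //.
- move=> x /st st0; have := is_derive_powR_affine p st0.
  by move=> [dx _]; apply/differentiable_continuous/derivable1_diffP.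
- by move=> x _; exact: powR_ge0.
- move=> x /st st0; have h := is_derive_powR_affine (p + 1) st0.
  have h4 := @is_deriveZ _ _ _ _ (s * (p + 1))^-1 _ _ _ h.
  apply: (is_derive_eq h4); rewrite -[_ *: _]/(_ * _) addrK.
  by field; rewrite s0 q0'.
- move=> x xlr; rewrite normrM ler_wpM2l // ger0_norm ?powR_ge0 //.
  have st0 := st _ xlr; have M0 : 0 <= M by rewrite addr_ge0 ?mulr_ge0 ?addr_ge0.
  apply: ge0_ler_powR; rewrite ?nnegrE ?(ltW q0) ?(ltW st0) //.
  rewrite (le_trans (ler_norm _)) // (le_trans (ler_normD _ _)) // lerD2r normrM.
  rewrite ler_wpM2l //; case/andP: xlr => lx xr.
  have := ler_norm (- l); have := ler_norm r; have := ler_norm l; have := ler_norm (- r).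
  have := normr_ge0 l; have := normr_ge0 r; rewrite !normrN.
  by case: (ler0P x) => _; lra.
Qed.

End improper_integral.

(** * The degenerate weight *)

Section degenerate_weight.
Context {R : realType}.
Local Notation mu := (@lebesgue_measure R).
Local Notation I01 := (`]0, 1[%classic : set (measurableTypeR R)).

Lemma L1_patch (D : set (measurableTypeR R)) (f : R -> R) : measurable D ->
  mu.-integrable D (EFin \o f) -> L1_01 (f \_ D).
Proof.
move=> mD fD; apply: (@integrableS _ _ _ mu setT) => //.
by rewrite -restrict_EFin; apply: (iffLR (integrable_mkcond _ _)) fD.
Qed.

Lemma L1_dist_powR (x0 p : R) : 0 < x0 < 1 -> -1 < p ->
  L1_01 (fun x => `|x - x0| `^ p).
Proof.
move=> /andP[x00 x01] p1.
have L : L1_01 ((fun x => (-1 * x + x0) `^ p) \_ `]0, x0[).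
  apply: L1_patch; first exact: measurable_itv.
  by apply: powR_affine_integrable => // x /andP[_ ?]; lra.
have U : L1_01 ((fun x => (1 * x + - x0) `^ p) \_ `]x0, 1[).
  apply: L1_patch; first exact: measurable_itv.
  by apply: powR_affine_integrable => // x /andP[? _]; lra.
(* The constant 1 covers the point x0 itself, where the power is 1 or 0 by convention. *)
apply: (L1_le _ _ (L1P 1 L (L1P 1 U (L1_cst 1)))).
  apply: (@measurableT_comp _ _ _ _ _ _ (fun y : R => y `^ p)) => //.
  by apply: measurableT_comp => //; apply: measurable_funB => //; exact: measurable_id.
move=> x /andP[h0 h1]; rewrite ger0_norm ?powR_ge0 // !mul1r.
have P1 : 0 <= ((fun x => (-1 * x + x0) `^ p) \_ `]0, x0[) x.
  by rewrite patchE; case: ifP => // _; exact: powR_ge0.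
have P2 : 0 <= ((fun x => (1 * x + - x0) `^ p) \_ `]x0, 1[) x.
  by rewrite patchE; case: ifP => // _; exact: powR_ge0.
case: (ltgtP x x0) => [xx|xx|].
- have -> : `|x - x0| `^ p = ((fun x => (-1 * x + x0) `^ p) \_ `]0, x0[) x.
    rewrite patchE mem_set /= ?in_itv /= ?h0 //.
    by rewrite ltr0_norm ?subr_lt0 // opprB mulN1r addrC.
  by rewrite /cst /=; lra.
- have -> : `|x - x0| `^ p = ((fun x => (1 * x + - x0) `^ p) \_ `]x0, 1[) x.
    rewrite patchE mem_set /= ?in_itv /= ?h1 ?andbT //.
    by rewrite gtr0_norm ?subr_gt0 // mul1r.
  by rewrite /cst /=; lra.
- move=> xx; have le1 : `|x - x0| `^ p <= 1.
    by rewrite xx subrr normr0; have [->|p0] := eqVneq p 0; rewrite ?powRr0 ?powR0.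
  by move: P1 P2; rewrite /cst /=; lra.
Qed.

Variables (a : R -> R) (x0 K : R).
Hypothesis a_cont : {within `[0, 1], continuous a}.
Hypothesis x0_in : 0 < x0 < 1.
Hypothesis a_x0 : a x0 = 0.
Hypothesis a_gt0 : forall x : R, 0 <= x <= 1 -> x != x0 -> 0 < a x.
Hypothesis K_range : 1 <= K < 2.
Hypothesis a_left :
  {in `[0, x0[ &, nonincreasing_fun (fun x : R => `|x - x0| `^ K / a x)}.
Hypothesis a_right :
  {in `]x0, 1] &, nondecreasing_fun (fun x : R => `|x - x0| `^ K / a x)}.

(** By monotonicity |x - x0|^K / a is largest at 0 on the left of x0 and at 1 on its right; the sum
    of these two values serves as C. *)
Lemma degenerate_lower_bound : exists2 C, 0 < C &
  forall x, 0 <= x <= 1 -> x != x0 -> (a x)^-1 <= C * (`|x - x0| `^ K)^-1.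
Proof.
case/andP: (x0_in) => x00 x01.
have a0 : 0 < a 0 by apply: a_gt0; rewrite ?lexx ?ler01 // lt_eqF.
have a1 : 0 < a 1 by apply: a_gt0; rewrite ?lexx ?ler01 // gt_eqF.
pose g x := `|x - x0| `^ K / a x.
have g0 x : 0 <= x <= 1 -> x != x0 -> 0 < g x.
  move=> xI xx; rewrite divr_gt0 ?a_gt0 // powR_gt0 // normr_gt0.
  by rewrite subr_eq0.
have G0 : 0 < g 0 by apply: g0; rewrite ?lexx ?ler01 // lt_eqF.
have G1 : 0 < g 1 by apply: g0; rewrite ?lexx ?ler01 // gt_eqF.
exists (g 0 + g 1); first exact: addr_gt0.
move=> x /andP[x0' x1'] xx.
have p0 : 0 < `|x - x0| `^ K by rewrite powR_gt0 // normr_gt0 subr_eq0.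
rewrite ler_pdivlMr // mulrC -/(g x).
have [xl|xl|xe] := ltgtP x x0; last by rewrite xe eqxx in xx.
  have : g x <= g 0 by apply: a_left; rewrite ?in_itv /= ?x0' ?lexx.
  lra.
have : g x <= g 1 by apply: a_right; rewrite ?in_itv /= ?x1' ?lexx ?andbT.
lra.
Qed.

Lemma a_ge0 x : 0 <= x <= 1 -> 0 <= a x.
Proof.
move=> xI; have [->|xx] := eqVneq x x0; first by rewrite a_x0.
by rewrite ltW // a_gt0.
Qed.

Lemma a_measurable : measurable_fun I01 a.
Proof.
apply: (@measurable_funS _ _ _ _ (`[0, 1]%classic : set (measurableTypeR R))) => //.
  exact: subset_itv_oo_cc.
by apply: subspace_continuous_measurable_fun => //; exact: measurable_itv.
Qed.

Lemma a_powR_measurable p : measurable_fun I01 (fun x => a x `^ p).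
Proof.
apply: (@measurableT_comp _ _ _ _ _ _ (fun y : R => y `^ p)) => //.
exact: a_measurable.
Qed.

Lemma inv_a_measurable : measurable_fun I01 (fun x => (a x)^-1).
Proof.
apply: eq_measurable_fun (a_powR_measurable (-1)) => x.
rewrite inE /= in_itv /= => /andP[h0 h1]; rewrite powR_inv1 // a_ge0 //.
by rewrite !ltW.
Qed.

Lemma isprim_dist (w w1 : R -> R) (M x y : R) : isprim w w1 ->
  (forall x, 0 < x < 1 -> `|w1 x| <= M) -> 0 <= x <= 1 -> 0 <= y <= 1 ->
  `|w x - w y| <= M * `|x - y|.
Proof.
move=> [w11 wE] wM.
wlog yx : x y / y <= x => [H xI yI|xI yI].
  have [/H|/ltW/H] := leP y x; first exact.
  by rewrite distrC (distrC x); exact.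
rewrite (wE _ xI) (wE _ yI) opprD addrACA subrr add0r (@ger0_norm _ (x - y)) ?subr_ge0 //.
exact: prim_lipschitz.
Qed.

(** As w is M-Lipschitz and vanishes at x0, |w / a| <= M C |x - x0|^(1 - K), integrable because 1 -
    K > -1, and w^2 / a <= M^2 C |x - x0|^(2 - K) is bounded. The constant is uniform in w, as the
    bound on solutions requires. *)
Lemma flux_bounds : exists2 C, 0 < C & forall (w w1 : R -> R) (M : R), isprim w w1 ->
  (forall x, 0 < x < 1 -> `|w1 x| <= M) -> w x0 = 0 ->
  [/\ L1_01 (fun x => w x / a x), L1_norm01 (fun x => w x / a x) <= C * M &
      L1_01 (fun x => w x ^+ 2 / a x)].
Proof.
have [C C0 aC] := degenerate_lower_bound; case/andP: (K_range) => K1 K2.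
case/andP: (x0_in) => x00 x01.
have p1 : -1 < 1 - K by lra.
have k1 := L1_dist_powR x0_in p1; pose B := L1_norm01 (fun x => `|x - x0| `^ (1 - K)).
have B0 : 0 <= B by exact: L1_norm_ge0.
exists (C * (B + 1)); first by rewrite mulr_gt0 // ltr_wpDl.
move=> w w1 M ww1 wM w0; have mw := isprim_measurable ww1.
have M0 : 0 <= M by rewrite (le_trans (normr_ge0 _) (wM (1 / 2) _)) //; lra.
have wx x : 0 < x < 1 -> `|w x| <= M * `|x - x0|.
  move=> /andP[h0 h1]; have := @isprim_dist _ _ _ x x0 ww1 wM.
  by rewrite w0 subr0; apply; rewrite !ltW.
have aux x : 0 < x < 1 -> x != x0 -> (a x)^-1 <= C * `|x - x0| `^ (- K).
  by move=> /andP[h0 h1] xx; rewrite powRN; apply: aC => //; rewrite !ltW.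
have wa x : 0 < x < 1 -> `|w x / a x| <= M * C * `|x - x0| `^ (1 - K).
  move=> xI; have [->|xx] := eqVneq x x0.
    by rewrite w0 mul0r normr0 mulr_ge0 ?powR_ge0 // mulr_ge0 // ltW.
  have xx0 : `|x - x0| != 0 by rewrite normr_eq0 subr_eq0.
  have a0 : 0 < a x by apply: a_gt0 => //; case/andP: xI => *; rewrite !ltW.
  rewrite normrM normfV (gtr0_norm a0).
  have -> : M * C * `|x - x0| `^ (1 - K) =
     (M * `|x - x0|) * (C * `|x - x0| `^ (- K)).
    rewrite powRD; last by rewrite xx0 implybT.
    by rewrite powRr1 //; ring.
  by apply: ler_pM; rewrite ?invr_ge0 ?(ltW a0) // ?wx // aux.
have mwa : measurable_fun I01 (fun x => w x / a x).
  by apply: measurable_funM => //; exact: inv_a_measurable.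
have k1' : L1_01 (fun x => M * C * `|x - x0| `^ (1 - K)).
  apply: (L1_le _ _ (L1P (M * C) k1 (L1_cst 0))).
    by apply: measurable_funM => //; exact: L1_measurable k1.
  move=> x xI; rewrite /cst addr0 ger0_norm //.
  by rewrite mulr_ge0 ?powR_ge0 // mulr_ge0 // ltW.
have wa1 : L1_01 (fun x => w x / a x) by exact: L1_le k1'.
split => //.
  apply: (@le_trans _ _ (\int[mu]_(x in I01) (M * C * `|x - x0| `^ (1 - K)))).
    apply: le_Rintegral; [exact: measurable_itv|exact: (L1_abs wa1)|exact: k1'|].
    by move=> x /=; rewrite in_itv; exact: wa.
  rewrite RintegralZl //.
  have -> : \int[mu]_(x in I01) (`|x - x0| `^ (1 - K)) = B.
    by apply: eq_Rintegral => x _; rewrite [RHS]ger0_norm // powR_ge0.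
  rewrite -subr_ge0 (_ : _ - _ = M * C); last by ring.
  by rewrite mulr_ge0 // ltW.
apply: (@L1_bounded _ _ (M ^+ 2 * C)).
  by apply: measurable_funM; [exact: measurable_funX|exact: inv_a_measurable].
move=> x xI; have [->|xx] := eqVneq x x0.
  by rewrite w0 expr0n mul0r normr0 mulr_ge0 ?sqr_ge0 // ltW.
have xx0 : `|x - x0| != 0 by rewrite normr_eq0 subr_eq0.
have xx1 : 0 < `|x - x0| <= 1.
  by rewrite lt_def xx0 normr_ge0 ler_norml; case/andP: xI => *; lra.
have a0 : 0 < a x by apply: a_gt0 => //; case/andP: xI => *; rewrite !ltW.
have E : w x ^+ 2 / a x = w x * (w x / a x) by rewrite expr2 mulrA.
rewrite E normrM (le_trans (ler_pM _ _ (wx _ xI) (wa _ xI))) //.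
have -> : M * `|x - x0| * (M * C * `|x - x0| `^ (1 - K)) =
   M ^+ 2 * C * (`|x - x0| * `|x - x0| `^ (1 - K)) by ring.
rewrite ler_piMr ?mulr_ge0 ?sqr_ge0 ?(ltW C0) //.
have -> : 1 - K = (2 - K) - 1 by lra.
rewrite mulr_powRB1 //; last lra.
have q0 : 0 <= 2 - K by lra.
by have := ger_powR xx1 q0; rewrite powRr0.
Qed.

(** Otherwise |w| >= |w(x0)| / 2 near x0, so there 1/a is at most 4 / w(x0)^2 times w^2 / a, while
    away from x0 it is bounded: 1/a would be integrable. *)
Lemma flux_vanishes (w w1 : R -> R) (M : R) :
  ~ mu.-integrable `]0, 1[ (fun x : R => ((a x)^-1)%:E) ->
  isprim w w1 -> (forall x, 0 < x < 1 -> `|w1 x| <= M) ->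
  L1_01 (fun x => w x ^+ 2 / a x) -> w x0 = 0.
Proof.
move=> nint ww1 wM w2; apply: contrapT => /eqP w0; apply: nint.
have [C C0 aC] := degenerate_lower_bound.
have M0 : 0 <= M by rewrite (le_trans (normr_ge0 _) (wM (1 / 2) _)) //; lra.
case/andP: (x0_in) => x00 x01; case/andP: (K_range) => K1 K2.
have c0 : 0 < `|w x0| by rewrite normr_gt0.
(* Within distance d of x0 the Lipschitz bound M lets w vary by at most |w(x0)| / 2. *)
pose d := `|w x0| / (2 * (M + 1)); have M1 : 0 < 2 * (M + 1) by lra.
have d0 : 0 < d by rewrite divr_gt0.
apply: (L1_le inv_a_measurable _ (L1P (4 / `|w x0| ^+ 2) w2 (L1_cst (C * (d `^ K)^-1)))).
move=> x xI; have xI' : 0 <= x <= 1 by case/andP: xI => *; rewrite !ltW.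
have a0 := a_ge0 xI'; rewrite /cst ger0_norm ?invr_ge0 //.
have P1 : 0 <= C * (d `^ K)^-1 by rewrite mulr_ge0 ?invr_ge0 ?powR_ge0 // ltW.
have P2 : 0 <= 4 / `|w x0| ^+ 2 * (w x ^+ 2 / a x).
  by rewrite mulr_ge0 // divr_ge0 // sqr_ge0.
have [xd|xd] := leP d `|x - x0|.
  have xx : x != x0.
    by apply/eqP => xx; move: xd; rewrite xx subrr normr0 leNgt d0.
  have := aC _ xI' xx; suff : C * (`|x - x0| `^ K)^-1 <= C * (d `^ K)^-1 by lra.
  rewrite ler_wpM2l ?(ltW C0) // lef_pV2 ?posrE ?powR_gt0 // ?(lt_le_trans d0) //.
  by rewrite ge0_ler_powR ?nnegrE ?(ltW d0) //; lra.
have h : `|w x0| / 2 <= `|w x|.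
  have x0I : 0 <= x0 <= 1 by rewrite (ltW x00) (ltW x01).
  have wd := isprim_dist ww1 wM xI' x0I.
  have := ler_distD (w x) (w x0) 0; rewrite !subr0 (distrC (w x0)).
  by move: xd; rewrite /d ltr_pdivlMr //; have := normr_ge0 (x - x0); nra.
suff : (a x)^-1 <= 4 / `|w x0| ^+ 2 * (w x ^+ 2 / a x) by lra.
have -> : 4 / `|w x0| ^+ 2 * (w x ^+ 2 / a x) = (4 * `|w x| ^+ 2 / `|w x0| ^+ 2) * (a x)^-1.
  by rewrite (real_normK (num_real (w x))); ring.
rewrite ler_peMl ?invr_ge0 // ler_pdivlMr ?exprn_gt0 // mul1r.
have : (`|w x0| / 2) ^+ 2 <= `|w x| ^+ 2 by rewrite ler_pXn2r ?nnegrE ?divr_ge0.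
by rewrite exprMn; lra.
Qed.

End degenerate_weight.

(** * The spaces L^2(0, 1) and X_mu *)

Section L2_complete.
Context {R : realType}.
Local Notation mu := (@lebesgue_measure R).
Local Notation T := (measurableTypeR R).
Local Notation I01 := (`]0, 1[%classic : set T).

(** Integrate |g| <= g^2 / (2 c) + c / 2 over an interval of length 1. *)
Lemma L1_norm_le_sqr (g : R -> R) (c : R) : measurable_fun I01 g ->
  L1_01 (fun x => g x ^+ 2) -> 0 < c ->
  \int[mu]_(x in I01) g x ^+ 2 <= c ^+ 2 -> L1_01 g /\ L1_norm01 g <= c.
Proof.
move=> mg g2 c0 gc.
have gx x : `|g x| <= (2 * c)^-1 * g x ^+ 2 + c / 2.
  have c2 : 0 < 2 * c by rewrite mulr_gt0.
  rewrite -(ler_pM2l c2) mulrDr mulrA divff ?gt_eqF // mul1r.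
  have : 0 <= (`|g x| - c) ^+ 2 by exact: sqr_ge0.
  rewrite sqrrB real_normK ?num_real //; lra.
have h1 := L1P (2 * c)^-1 g2 (L1_cst (c / 2)).
have g1 : L1_01 g by apply: (L1_le mg _ h1) => x _; exact: gx.
split => //; apply: (@le_trans _ _ (\int[mu]_(x in I01) ((2 * c)^-1 * g x ^+ 2 + c / 2))).
  by apply: le_Rintegral; [exact: measurable_itv|exact: L1_abs|exact: h1|move=> x _; exact: gx].
have -> : \int[mu]_(x in I01) ((2 * c)^-1 * g x ^+ 2 + c / 2) =
  (2 * c)^-1 * \int[mu]_(x in I01) g x ^+ 2 + c / 2.
  have E1 : L1_01 (fun x => (2 * c)^-1 * g x ^+ 2) by exact: integrableZl g2.
  rewrite integralD01 //; last exact: L1_cst.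
  congr (_ + _); first exact: RintegralZl.
  rewrite (@Rintegral_cst _ _ _ mu I01) //.
  transitivity (c / 2 * fine (@lebesgue_measure R I01)) => //.
  by rewrite lebesgue_measure_I01 mulr1.
suff : (2 * c)^-1 * \int[mu]_(x in I01) g x ^+ 2 <= c / 2 by lra.
have -> : c / 2 = (2 * c)^-1 * c ^+ 2 by field; rewrite gt_eqF.
by rewrite ler_pM2l // invr_gt0 mulr_gt0.
Qed.

(** Riesz-Fischer: along a fast subsequence the increments have summable L^1 norms, so the sum of
    their absolute values is finite almost everywhere and the subsequence converges there; Fatou's
    lemma then gives the convergence of the whole sequence. The conclusion uses the extended
    integral, integrability of the square not being known in advance. *)
Lemma L2_complete (f : nat -> T -> R) :
  (forall n, measurable_fun setT (f n)) ->
  (forall m n, L1_01 (fun x => (f m x - f n x) ^+ 2)) ->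
  (forall e, 0 < e -> exists n0, forall m n, (n0 <= m)%N -> (n0 <= n)%N ->
     \int[mu]_(x in I01) (f m x - f n x) ^+ 2 < e) ->
  exists2 v : T -> R, measurable_fun setT v &
    forall e, 0 < e -> exists n0, forall n, (n0 <= n)%N ->
    (\int[mu]_(x in I01) ((f n x - v x) ^+ 2)%:E <= e%:E)%E.
Proof.
move=> mf f2 cf; pose c k : R := 1 / (2 ^ k.+1)%:R.
have c0 k : 0 < c k by rewrite divr_gt0 // ltr0n expn_gt0.
have /choice[N HN] : forall k, exists n0, forall m n, (n0 <= m)%N -> (n0 <= n)%N ->
     \int[mu]_(x in I01) (f m x - f n x) ^+ 2 < c k ^+ 2.
  by move=> k; apply: cf; rewrite exprn_gt0.
(* Adding all earlier thresholds and k makes the index nondecreasing, at least [N k], and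
   unbounded. *)
pose p k := (k + \sum_(i < k.+1) N i)%N.
have pN k : (N k <= p k)%N by rewrite /p big_ord_recr /=; lia.
have pS k : (p k <= p k.+1)%N by rewrite /p [in leqRHS]big_ord_recr /=; lia.
have pk k : (k <= p k)%N by rewrite /p leq_addr.
pose g k x := f (p k.+1) x - f (p k) x.
have mg k D : measurable_fun D (g k).
  by apply: measurable_funTS; apply: measurable_funB.
have g1 k : L1_01 (g k) /\ L1_norm01 (g k) <= c k.
  apply: L1_norm_le_sqr => //; first exact: f2.
  by apply/ltW/HN => //; exact: leq_trans (pS k).
pose G x := (\sum_(k <oo) `|g k x|%:E)%E.
have mag k : measurable_fun I01 (fun x => `|g k x|%:E).
  by apply/measurable_EFinP; apply: measurableT_comp => //; exact: mg.
have G1 : (\int[mu]_(x in I01) G x <= 1%:E)%E.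
  rewrite /G integral_nneseries //.
  apply: le_trans (epsilon_trick0 xpredT ler01).
  apply: lee_nneseries => // k _; first by move=> _; apply: integral_ge0.
  have [gk1 gk2] := g1 k.
  have -> : (\int[mu]_(x in I01) `|g k x|%:E = (L1_norm01 (g k))%:E)%E.
    by rewrite /L1_norm01 /Rintegral fineK //; apply: integrable_fin_num (L1_abs gk1).
  by rewrite lee_fin.
have mG : measurable_fun I01 G by apply: ge0_emeasurable_sum.
have G0 x : (0 <= G x)%E by apply: nneseries_ge0.
have iG : mu.-integrable I01 G.
  apply/integrableP; split => //; apply: le_lt_trans (ltry 1); apply: le_trans G1.
  by rewrite le_eqVlt; apply/orP; left; apply/eqP; apply: eq_integral => x _; rewrite gee0_abs.
have Gfin : {ae mu, forall x, I01 x -> G x \is a fin_num} by apply: integrable_ae.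
(* The upper limit is defined and measurable everywhere, including the null set where the
   subsequence may diverge. *)
pose v x := fine (limn_esup (fun k => (f (p k) x)%:E)).
have mv : measurable_fun setT v.
  apply: (@measurableT_comp _ _ _ _ _ _ (@fine R)); first exact: fine_measurable.
  by apply: measurable_fun_limn_esup => n; exact/measurable_EFinP.
have fv x : G x \is a fin_num -> f (p k) x @[k --> \oo] --> v x.
  move=> Gx; suff cv : cvgn (fun k => f (p k) x).
    rewrite /v is_cvg_limn_esupE; last by apply/cvg_ex; eexists; apply: cvg_EFin; [exact: nearW|exact: cv].
    by rewrite EFin_lim.
  have : cvgn (series (fun k => g k x)).
    apply: normed_cvg; apply: nondecreasing_is_cvgn.
      by apply: nondecreasing_series => n _ _; exact: normr_ge0.
    exists (fine (G x)) => _ [n _ <-]; rewrite -lee_fin fineK // /series /= -sumEFin.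
    by apply: nneseries_lim_ge => k _ _; rewrite lee_fin.
  move=> cg; have -> : (fun k => f (p k) x) = series (fun k => g k x) \+ cst (f (p 0%N) x).
    by apply/funext => k; rewrite /series /= telescope_sumr // subrK.
  exact: is_cvgD cg (is_cvg_cst _).
exists v => // e e0; have [n0 Hn0] := cf _ e0; exists n0 => n n0n.
pose F k x := ((f n x - f (p (k + n0)%N) x) ^+ 2)%:E.
have mF k : measurable_fun I01 (F k).
  apply/measurable_EFinP; apply: measurable_funX; apply: measurable_funTS.
  exact: measurable_funB.
have F0 k x : I01 x -> (0 <= F k x)%E by move=> _; rewrite lee_fin sqr_ge0.
have -> : (\int[mu]_(x in I01) ((f n x - v x) ^+ 2)%:E =
   \int[mu]_(x in I01) limn_einf (F ^~ x))%E.
  apply: ae_eq_integral => //.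
  - apply/measurable_EFinP; apply: measurable_funX; apply: measurable_funTS.
    exact: measurable_funB.
  - have E : (fun x => limn_einf (F ^~ x)) = (fun x => - limn_esup (fun k => - F k x))%E.
      by apply/funext => x; rewrite -limn_einfN; congr limn_einf; apply/funext => k; rewrite /= opprK.
    rewrite E; apply: measurableT_comp => //.
    by apply: measurable_fun_limn_esup => k; apply: measurableT_comp.
  apply: filterS Gfin.
  move=> x /= Gx xI; have {}Gx := fv _ (Gx xI).
  have Fx : F k x @[k --> \oo] --> ((f n x - v x) ^+ 2)%:E.
    apply: cvg_EFin; first exact: nearW.
    have H : f n x - f (p (k + n0)%N) x @[k --> \oo] --> f n x - v x.
      by apply: cvgB; [exact: cvg_cst|rewrite (cvg_shiftn n0 (fun k => f (p k) x))].
    by rewrite expr2; apply: cvgM.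
  rewrite is_cvg_limn_einfE; last by apply/cvg_ex; eexists; exact: Fx.
  by apply/esym/cvg_lim.
apply: le_trans (fatou _ _ _ _) _ => //.
rewrite limn_einf_lim; apply: lime_le; first exact: is_cvg_einfs.
apply: nearW => k; apply: (@le_trans _ _ (\int[mu]_(x in I01) F k x)%E).
  by apply: ereal_inf_lbound; exists k => //=.
rewrite -(fineK (integrable_fin_num _ (f2 n (p (k + n0)%N)))) //.
rewrite lee_fin ltW // Hn0 //.
by rewrite (leq_trans _ (pk _)) // leq_addl.
Qed.

End L2_complete.

(** * Representatives of elements of L^2(0, 1) *)

Section L2_01_theory.
Context {R : realType}.
Local Notation mu := (@lebesgue_measure R).
Local Notation T := (measurableTypeR R).
Local Notation I01 := (`]0, 1[%classic : set T).

Lemma ae_mu01S (P Q : R -> Prop) : (forall x, 0 < x < 1 -> P x -> Q x) ->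
  (\forall x \ae mu01 R, P x) -> \forall x \ae mu01 R, Q x.
Proof.
move=> PQ /ae_mu01P H; apply/ae_mu01P; apply: filterS H.
  exact: (ae_filter_ringOfSetsType mu).
by move=> x /= Px xI; apply: PQ => //; exact: Px.
Qed.

Lemma ae_mu01S2 (P Q S : R -> Prop) : (forall x, 0 < x < 1 -> P x -> Q x -> S x) ->
  (\forall x \ae mu01 R, P x) -> (\forall x \ae mu01 R, Q x) ->
  \forall x \ae mu01 R, S x.
Proof.
move=> PQ /ae_mu01P H1 /ae_mu01P H2; apply/ae_mu01P; apply: filterS2 H1 H2.
  exact: (ae_filter_ringOfSetsType mu).
by move=> x /= Px Qx xI; apply: PQ => //; [exact: Px|exact: Qx].
Qed.

Lemma integral_mu01 (f : T -> \bar R) : measurable_fun setT f ->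
  (forall x, 0 <= f x)%E ->
  (\int[mu01 R]_x f x = \int[mu]_(x in I01) f x)%E.
Proof.
move=> mf f0; rewrite (@ge0_negligible_integral _ _ _ (mu01 R) setT (~` I01)) //.
- rewrite setTD setCK; apply: eq_measure_integral => A mA AI.
  by rewrite /mu01 /= /mrestr setIidl.
- exact: measurableC.
- by rewrite /mu01 /= /mrestr setICl measure0.
Qed.

Lemma mu01_L1 (f : T -> R) : (mu01 R).-integrable setT (EFin \o f) -> L1_01 f.
Proof.
move=> /integrableP[mf fi]; apply/integrableP; split; first exact: measurable_funTS.
by rewrite -integral_mu01 //; exact: measurableT_comp.
Qed.

Lemma L2_measurable (f : L2_01 R) : measurable_fun setT (f : T -> R).
Proof. by have := Lspace_Lfun f; rewrite inE => /andP[]; rewrite inE. Qed.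

Lemma L2_mul_L1 (f g : L2_01 R) : L1_01 (fun x => (f : T -> R) x * (g : T -> R) x).
Proof.
apply/mu01_L1/Lfun1_integrable; apply: Lfun2_mul_Lfun1; exact: Lspace_Lfun.
Qed.

Lemma L2_sqr_L1 (f : L2_01 R) : L1_01 (fun x => (f : T -> R) x ^+ 2).
Proof. exact: L2_mul_L1. Qed.

Lemma L2_L1 (f : L2_01 R) : L1_01 (f : T -> R).
Proof.
have mf : measurable_fun I01 (f : T -> R) by apply: measurable_funTS; exact: L2_measurable.
apply: (L1_le mf _ (L1P 1 (L2_sqr_L1 f) (L1_cst 1))) => x _ /=.
set y := (f : T -> R) x; rewrite mul1r.
have : 0 <= (`|y| - 1) ^+ 2 by exact: sqr_ge0.
by rewrite sqrrB real_normK ?num_real // expr1n mulr1; have := normr_ge0 y; rewrite /cst; lra.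
Qed.

Lemma mem_L2P (f : R -> R) : measurable_fun I01 f -> L1_01 (fun x => f x ^+ 2) ->
  exists g : L2_01 R, \forall x \ae mu01 R, (g : T -> R) x = f x.
Proof.
move=> mf f2; have mc : measurable_fun setT (cut01 f : T -> R).
  exact: (measurable_restrictT _ _).1.
have c2 x : cut01 (fun x => f x ^+ 2) x = cut01 f x ^+ 2.
  by case/boolP: (0 < x < 1) => xI; [rewrite !cut01E|rewrite !cut010 // expr0n].
have fin : (cut01 f : T -> R) \in Lfun (mu01 R) 2.
  apply/andP; split; rewrite inE //=.
  rewrite /finite_norm unlock /Lnorm; apply: poweR_lty.
  have -> : (\int[mu01 R]_x `|(EFin \o (cut01 f : T -> R)) x| `^ 2 =
     \int[mu01 R]_x (cut01 f x ^+ 2)%:E)%E.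
    apply: eq_integral => x _; rewrite /= powR_mulrn //.
    by rewrite real_normK // num_real.
  rewrite integral_mu01 //.
  - have /integrableP[_] := f2; apply: le_lt_trans; rewrite le_eqVlt; apply/orP; left.
    apply/eqP/eq_integral => x; rewrite inE /= in_itv /= => xI.
    by rewrite -c2 cut01E // ger0_norm ?sqr_ge0.
  - by apply/measurable_EFinP; exact: measurable_funX.
  - by move=> x; rewrite lee_fin sqr_ge0.
exists (Lspace_of_Lfun (Lfun_Sub (lee1n 2) fin)).
have := Lspace_of_LfunE (Lfun_Sub (lee1n 2) fin).
move=> h; apply/ae_mu01P; move: h; rewrite /ae_eq => h.
have {}h : \forall x \ae mu01 R, (Lspace_of_Lfun (Lfun_Sub (lee1n 2) fin) : T -> R) x = cut01 f x.
  by apply: filterS h => x /(_ I).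
move/ae_mu01P : h; apply: filterS; first exact: (ae_filter_ringOfSetsType mu).
by move=> x /= h xI; rewrite h // cut01E.
Qed.

Lemma L2_ext (f g : L2_01 R) :
  (\forall x \ae mu01 R, (f : T -> R) x = (g : T -> R) x) -> f = g.
Proof. by move=> fg; apply/Lspace_eqP; apply: filterS fg => x fgx _. Qed.

Lemma L2_linear k (f g : L2_01 R) :
  \forall x \ae mu01 R, ((k *: f + g : L2_01 R) : T -> R) x =
    k * (f : T -> R) x + (g : T -> R) x.
Proof.
rewrite -[k *: f + g]/(Lspace_add (Lspace_scale k f) g).
apply: filterS2 (Lspace_addE (Lspace_scale k f) g) (Lspace_scaleE k f) => x h1 h2.
by rewrite h1 h2.
Qed.

Lemma integral01_eq0 (f : R -> R) : L1_01 f -> (forall x, 0 < x < 1 -> 0 <= f x) ->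
  \int[mu]_(x in I01) f x = 0 -> \forall x \ae mu01 R, f x = 0.
Proof.
move=> f1 f0 If.
have : ae_eq mu I01 (EFin \o f) (cst 0%E).
  apply/ae_eq_integral_abs => //; first by have /integrableP[] := f1.
  move/eqP: If; rewrite /Rintegral fine_eq0; last exact: integrable_fin_num f1.
  move/eqP => <-; apply: eq_integral => x; rewrite inE /= in_itv /= => /f0 fx.
  by rewrite ger0_norm.
move=> fae; apply/ae_mu01P; apply: filterS fae => x /= fx xI.
by have : I01 x by [rewrite /= in_itv]; move/fx => [].
Qed.

Lemma integral_ae01 (f g : R -> R) : (\forall x \ae mu01 R, f x = g x) ->
  L1_01 f -> L1_01 g ->
  \int[mu]_(x in I01) f x = \int[mu]_(x in I01) g x.
Proof. by move=> fg f1 g1; rewrite -!(prim_ge1 _ (lexx 1)); exact: prim_ae. Qed.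

End L2_01_theory.

(** * X_mu is a Hilbert space *)

Section X_mu_theory.
Context {R : realType}.
Local Notation mu := (@lebesgue_measure R).
Local Notation T := (measurableTypeR R).
Local Notation I01 := (`]0, 1[%classic : set T).
Variables (a : R -> R) (beta0 beta1 : R).
Hypotheses (a0 : 0 < a 0) (a1 : 0 < a 1) (beta0_gt0 : 0 < beta0) (beta1_gt0 : 0 < beta1).
Local Notation dot := (X_mu_dot a beta0 beta1).

Lemma X_fun_linear k (f g : X_mu R) :
  \forall x \ae mu01 R, X_fun (k *: f + g) x = k * X_fun f x + X_fun g x.
Proof. exact: L2_linear. Qed.

Lemma X_at0_linear k (f g : X_mu R) : X_at0 (k *: f + g) = k * X_at0 f + X_at0 g.
Proof. by []. Qed.

Lemma X_at1_linear k (f g : X_mu R) : X_at1 (k *: f + g) = k * X_at1 f + X_at1 g.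
Proof. by []. Qed.

Lemma X_mul_L1 (f g : X_mu R) : L1_01 (fun x => X_fun f x * X_fun g x).
Proof. exact: L2_mul_L1. Qed.

Lemma X_L1 (f : X_mu R) : L1_01 (X_fun f).
Proof. exact: L2_L1. Qed.

Lemma X_mu_ext (f g : X_mu R) : (\forall x \ae mu01 R, X_fun f x = X_fun g x) ->
  X_at0 f = X_at0 g -> X_at1 f = X_at1 g -> f = g.
Proof.
case: f g => [[f f0] f1] [[g g0] g1] /L2_ext fg.
by rewrite /X_at0 /X_at1 /= => -> ->; rewrite (fg : f = g).
Qed.

Lemma X_mu_dotP k (f g h : X_mu R) : dot (k *: f + g) h = k * dot f h + dot g h.
Proof.
have L := L1P k (X_mul_L1 f h) (X_mul_L1 g h).
rewrite /X_mu_dot X_at0_linear X_at1_linear (integral_ae01 _ _ L); last 2 first.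
- by apply: ae_mu01S (X_fun_linear k f g) => x _ ->; rewrite mulrDl mulrA.
- exact: X_mul_L1.
have E1 : L1_01 (fun x => k * (X_fun f x * X_fun h x)).
  exact: integrableZl (X_mul_L1 f h).
rewrite integralD01 //; last exact: X_mul_L1.
by rewrite RintegralZl //; [ring|exact: X_mul_L1].
Qed.

Lemma X_mu_dotE (f : X_mu R) : dot f f = \int[mu]_(x in I01) X_fun f x ^+ 2 +
  a 0 / beta0 * X_at0 f ^+ 2 + a 1 / beta1 * X_at1 f ^+ 2.
Proof.
by rewrite /X_mu_dot !expr2; congr (_ + _ + _); rewrite -!mulrA;
  congr (_ * _); rewrite [RHS]mulrC !mulrA.
Qed.

Lemma X_mu_dot_ge (f : X_mu R) : [/\ \int[mu]_(x in I01) X_fun f x ^+ 2 <= dot f f,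
  a 0 / beta0 * X_at0 f ^+ 2 <= dot f f & a 1 / beta1 * X_at1 f ^+ 2 <= dot f f].
Proof.
have h0 : 0 <= a 0 / beta0 * X_at0 f ^+ 2 by rewrite mulr_ge0 ?sqr_ge0 // ltW // divr_gt0.
have h1 : 0 <= a 1 / beta1 * X_at1 f ^+ 2 by rewrite mulr_ge0 ?sqr_ge0 // ltW // divr_gt0.
have h2 : 0 <= \int[mu]_(x in I01) X_fun f x ^+ 2.
  by apply: Rintegral_ge0 => x _; exact: sqr_ge0.
rewrite X_mu_dotE; split.
- by rewrite -addrA lerDl addr_ge0.
- by rewrite addrAC lerDr addr_ge0.
- by rewrite lerDr addr_ge0.
Qed.

Lemma X_mu_eq0 (f : X_mu R) : dot f f = 0 -> f = 0.
Proof.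
have [h h0 h1] := X_mu_dot_ge f; move=> f0; rewrite f0 in h h0 h1.
have ab0 : 0 < a 0 / beta0 by rewrite divr_gt0.
have ab1 : 0 < a 1 / beta1 by rewrite divr_gt0.
have Z : X_fun (0 : X_mu R) = (Lspace_zero (mu01 R) (lee1n 2) : T -> R) by [].
apply: X_mu_ext.
- have h2 : \int[mu]_(x in I01) X_fun f x ^+ 2 = 0.
    apply/eqP; rewrite eq_le h; apply: Rintegral_ge0 => x _; exact: sqr_ge0.
  have H0 := Lspace_zeroE (mu01 R) (lee1n 2).
  have fae : \forall x \ae mu01 R, X_fun f x ^+ 2 = 0.
    by apply: integral01_eq0 => //; [exact: L2_sqr_L1|move=> x _; exact: sqr_ge0].
  apply: ae_mu01S2 fae H0 => x _ /eqP; rewrite sqrf_eq0 => /eqP -> h3.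
  by rewrite Z h3.
- apply/eqP; rewrite -sqrf_eq0 eq_le sqr_ge0 andbT.
  by rewrite -(ler_pM2l ab0) mulr0.
- apply/eqP; rewrite -sqrf_eq0 eq_le sqr_ge0 andbT.
  by rewrite -(ler_pM2l ab1) mulr0.
Qed.

Lemma real_cauchy (w : nat -> R) :
  (forall e, 0 < e -> exists n0, forall m n, (n0 <= m)%N -> (n0 <= n)%N -> (w m - w n) ^+ 2 < e) ->
  exists l, forall e, 0 < e -> exists n0, forall n, (n0 <= n)%N -> (w n - l) ^+ 2 <= e.
Proof.
move=> cw.
have /cauchy_cvgP/cvg_ex[l wl] : cauchy (w @ \oo).
  apply: cauchy_exP => e e0; have [n0 H] := cw (e ^+ 2) (exprn_gt0 _ e0).
  exists (w n0); exists n0 => // n /= n0n; rewrite /ball /=.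
  have := H n0 n (leqnn _) n0n.
  by rewrite -(@ltr_pXn2r _ 2) ?nnegrE ?(ltW e0) // real_normK // num_real.
exists l => e e0; have e1 : 0 < Num.min 1 e by rewrite lt_min ltr01.
have /cvgrPdist_lt /(_ _ e1) [n0 _ Hn] := wl; exists n0 => n /Hn /=.
rewrite lt_min distrC => /andP[w1 w2].
rewrite -real_normK ?num_real // expr2; apply: le_trans (ltW w2).
by rewrite ler_piMr // ltW.
Qed.

Lemma X_mu_hilbert : hilbert dot.
Proof.
split.
- move=> f g; rewrite /X_mu_dot; congr (_ + _ + _).
  + by apply: eq_Rintegral => x _; rewrite mulrC.
  + by rewrite -!mulrA; congr (_ * _); rewrite mulrCA.
  + by rewrite -!mulrA; congr (_ * _); rewrite mulrCA.
- exact: X_mu_dotP.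
- move=> f; have [h _ _] := X_mu_dot_ge f; apply: le_trans h.
  by apply: Rintegral_ge0 => x _; exact: sqr_ge0.
- exact: X_mu_eq0.
have add3 (x y z t : R) : x <= t / 4 -> y <= t / 4 -> z <= t / 4 -> 0 < t ->
  x + y + z < t by move=> *; lra.
move=> u cu; have ab0 : 0 < a 0 / beta0 by rewrite divr_gt0.
have ab1 : 0 < a 1 / beta1 by rewrite divr_gt0.
pose d m n := dot (u m - u n) (u m - u n).
have {}cu e : 0 < e -> exists n0, forall m n, (n0 <= m)%N -> (n0 <= n)%N -> d m n < e.
  move=> e0; have [|n0 H] := cu (Num.sqrt e); first by rewrite sqrtr_gt0.
  by exists n0 => m n n0m n0n; have := H m n n0m n0n; rewrite ltr_sqrt.
have subE (f g : X_mu R) : f - g = (-1) *: g + f by rewrite scaleN1r addrC.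
have fB (f g : X_mu R) : \forall x \ae mu01 R, X_fun (f - g) x = X_fun f x - X_fun g x.
  by rewrite subE; apply: ae_mu01S (X_fun_linear (-1) g f) => x _ ->; rewrite mulN1r addrC.
have at0B (f g : X_mu R) : X_at0 (f - g) = X_at0 f - X_at0 g.
  by rewrite subE X_at0_linear mulN1r addrC.
have at1B (f g : X_mu R) : X_at1 (f - g) = X_at1 f - X_at1 g.
  by rewrite subE X_at1_linear mulN1r addrC.
have sqB m n : L1_01 (fun x => (X_fun (u m) x - X_fun (u n) x) ^+ 2).
  apply: L1_ae (L2_sqr_L1 (u m - u n).1.1).
    by apply: ae_mu01S (fB (u m) (u n)) => x _; rewrite /X_fun => ->.
  apply: measurable_funX; apply: measurable_funTS.
  by apply: measurable_funB; exact: L2_measurable.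
have [|||v mv Hv] := @L2_complete _ (fun n => X_fun (u n)).
- by move=> n; exact: L2_measurable.
- exact: sqB.
- move=> e /cu[n0 H]; exists n0 => m n n0m n0n; apply: le_lt_trans (H m n n0m n0n).
  have [h _ _] := X_mu_dot_ge (u m - u n); apply: le_trans h.
  rewrite le_eqVlt; apply/orP; left; apply/eqP; apply: integral_ae01.
  + by apply: ae_mu01S (fB (u m) (u n)) => x _ ->.
  + exact: sqB.
  + exact: L2_sqr_L1.
have [|l0 H0] := @real_cauchy (fun n => X_at0 (u n)).
  move=> e e0; have [n0 H] := cu _ (mulr_gt0 ab0 e0); exists n0 => m n n0m n0n.
  have [_ h _] := X_mu_dot_ge (u m - u n); rewrite -(ltr_pM2l ab0) -at0B.
  exact: le_lt_trans h (H m n n0m n0n).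
have [|l1 H1] := @real_cauchy (fun n => X_at1 (u n)).
  move=> e e0; have [n0 H] := cu _ (mulr_gt0 ab1 e0); exists n0 => m n n0m n0n.
  have [_ _ h] := X_mu_dot_ge (u m - u n); rewrite -(ltr_pM2l ab1) -at1B.
  exact: le_lt_trans h (H m n n0m n0n).
have mfv n : measurable_fun I01 (fun x => (X_fun (u n) x - v x) ^+ 2).
  apply: measurable_funX; apply: measurable_funTS; apply: measurable_funB => //.
  exact: L2_measurable.
have fv2 n (e : R) : (\int[mu]_(x in I01) ((X_fun (u n) x - v x) ^+ 2)%:E <= e%:E)%E ->
    L1_01 (fun x => (X_fun (u n) x - v x) ^+ 2) /\
    \int[mu]_(x in I01) (X_fun (u n) x - v x) ^+ 2 <= e.
  move=> h; have L : L1_01 (fun x => (X_fun (u n) x - v x) ^+ 2).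
    apply/integrableP; split; first exact/measurable_EFinP.
    apply: le_lt_trans (ltry e); apply: le_trans h.
    rewrite le_eqVlt; apply/orP; left; apply/eqP; apply: eq_integral => x _.
    by rewrite /= ger0_norm // sqr_ge0.
  split => //; rewrite -lee_fin /Rintegral fineK //.
  exact: integrable_fin_num L.
(* The limit is a sum of two square integrable functions: v = u_n - (u_n - v), for one fixed n. *)
have [g gv] : exists g : L2_01 R, \forall x \ae mu01 R, (g : T -> R) x = v x.
  apply: mem_L2P; first exact: measurable_funTS.
  have [n0 /(_ n0 (leqnn _)) /fv2[L _]] := Hv 1 ltr01.
  apply: L1_le (L1P 2 L (L1P 2 (L2_sqr_L1 (u n0).1.1) (L1_cst 0))).
    by apply: measurable_funX; exact: measurable_funTS.
  move=> x _; rewrite ger0_norm ?sqr_ge0 // /cst addr0 -/(X_fun (u n0)).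
  have : 0 <= (2 * X_fun (u n0) x - v x) ^+ 2 by exact: sqr_ge0.
  by rewrite !sqrrB !exprMn; set y := X_fun _ x; nra.
exists ((g, l0), l1) => e e0; pose l : X_mu R := ((g, l0), l1).
have e20 : 0 < e ^+ 2 / 4 by rewrite divr_gt0 // exprn_gt0.
have [n1 h1] := Hv _ e20.
have [n2 h2] := H0 _ (divr_gt0 e20 ab0); have [n3 h3] := H1 _ (divr_gt0 e20 ab1).
exists (maxn n1 (maxn n2 n3)) => n; rewrite !geq_max => /and3P[/h1/fv2[L {}h1] /h2 {}h2 /h3 {}h3].
rewrite -(@ltr_pXn2r _ 2) ?nnegrE ?sqrtr_ge0 ?(ltW e0) // sqr_sqrtr; last first.
  have [h _ _] := X_mu_dot_ge (u n - l); apply: le_trans h.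
  by apply: Rintegral_ge0 => x _; exact: sqr_ge0.
rewrite -/l X_mu_dotE at0B at1B.
have -> : \int[mu]_(x in I01) X_fun (u n - l) x ^+ 2 =
    \int[mu]_(x in I01) (X_fun (u n) x - v x) ^+ 2.
  apply: integral_ae01 => //; last exact: L2_sqr_L1.
  by apply: ae_mu01S2 (fB (u n) l) gv => x _ -> <-.
rewrite ler_pdivlMr // mulrC in h2; rewrite ler_pdivlMr // mulrC in h3.
exact: add3 h1 h2 h3 (exprn_gt0 2 e0).
Qed.

End X_mu_theory.

(** * Null primitives, step functions and embeddings into X_mu *)

Section isprim_extra.
Context {R : realType}.
Implicit Types (c d x y z k : R) (f g F G : R -> R).
Local Notation mu := (@lebesgue_measure R).
Local Notation T := (measurableTypeR R).
Local Notation I01 := (`]0, 1[%classic : set T).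

Lemma isprim_affine c f : L1_01 f -> isprim (fun x => c + prim f x) f.
Proof. by move=> f1; split=> // x _; rewrite (prim_le0 f (lexx 0)) addr0. Qed.

Lemma isprim_self_L1 F f : isprim F f -> L1_01 F.
Proof.
move=> Ff; apply: (L1_bounded (isprim_measurable Ff)) => x /andP[x0 x1].
by apply: (isprim_bounded Ff); rewrite !ltW.
Qed.

Lemma ae_mu01_neq c : \forall x \ae mu01 R, x != c.
Proof.
apply/ae_mu01P; exists [set c]; split => //; first exact: lebesgue_measure_set1.
by move=> x /= /not_implyP[_ /negP]; rewrite negbK => /eqP.
Qed.

Lemma ae_mu01_dense (P : R -> Prop) y z : (\forall x \ae mu01 R, P x) ->
  0 <= y -> y < z -> z <= 1 -> exists x, y < x < z /\ P x.
Proof.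
move=> /ae_mu01P[B [mB B0 PB]] y0 yz z1; apply: contrapT => H.
have sub : `]y, z[%classic `<=` B.
  move=> x; rewrite /= in_itv /= => /andP[yx xz]; apply: PB => /= Px; apply: H.
  by exists x; rewrite yx xz; split => //; apply: Px; rewrite (le_lt_trans y0) // (lt_le_trans xz).
have : (mu `]y, z[ <= mu B)%E by apply: le_measure => //; rewrite inE.
rewrite [X in (_ <= X)%E](B0 : mu B = 0%E).
rewrite lebesgue_measure_itv /= lte_fin yz -EFinB lee_fin leNgt subr_gt0.
by rewrite yz.
Qed.

(** A null set contains no interval, so every point of [0, 1] has zeros of F arbitrarily close to
    it, and continuity concludes. *)
Lemma isprim_ae0 F f : isprim F f -> (\forall x \ae mu01 R, F x = 0) ->
  (forall x, 0 <= x <= 1 -> F x = 0) /\ (\forall x \ae mu01 R, f x = 0).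
Proof.
move=> Ff F0; have F00 x : 0 <= x <= 1 -> F x = 0.
  move=> /andP[x0 x1]; apply/eqP; rewrite -normr_eq0 eq_le normr_ge0 andbT.
  apply/ler_addgt0Pr => e e0; rewrite add0r.
  have [del del0 H] := isprim_abs_continuous Ff e0.
  pose y := Num.max 0 (x - del / 2); pose z := Num.min 1 (x + del / 2).
  have yz : y < z.
    by rewrite lt_min !gt_max ltr01 /=; apply/and3P; split; lra.
  have y0 : 0 <= y by rewrite le_max lexx.
  have z1 : z <= 1 by rewrite ge_min lexx.
  have [t [/andP[yt tz] Ft]] := ae_mu01_dense F0 y0 yz z1.
  move: yt tz; rewrite gt_max lt_min => /andP[t0 tx] /andP[t1 xt].
  have [tx'|xt'] := leP t x.
    have := H [:: (t, x)]; rewrite !big_seq1 /= Ft subr0 => h; apply/ltW/h => //.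
      by rewrite tx' x1 (ltW t0).
    by lra.
  have := H [:: (x, t)]; rewrite !big_seq1 /= Ft sub0r normrN => h; apply/ltW/h => //.
    by rewrite (ltW xt') (ltW t1) x0.
  by lra.
split => //; apply: ae_mu01S (isprim_derivative Ff) => x xI dF.
have d0 : is_derive x (1 : R) F 0.
  have : is_derive x (1 : R) (cst (0 : R) : R -> R) 0 by exact: is_derive_cst.
  apply: near_eq_is_derive.
  have : x \in `]0, 1[ by rewrite in_itv.
  move/near_in_itvoo; apply: filterS => y; rewrite in_itv /= => /andP[y0 y1].
  by rewrite F00 // !ltW.
by rewrite -(@derive_val _ _ _ _ _ _ _ dF) (@derive_val _ _ _ _ _ _ _ d0).
Qed.

(** The Heaviside function at c, with value 0 at c; it carries the jump of u' across x0. *)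
Definition step c x : R := \1_(`]c, +oo[%classic) x.

Lemma step_gt c x : c < x -> step c x = 1.
Proof. by move=> cx; rewrite /step indicE mem_set // /= in_itv /= cx. Qed.

Lemma step_le c x : x <= c -> step c x = 0.
Proof.
move=> xc; rewrite /step indicE memNset //= in_itv /= andbT.
by apply/negP; rewrite -leNgt.
Qed.

Lemma L1_step c : L1_01 (step c).
Proof.
apply: (@L1_bounded _ _ 1); first by apply: measurable_indic; exact: measurable_itv.
by move=> x _; have [xc|cx] := leP x c; [rewrite step_le // normr0|rewrite step_gt // normr1].
Qed.

Lemma integral_step c f : 0 <= c <= 1 -> L1_01 f ->
  \int[mu]_(x in I01) (step c x * f x) = prim f 1 - prim f c.
Proof.
move=> /andP[c0 c1] f1; rewrite prim_itv // Rintegral_mkcond [RHS]Rintegral_mkcond.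
apply: eq_Rintegral => x _; rewrite !patchE /cut01 patchE.
case: ifPn; rewrite ?inE ?notin_setE /= !in_itv /= => xI; last first.
  by case: ifP => // _; rewrite memNset //= in_itv.
have [x0 x1] : 0 < x /\ x < 1 by case/andP: xI.
have [xc|cx] := leP x c.
  by rewrite step_le // mul0r memNset //= in_itv /= ltNge xc.
by rewrite step_gt // mul1r mem_set /= ?in_itv /= ?cx ?(ltW x1) // mem_set /= ?in_itv.
Qed.

Lemma abs_continuous_ext c d F G : (forall x, c <= x <= d -> F x = G x) ->
  abs_continuous c d F -> abs_continuous c d G.
Proof.
move=> FG FA e /FA[del del0 H]; exists del => // s s1 s2 s3.
rewrite (le_lt_trans _ (H s s1 s2 s3)) // big_seq [leRHS]big_seq.
apply: ler_sum => p /(allP s1) /and3P[p0 p12 p1].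
by rewrite !FG // ?p0 ?p1 ?(le_trans p0) ?(le_trans p12).
Qed.

Lemma L2_of_bounded f k : measurable_fun I01 f -> (forall x, 0 < x < 1 -> `|f x| <= k) ->
  exists g : L2_01 R, \forall x \ae mu01 R, (g : T -> R) x = f x.
Proof.
move=> mf fk; apply: mem_L2P => //; apply: (@L1_bounded _ _ (k ^+ 2)).
  exact: measurable_funX.
move=> x xI; have := fk _ xI; rewrite normrX => h.
by rewrite ler_pXn2r ?nnegrE // (le_trans _ h).
Qed.

Lemma isprim_L2 F f : isprim F f ->
  exists g : L2_01 R, \forall x \ae mu01 R, (g : T -> R) x = F x.
Proof.
move=> Ff; apply: (@L2_of_bounded _ (`|F 0| + L1_norm01 f)).
  exact: isprim_measurable Ff.
by move=> x /andP[x0 x1]; apply: (isprim_bounded Ff); rewrite !ltW.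
Qed.

Lemma isprim_embed F f : isprim F f -> exists X : X_mu R, X_mu_embeds F X.
Proof. by move=> /isprim_L2[g gF]; exists ((g, F 0), F 1). Qed.

End isprim_extra.

(** * The operator A_1 *)

Section representation.
Context {R : realType}.
Local Notation mu := (@lebesgue_measure R).
Local Notation T := (measurableTypeR R).
Local Notation I01 := (`]0, 1[%classic : set T).
Variables (a : R -> R) (x0 K : R).
Hypothesis a_cont : {within `[0, 1], continuous a}.
Hypothesis x0_in : 0 < x0 < 1.
Hypothesis a_x0 : a x0 = 0.
Hypothesis a_gt0 : forall x : R, 0 <= x <= 1 -> x != x0 -> 0 < a x.
Hypothesis a_strong :
  ~ lebesgue_measure.-integrable `]0, 1[ (fun x : R => ((a x)^-1)%:E).
Hypothesis K_range : 1 <= K < 2.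
Hypothesis a_left :
  {in `[0, x0[ &, nonincreasing_fun (fun x : R => `|x - x0| `^ K / a x)}.
Hypothesis a_right :
  {in `]x0, 1] &, nondecreasing_fun (fun x : R => `|x - x0| `^ K / a x)}.
Implicit Types (X Y : X_mu R) (c p q e x : R) (g : R -> R).

Let x0I : 0 <= x0 <= 1. Proof. by case/andP: x0_in => *; rewrite !ltW. Qed.

(** From g = w'' upwards: [flux1] is w', [flux] is w = a u'' normalised by w(0) = 0, [bend] is u'',
    [slope] is u' with its jump q at x0, and [disp] is u. *)
Definition flux1 e g x := e + prim g x.
Definition flux e g := prim (flux1 e g).
Definition bend e g x := flux e g x / a x.
Definition slope p q e g x := p + q * step x0 x + prim (bend e g) x.
Definition disp c p q e g x := c + prim (slope p q e g) x.

Lemma isprim_flux1 e g : L1_01 g -> isprim (flux1 e g) g.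
Proof. exact: isprim_affine. Qed.

Lemma isprim_flux e g : L1_01 g -> isprim (flux e g) (flux1 e g).
Proof. by move=> g1; apply/isprim_prim/isprim_self_L1/isprim_flux1. Qed.

Lemma flux1_bounded e g x : L1_01 g -> 0 < x < 1 ->
  `|flux1 e g x| <= `|e| + L1_norm01 g.
Proof.
move=> g1 /andP[h0 h1]; have := isprim_bounded (x := x) (isprim_flux1 e g1).
by rewrite /flux1 (prim_le0 g (lexx 0)) addr0; apply; rewrite !ltW.
Qed.

Lemma flux0 e g : flux e g 0 = 0.
Proof. exact: prim_le0. Qed.

Lemma L1_bend e g : L1_01 g -> flux e g x0 = 0 -> L1_01 (bend e g).
Proof.
move=> g1 w0; have [C C0 H] := flux_bounds a_cont x0_in a_x0 a_gt0 K_range a_left a_right.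
have [] // := H _ _ (`|e| + L1_norm01 g) (isprim_flux e g1).
by move=> x; exact: flux1_bounded.
Qed.

Lemma L1_flux_sqr e g : L1_01 g -> flux e g x0 = 0 ->
  L1_01 (fun x => flux e g x ^+ 2 / a x).
Proof.
move=> g1 w0; have [C C0 H] := flux_bounds a_cont x0_in a_x0 a_gt0 K_range a_left a_right.
have [] // := H _ _ (`|e| + L1_norm01 g) (isprim_flux e g1).
by move=> x; exact: flux1_bounded.
Qed.

Lemma L1_slope p q e g : L1_01 g -> flux e g x0 = 0 -> L1_01 (slope p q e g).
Proof.
move=> g1 w0.
have b1 : L1_01 (prim (bend e g)) by apply/isprim_self_L1/isprim_prim/L1_bend.
have := L1P 1 (L1P q (L1_step x0) (L1_cst p)) b1.
apply: eq_integrable => // x _; rewrite /= /slope /cst; congr EFin; ring.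
Qed.

Lemma isprim_disp c p q e g : L1_01 g -> flux e g x0 = 0 ->
  isprim (disp c p q e g) (slope p q e g).
Proof. by move=> g1 w0; apply: isprim_affine; exact: L1_slope. Qed.

Variables (beta0 beta1 gamma0 gamma1 : R).

(* With w = flux: Y = w'', X = disp, and e = w'(0), c = X(0), p = X'(0), while q is
   the jump of X' at x0 left over by the absolutely continuous part. *)
Record A1_repr X Y c p q e : Prop := A1Repr {
  repr_flux_x0 : flux e (X_fun Y) x0 = 0 ;
  repr_flux_1 : flux e (X_fun Y) 1 = 0 ;
  repr_fun : \forall x \ae mu01 R, X_fun X x = disp c p q e (X_fun Y) x ;
  repr_at0 : X_at0 X = c ;
  repr_at1 : X_at1 X = disp c p q e (X_fun Y) 1 ;
  repr_A0 : X_at0 Y = beta0 / a 0 * e - gamma0 * c ;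
  repr_A1 : X_at1 Y = - (beta1 / a 1 * flux1 e (X_fun Y) 1) - gamma1 * X_at1 X }.

Lemma repr_A1_op X Y c p q e : A1_repr X Y c p q e ->
  A1 a x0 beta0 beta1 gamma0 gamma1 (X, Y).
Proof.
move=> [w0 w1 Xf X0 X1 Y0 Y1]; have Y1' := X_L1 Y; set g := X_fun Y in w0 w1 Xf X1 Y1 Y1'.
have iu := isprim_disp c p q Y1' w0.
have iw := isprim_flux e Y1'; have iw1 := isprim_flux1 e Y1'.
have b1 := L1_bend Y1' w0; have ib := isprim_prim b1.
exists (disp c p q e g), (bend e g), (flux e g), (flux1 e g), g; split.
- split.
  + split; first exact: isprim_abs_continuous iu.
    exists (slope p q e g); first exact: isprim_derivative iu.
    have ms : measurable_fun I01 (slope p q e g) by apply: L1_measurable; exact: L1_slope.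
    have [|h hs] := @L2_of_bounded _ _ (`|p| + `|q| + (`|prim (bend e g) 0| + L1_norm01 (bend e g))) ms.
      move=> x /andP[h0 h1]; rewrite /slope.
      apply: le_trans (ler_normD _ _) _; apply: lerD.
        apply: le_trans (ler_normD _ _) _; rewrite lerD2l normrM.
        have [xc|cx] := leP x x0; first by rewrite step_le // normr0 mulr0.
        by rewrite step_gt // normr1 mulr1.
      by apply: (isprim_bounded ib); rewrite !ltW.
    by exists h; apply: ae_mu01S hs => x _ ->.
  + exists (slope p q e g); split; first exact: isprim_derivative iu.
    (* An interval that avoids x0 lies on one side of it, where [step x0] keeps its value at c'. *)
    * move=> c' d' c0 cd d1 ncd.
      have ac := isprim_abs_continuous (isprim_affine (p + q * step x0 c') b1).
      apply: abs_continuous_ext (abs_continuousS c0 d1 ac).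
      move=> x /andP[cx xd]; rewrite /slope; congr (_ + _ * _ + _).
      move: ncd; rewrite negb_and -!ltNge => /orP[h|h].
        by rewrite !step_gt // (lt_le_trans h).
      by rewrite !step_le // ltW // (le_lt_trans _ h).
    * apply: ae_mu01S2 (prim_ae_derivative b1) (ae_mu01_neq x0) => x xI db xx0.
      have : is_derive x (1 : R) (cst (p + q * step x0 x) + prim (bend e g)) (bend e g x).
        by apply: is_derive_eq; rewrite add0r.
      apply: near_eq_is_derive.
      have [xc|cx] : x < x0 \/ x0 < x by case: ltgtP xx0 => //; [left|right].
        near=> y; rewrite /slope /= -[LHS]/(_ + _) /= !step_le //; last exact: ltW.
        by rewrite ltW //; near: y; exact: lt_nbhsl.
      near=> y; rewrite /slope /= -[LHS]/(_ + _) /= !step_gt //.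
      by near: y; exact: lt_nbhsr.
  + have L := L1_flux_sqr Y1' w0.
    have ma : measurable_fun I01 (fun x => Num.sqrt (a x) * bend e g x).
      apply: measurable_funM; last exact: L1_measurable.
      have := a_powR_measurable a_cont 2^-1.
      apply: eq_measurable_fun => x; rewrite inE /= in_itv /= => /andP[h0 h1].
      by rewrite powR12_sqrt // (a_ge0 a_x0 a_gt0) // !ltW.
    have [|h hs] := @mem_L2P _ _ ma; last by exists h; apply: ae_mu01S hs => x _ ->.
    have := L; apply: eq_integrable => // x; rewrite inE /= in_itv /= => /andP[h0 h1].
    congr EFin; rewrite exprMn sqr_sqrtr; last by rewrite (a_ge0 a_x0 a_gt0) // !ltW.
    (* Where a vanishes both sides are 0, the inverse of 0 being 0. *)
    rewrite /bend exprMn; have [->|ax] := eqVneq (a x) 0; first by rewrite mul0r invr0 mulr0.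
    by field.
  + move=> x xI xx0; rewrite /bend mulrCA divff ?mulr1 // gt_eqF //; exact: a_gt0.
  + split; first exact: isprim_abs_continuous iw.
    exists (flux1 e g); first exact: isprim_derivative iw.
    split; first exact: isprim_abs_continuous iw1.
    exists g; first exact: isprim_derivative iw1.
    by exists Y.1.1; apply: nearW.
  + by rewrite /bend flux0 mul0r.
  + by rewrite /bend w1 mul0r.
- by split => //; rewrite X0 /disp (prim_le0 _ (lexx 0)) addr0.
- split; [exact: isprim_derivative iw|exact: isprim_abs_continuous iw1|exact: isprim_derivative iw1].
- split; first by apply: nearW.
  + by rewrite /= Y0 /flux1 /disp !(prim_le0 _ (lexx 0)) !addr0.
  + by rewrite /= Y1 -X1.
Unshelve. all: by end_near. Qed.

(** Uniqueness of primitives recovers w' and w from Y, with w(0) = 0 and w(1) = 0 given by u''(0) =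
    u''(1) = 0. Since sqrt(a) u'' is in L^2, w^2 / a is integrable and [flux_vanishes] gives w(x0) =
    0. Then u' is recovered on each side of x0 separately. *)
Lemma A1_op_repr X Y : A1 a x0 beta0 beta1 gamma0 gamma1 (X, Y) ->
  exists c p q e, A1_repr X Y c p q e.
Proof.
case=> u [u2] [w] [w1] [w2] [[uH1 [u1 [du acu1 du1]] sq fl wH2 u20 u21]].
move=> [Xu X0 X1] [dw acw1 dw1] [Yw Y0 Y1] /=.
rewrite /= in Xu X0 X1 Yw Y0 Y1.
have Y1' := X_L1 Y; set g := X_fun Y in Yw Y1'.
have iw1 : isprim w1 g.
  by apply: ac_isprim => //; apply: ae_mu01S2 dw1 Yw => x _ dx ->.
have iw : isprim w w1.
  by apply: ac_isprim => //; [case: wH2|exact: isprim_self_L1 iw1].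
pose e := w1 0.
have w1E x : 0 <= x <= 1 -> w1 x = flux1 e g x by move=> xI; rewrite (isprimE iw1 xI).
have i01 : 0 <= (0 : R) <= 1 by rewrite lexx ler01.
have i11 : 0 <= (1 : R) <= 1 by rewrite lexx ler01.
have n0 : (0 : R) != x0 by case/andP: x0_in => h _; rewrite lt_eqF.
have n1 : (1 : R) != x0 by case/andP: x0_in => _ h; rewrite gt_eqF.
have w00 : w 0 = 0 by rewrite fl // u20 mulr0.
have wE x : 0 <= x <= 1 -> w x = flux e g x.
  move=> xI; rewrite (isprimE iw xI) w00 add0r; apply: prim_ae.
  - by apply/ae_mu01P; apply: nearW => y /andP[y0 y1]; rewrite w1E // !ltW.
  - exact: isprim_self_L1 iw1.
  - exact: isprim_self_L1 (isprim_flux1 e Y1').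
have w2a : L1_01 (fun x => w x ^+ 2 / a x).
  case: sq => h hs; apply: L1_ae (L2_sqr_L1 h).
    apply: ae_mu01S2 hs (ae_mu01_neq x0) => x /andP[h0 h1] <- xx0.
    have xI : 0 <= x <= 1 by rewrite !ltW.
    rewrite exprMn sqr_sqrtr ?(a_ge0 a_x0 a_gt0) // fl //.
    by field; rewrite gt_eqF // a_gt0.
  apply: measurable_funM; last exact: inv_a_measurable a_cont a_x0 a_gt0.
  by apply: measurable_funX; exact: isprim_measurable iw.
have wx0 : w x0 = 0.
  apply: (flux_vanishes a_cont x0_in a_x0 a_gt0 K_range a_left a_right a_strong iw _ w2a
    (M := `|w1 0| + L1_norm01 g)).
  by move=> x /andP[h0 h1]; apply: (isprim_bounded iw1); rewrite !ltW.
have f0 : flux e g x0 = 0 by rewrite -wE.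
have b1 := L1_bend Y1' f0; have ib := isprim_prim b1.
have u2E x : 0 < x < 1 -> x != x0 -> u2 x = bend e g x.
  move=> /andP[h0 h1] xx0; have xI : 0 <= x <= 1 by rewrite !ltW.
  by rewrite /bend -wE // fl // mulrAC divff ?mul1r // gt_eqF // a_gt0.
have {}du1 : \forall x \ae mu01 R, is_derive x (1 : R) u1 (bend e g x).
  by apply: ae_mu01S2 du1 (ae_mu01_neq x0) => x xI dx xx0; rewrite -u2E.
move/ae_mu01P : (du1) => du1'.
have dsub (y z : R) : 0 <= y -> z <= 1 ->
    {ae mu, forall x, y < x < z -> is_derive x (1 : R) u1 (bend e g x)}.
  move=> y0 z1; apply: filterS du1'; first exact: (ae_filter_ringOfSetsType mu).
  by move=> x /= h /andP[yx xz]; apply: h; rewrite (le_lt_trans y0) // (lt_le_trans xz).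
(* The constant of integration of u' is read at 0 on the left of x0 and at 1 on its right; q is the
   difference. *)
pose p := u1 0; pose q := u1 1 - prim (bend e g) 1 - p.
have u1E x : 0 < x < 1 -> x != x0 -> u1 x = slope p q e g x.
  move=> /andP[h0 h1] xx0; rewrite /slope.
  have [xc|cx] : x < x0 \/ x0 < x by case: ltgtP xx0 => //; [left|right].
    have ac : abs_continuous 0 x u1.
      by apply: acu1 => //; rewrite ?(ltW h0) ?(ltW h1) // negb_and -!ltNge xc orbT.
    rewrite (prim_unique (lexx 0) (ltW h1) ac (dsub _ _ (lexx 0) (ltW h1)) b1 (x := x)) ?(ltW h0) ?lexx //.
    by rewrite step_le ?(ltW xc) // (prim_le0 _ (lexx 0)) subr0 mulr0 addr0.
  have ac : abs_continuous x 1 u1.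
    by apply: acu1 => //; rewrite ?(ltW h0) ?(ltW h1) // negb_and -!ltNge cx.
  have := prim_unique (ltW h0) (lexx 1) ac (dsub _ _ (ltW h0) (lexx 1)) b1 (x := 1).
  rewrite (ltW h1) lexx => /(_ isT) E; rewrite step_gt // /q E; ring.
have iu : isprim u (slope p q e g).
  apply: ac_isprim; [by case: uH1| |exact: L1_slope].
  by apply: ae_mu01S2 du (ae_mu01_neq x0) => x xI dx xx0; rewrite -u1E.
have uE x : 0 <= x <= 1 -> u x = disp (u 0) p q e g x.
  by move=> xI; rewrite (isprimE iu xI).
exists (u 0), p, q, e; split => //.
- by rewrite -/g -wE // fl // u21 mulr0.
- by apply: ae_mu01S Xu => x /andP[h0 h1] ->; rewrite uE // !ltW.
- by rewrite X1 uE.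
- by rewrite -/g -w1E // X1.
Qed.

End representation.

Local Opaque prim.

Lemma slope_combination (S : comPzRingType) (k p q u p' q' v s : S) :
  k * p + p' + (k * q + q') * s + (k * u + v) = k * (p + q * s + u) + (p' + q' * s + v).
Proof. ring. Qed.

(** * Green's formula, symmetry and maximality of A_1 *)

Section wentzell.
Context {R : realType}.
Local Notation mu := (@lebesgue_measure R).
Local Notation T := (measurableTypeR R).
Local Notation I01 := (`]0, 1[%classic : set T).
Variables (a : R -> R) (x0 K : R).
Hypothesis a_cont : {within `[0, 1], continuous a}.
Hypothesis x0_in : 0 < x0 < 1.
Hypothesis a_x0 : a x0 = 0.
Hypothesis a_gt0 : forall x : R, 0 <= x <= 1 -> x != x0 -> 0 < a x.
Hypothesis a_strong :
  ~ lebesgue_measure.-integrable `]0, 1[ (fun x : R => ((a x)^-1)%:E).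
Hypothesis K_range : 1 <= K < 2.
Hypothesis a_left :
  {in `[0, x0[ &, nonincreasing_fun (fun x : R => `|x - x0| `^ K / a x)}.
Hypothesis a_right :
  {in `]x0, 1] &, nondecreasing_fun (fun x : R => `|x - x0| `^ K / a x)}.
Implicit Types (X Y : X_mu R) (c p q d e x k beta gamma : R) (g h : R -> R).

Local Notation repr := (A1_repr a x0).
Local Notation A := (A1 a x0).
Local Notation dot := (X_mu_dot a).
Local Notation flux := (@flux R).

Let A_repr := A1_op_repr a_cont x0_in a_x0 a_gt0 a_strong K_range a_left a_right.
Let repr_A := repr_A1_op a_cont x0_in a_x0 a_gt0 K_range a_left a_right.
Let bend_L1 := L1_bend a_cont x0_in a_x0 a_gt0 K_range a_left a_right.
Let slope_L1 := L1_slope a_cont x0_in a_x0 a_gt0 K_range a_left a_right.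
Let disp_isprim := isprim_disp a_cont x0_in a_x0 a_gt0 K_range a_left a_right.

Let x0I : 0 <= x0 <= 1. Proof. by case/andP: x0_in => *; rewrite !ltW. Qed.
Let a0_gt0 : 0 < a 0.
Proof. by apply: a_gt0; [rewrite lexx ler01|case/andP: x0_in => h _; rewrite lt_eqF]. Qed.
Let a1_gt0 : 0 < a 1.
Proof. by apply: a_gt0; [rewrite lexx ler01|case/andP: x0_in => _ h; rewrite gt_eqF]. Qed.

Lemma flux1_linear k e e' Y Y' x : flux1 (k * e + e') (X_fun (k *: Y + Y')) x =
  k * flux1 e (X_fun Y) x + flux1 e' (X_fun Y') x.
Proof.
rewrite /flux1 (prim_ae x (X_fun_linear k Y Y')); last 2 first.
- exact: X_L1.
- by apply: L1P; exact: X_L1.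
by rewrite primP; [ring|exact: X_L1|exact: X_L1].
Qed.

Lemma flux_linear k e e' Y Y' x : flux (k * e + e') (X_fun (k *: Y + Y')) x =
  k * flux e (X_fun Y) x + flux e' (X_fun Y') x.
Proof.
rewrite /flux; have -> : flux1 (k * e + e') (X_fun (k *: Y + Y')) =
    fun x => k * flux1 e (X_fun Y) x + flux1 e' (X_fun Y') x.
  by apply/funext => t; exact: flux1_linear.
by rewrite primP //; apply/isprim_self_L1/isprim_flux1/X_L1.
Qed.

Lemma disp_linear k c c' p p' q q' e e' d g g' h x : L1_01 g -> L1_01 g' ->
  (forall x, flux d h x = k * flux e g x + flux e' g' x) ->
  flux e g x0 = 0 -> flux e' g' x0 = 0 ->
  disp a x0 (k * c + c') (k * p + p') (k * q + q') d h x =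
  k * disp a x0 c p q e g x + disp a x0 c' p' q' e' g' x.
Proof.
move=> g1 g1' F w0 w0'; have b1 := bend_L1 g1 w0; have b1' := bend_L1 g1' w0'.
have B : bend a d h = fun x => k * bend a e g x + bend a e' g' x.
  by apply/funext => t; rewrite /bend F mulrDl mulrA.
have S : slope a x0 (k * p + p') (k * q + q') d h =
    fun x => k * slope a x0 p q e g x + slope a x0 p' q' e' g' x.
  apply/funext => t; rewrite /slope B (primP k t b1 b1').
  exact: slope_combination.
have s1 := slope_L1 p q g1 w0; have s1' := slope_L1 p' q' g1' w0'.
rewrite /disp S (primP k x s1 s1').
by rewrite mulrDr addrACA.
Qed.

Lemma repr_linear beta0 beta1 gamma0 gamma1 k X Y X' Y' c p q e c' p' q' e' :
  repr beta0 beta1 gamma0 gamma1 X Y c p q e ->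
  repr beta0 beta1 gamma0 gamma1 X' Y' c' p' q' e' ->
  repr beta0 beta1 gamma0 gamma1 (k *: X + X') (k *: Y + Y')
    (k * c + c') (k * p + p') (k * q + q') (k * e + e').
Proof.
move=> [w0 w1 f X0 X1 Y0 Y1] [w0' w1' f' X0' X1' Y0' Y1'].
have F := flux_linear k e e' Y Y'; split.
- by rewrite flux_linear w0 w0' mulr0 addr0.
- by rewrite flux_linear w1 w1' mulr0 addr0.
- have ff' : \forall x \ae mu01 R, X_fun X x = disp a x0 c p q e (X_fun Y) x /\
      X_fun X' x = disp a x0 c' p' q' e' (X_fun Y') x.
    by apply: ae_mu01S2 f f' => x _.
  apply: ae_mu01S2 (X_fun_linear k X X') ff' => x _ -> [-> ->].
  by rewrite (disp_linear _ _ _ _ _ _ _ (X_L1 Y) (X_L1 Y') F).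
- by rewrite X_at0_linear X0 X0'.
- by rewrite X_at1_linear X1 X1' (disp_linear _ _ _ _ _ _ _ (X_L1 Y) (X_L1 Y') F).
- by rewrite X_at0_linear Y0 Y0'; ring.
- by rewrite !X_at1_linear Y1 Y1' flux1_linear; ring.
Qed.

Lemma A_linear beta0 beta1 gamma0 gamma1 : linear_op (A beta0 beta1 gamma0 gamma1).
Proof.
move=> k X Y X' Y' /A_repr[c [p [q [e r]]]] /A_repr[c' [p' [q' [e' r']]]].
exact: repr_A (repr_linear k r r').
Qed.

(** For fluxes w = a u'' and w' = a v'' this is the bending energy, the integral of a u'' v''. *)
Definition energy e g e' g' :=
  \int[mu]_(x in I01) (flux e g x * flux e' g' x / a x).

Lemma energyC e g e' g' : energy e g e' g' = energy e' g' e g.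
Proof.
have I (v w : R -> R) :
    \int[mu]_(x in I01) (v x * w x / a x) = \int[mu]_(x in I01) (w x * v x / a x).
  by apply: eq_Rintegral => x _; rewrite (mulrC (v x)).
exact: I.
Qed.

Lemma energy0 e g e' g' : (forall x, flux e' g' x = 0) -> energy e g e' g' = 0.
Proof.
move=> w0; transitivity (\int[mu]_(x in I01) cst 0 x); last first.
  by rewrite (@Rintegral_cst _ _ _ mu I01) // mul0r.
by apply: eq_Rintegral => x _; rewrite w0 mulr0 mul0r.
Qed.

(** Two integrations by parts against v' = p' + q' [step x0] + (primitive of v''): the step
    contributes the increment of the flux from x0 to 1. The flux of g is left free at x0 and 1, so
    that the formula also tests an arbitrary Y against the kernel. *)
Lemma integral_mul_disp e g c' p' q' e' g' : L1_01 g -> L1_01 g' ->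
  flux e' g' x0 = 0 ->
  \int[mu]_(x in I01) (g x * disp a x0 c' p' q' e' g' x) =
  flux1 e g 1 * disp a x0 c' p' q' e' g' 1 - e * c'
  - (p' * flux e g 1 + (q' * (flux e g 1 - flux e g x0)
      + (flux e g 1 * prim (bend a e' g') 1 - energy e g e' g'))).
Proof.
move=> g1 g1' w0'.
have iw1 := isprim_flux1 e g1; have iw := isprim_flux e g1.
have B' := bend_L1 g1' w0'; have iB' := isprim_prim B'.
have iu' := disp_isprim c' p' q' g1' w0'.
have L1 := isprim_self_L1 iw1.
have Lw1S : L1_01 (fun x => step x0 x * flux1 e g x) by exact: isprim_L1M iw1 (L1_step x0).
have Lw1B : L1_01 (fun x => flux1 e g x * prim (bend a e' g') x) by exact: isprim_L1M iB' L1.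
have u'0 : disp a x0 c' p' q' e' g' 0 = c' by rewrite /disp (prim_le0 _ (lexx 0)) addr0.
have w10 : flux1 e g 0 = e by rewrite /flux1 (prim_le0 _ (lexx 0)) addr0.
rewrite (integration_by_parts01 iw1 iu') u'0 w10; congr (_ - _).
transitivity (\int[mu]_(x in I01) (p' * flux1 e g x +
     (q' * (step x0 x * flux1 e g x) + flux1 e g x * prim (bend a e' g') x))).
  by apply: eq_Rintegral => x _; rewrite /slope; ring.
have Lp : L1_01 (fun x => p' * flux1 e g x) by exact: integrableZl L1.
have Lq : L1_01 (fun x => q' * (step x0 x * flux1 e g x)) by exact: integrableZl Lw1S.
rewrite integralD01 //; last exact: L1P.
rewrite integralD01 // !RintegralZl // integral_step // -(prim_ge1 _ (lexx 1)).
rewrite -!/(flux e g _) (integration_by_parts01 iw iB') flux0 mul0r subr0.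
congr (_ + (_ + (_ - _))); rewrite /energy; apply: eq_Rintegral => x _.
by rewrite mulrC /bend mulrA.
Qed.

(** The terms in p' and q' vanish with the flux at x0 and 1. The boundary terms in w' cancel against
    the boundary values of Y, whose weights a(j) / beta_j undo the factors beta_j / a(j), and only
    those in gamma are left. *)
Lemma green beta0 beta1 gamma0 gamma1 X Y X' Y' c p q e c' p' q' e' :
  0 < beta0 -> 0 < beta1 ->
  repr beta0 beta1 gamma0 gamma1 X Y c p q e ->
  repr beta0 beta1 gamma0 gamma1 X' Y' c' p' q' e' ->
  dot beta0 beta1 Y X' =
  energy e (X_fun Y) e' (X_fun Y')
  - a 0 * gamma0 / beta0 * (X_at0 X * X_at0 X')
  - a 1 * gamma1 / beta1 * (X_at1 X * X_at1 X').
Proof.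
move=> b0 b1 [w0 w1 f X0 X1 Y0 Y1] [w0' w1' f' X0' X1' Y0' Y1'].
have iu' := disp_isprim c' p' q' (X_L1 Y') w0'.
have E1 : \int[mu]_(x in I01) (X_fun Y x * X_fun X' x) =
    \int[mu]_(x in I01) (X_fun Y x * disp a x0 c' p' q' e' (X_fun Y') x).
  apply: integral_ae01; [|exact: X_mul_L1|exact: isprim_L1M iu' (X_L1 Y)].
  by apply: ae_mu01S f' => x _ ->.
rewrite /X_mu_dot E1 (integral_mul_disp e c' p' q' (X_L1 Y) (X_L1 Y') w0').
rewrite w0 w1 Y0 Y1 X0 X0' -X1'.
field; rewrite !gt_eqF //.
Qed.

Local Opaque energy.

Lemma A_symmetric beta0 beta1 gamma0 gamma1 : 0 < beta0 -> 0 < beta1 ->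
  symmetric_op (dot beta0 beta1) (A beta0 beta1 gamma0 gamma1).
Proof.
move=> b0 b1 X Y X' Y' /A_repr[c [p [q [e r]]]] /A_repr[c' [p' [q' [e' r']]]].
have hd := X_mu_hilbert a0_gt0 a1_gt0 b0 b1.
rewrite (hdotC hd X Y') (green b0 b1 r r') (green b0 b1 r' r) energyC.
by rewrite (mulrC (X_at0 X) (X_at0 X')) (mulrC (X_at1 X) (X_at1 X')).
Qed.

Lemma A_nonnegative beta0 beta1 gamma0 gamma1 : 0 < beta0 -> 0 < beta1 ->
  gamma0 <= 0 -> gamma1 <= 0 ->
  nonnegative_op (dot beta0 beta1) (A beta0 beta1 gamma0 gamma1).
Proof.
move=> b0 b1 g0 g1 X Y /A_repr[c [p [q [e r]]]]; rewrite (green b0 b1 r r).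
have bdry (b al ga z : R) : 0 < b -> 0 < al -> ga <= 0 -> 0 <= - (al * ga / b * (z * z)).
  move=> b_gt0 al0 ga0; rewrite -mulNr mulr_ge0 // -?expr2 ?sqr_ge0 //.
  by rewrite -mulNr -mulrN mulr_ge0 ?invr_ge0 ?(ltW b_gt0) // mulr_ge0 ?oppr_ge0 // ltW.
rewrite !addr_ge0 ?bdry // Rintegral_ge0 // => x.
rewrite /= in_itv /= => /andP[h0 h1]; rewrite divr_ge0 // -?expr2 ?sqr_ge0 //.
by rewrite (a_ge0 a_x0 a_gt0) // !ltW.
Qed.

(** The energy of Y is zero, so its flux w vanishes almost everywhere, then everywhere by
    continuity; w' and w'' vanish in turn, and with them all components of Y. *)
Lemma A_functional beta0 beta1 gamma0 gamma1 Y : 0 < beta0 -> 0 < beta1 ->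
  A beta0 beta1 gamma0 gamma1 (0, Y) -> Y = 0.
Proof.
move=> b0 b1 /A_repr[c [p [q [e r]]]].
have hd := X_mu_hilbert a0_gt0 a1_gt0 b0 b1.
have := green b0 b1 r r; rewrite (dot0r hd).
have [w0 w1 f X0 X1 Y0 Y1] := r.
have -> : X_at0 (0 : X_mu R) = 0 by [].
have -> : X_at1 (0 : X_mu R) = 0 by [].
rewrite !mul0r !mulr0 !subr0 => /esym I0.
have g1 := X_L1 Y; have iw := isprim_flux e g1; have iw1 := isprim_flux1 e g1.
have W0 : \forall x \ae mu01 R, flux e (X_fun Y) x * flux e (X_fun Y) x / a x = 0.
  apply: integral01_eq0 => //.
    have := L1_flux_sqr a_cont x0_in a_x0 a_gt0 K_range a_left a_right g1 w0.
    by apply: eq_integrable => // x _; rewrite /= expr2.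
  move=> x /andP[h0 h1]; rewrite divr_ge0 // -?expr2 ?sqr_ge0 //.
  by rewrite (a_ge0 a_x0 a_gt0) // !ltW.
have {}W0 : \forall x \ae mu01 R, flux e (X_fun Y) x = 0.
  apply: ae_mu01S2 W0 (ae_mu01_neq x0) => x /andP[h0 h1] /eqP + xx0.
  have ax : 0 < a x by apply: a_gt0 => //; rewrite !ltW.
  by rewrite mulf_eq0 mulf_eq0 orbb invr_eq0 (gt_eqF ax) orbF => /eqP.
have [_ F0] := isprim_ae0 iw W0.
have [F00 G0] := isprim_ae0 iw1 F0.
have e0 : e = 0.
  by have := F00 0; rewrite /flux1 (prim_le0 _ (lexx 0)) addr0; apply; rewrite lexx ler01.
apply: X_mu_ext.
- have Z : \forall x \ae mu01 R, X_fun (0 : X_mu R) x = 0.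
    exact: (Lspace_zeroE (mu01 R) (lee1n 2)).
  by apply: ae_mu01S2 G0 Z => x _ -> ->.
- by rewrite Y0 e0 -X0 !mulr0 subr0.
- by rewrite Y1 F00 ?lexx ?ler01 // (_ : X_at1 (0 : X_mu R) = 0) // !mulr0 subr0 oppr0.
Qed.

Lemma integral01_le (f : R -> R) k : L1_01 f -> (forall x, 0 < x < 1 -> f x <= k) ->
  \int[mu]_(x in I01) f x <= k.
Proof.
move=> f1 fk; apply: (@le_trans _ _ (\int[mu]_(x in I01) cst k x)).
  apply: le_Rintegral; [exact: measurable_itv|exact: f1|exact: L1_cst|].
  by move=> x; rewrite /= in_itv /=; exact: fk.
rewrite (@Rintegral_cst _ _ _ mu I01) //.
suff -> : k * fine (@lebesgue_measure R I01) = k by [].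
by rewrite lebesgue_measure_I01 mulr1.
Qed.

(** * Solving A_1 X = Y for gamma = 0 *)

Section range.
Variables beta0 beta1 : R.
Hypotheses (b0 : 0 < beta0) (b1 : 0 < beta1).
Let hd := X_mu_hilbert a0_gt0 a1_gt0 b0 b1.
Local Notation repr0 := (repr beta0 beta1 0 0).
Local Notation N := (dotnorm (dot beta0 beta1)).

Lemma repr_uniq X X' Y c p q e : repr0 X Y c p q e -> repr0 X' Y c p q e -> X = X'.
Proof.
move=> [_ _ f X0 X1 _ _] [_ _ f' X0' X1' _ _]; apply: X_mu_ext.
- by apply: ae_mu01S2 f f' => x _ -> ->.
- by rewrite X0 X0'.
- by rewrite X1 X1'.
Qed.

Lemma repr_ex Y c p q e : flux e (X_fun Y) x0 = 0 -> flux e (X_fun Y) 1 = 0 ->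
  X_at0 Y = beta0 / a 0 * e -> X_at1 Y = - (beta1 / a 1 * flux1 e (X_fun Y) 1) ->
  exists X, repr0 X Y c p q e.
Proof.
move=> w0 w1 Y0 Y1; have [X [Xf X0 X1]] := isprim_embed (disp_isprim c p q (X_L1 Y) w0).
exists X; split => //.
- by rewrite X0 /disp (prim_le0 _ (lexx 0)) addr0.
- by rewrite Y0 mul0r subr0.
- by rewrite Y1 mul0r subr0.
Qed.

Lemma X_fun0 : \forall x \ae mu01 R, X_fun (0 : X_mu R) x = 0.
Proof. exact: (Lspace_zeroE (mu01 R) (lee1n 2)). Qed.

Lemma prim_X_fun0 x : prim (X_fun (0 : X_mu R)) x = 0.
Proof.
by rewrite (@prim_ae _ _ (cst 0) x X_fun0 (X_L1 _) (L1_cst 0)) prim_cst0.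
Qed.

Lemma flux1_X0 x : flux1 0 (X_fun (0 : X_mu R)) x = 0.
Proof. by rewrite /flux1 prim_X_fun0 addr0. Qed.

Lemma flux_X0 x : flux 0 (X_fun (0 : X_mu R)) x = 0.
Proof.
rewrite /flux (_ : flux1 0 _ = cst 0); first exact: prim_cst0.
by apply/funext => t; exact: flux1_X0.
Qed.

Lemma prim_bend_X0 x : prim (bend a 0 (X_fun (0 : X_mu R))) x = 0.
Proof.
rewrite (_ : bend a 0 _ = cst 0); first exact: prim_cst0.
by apply/funext => t; rewrite /bend flux_X0 mul0r.
Qed.

(** The element c + p x + q (x - x0)^+ of the kernel. *)
Lemma kernel_ex c p q : exists n, repr0 n 0 c p q 0.
Proof.
apply: repr_ex; rewrite ?flux_X0 //; first by rewrite mulr0.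
by rewrite flux1_X0 mulr0 oppr0.
Qed.

(** Here e is the value of w'(0) forced by the boundary value of Y at 0, and the pairing exhibits
    the defects of the three remaining conditions, on w'(1), w(1) and w(x0). *)
Lemma dot_kernel Y n c p q : repr0 n 0 c p q 0 ->
  let e := a 0 / beta0 * X_at0 Y in
  dot beta0 beta1 Y n = (flux1 e (X_fun Y) 1 + a 1 / beta1 * X_at1 Y) * X_at1 n
  - p * flux e (X_fun Y) 1 - q * (flux e (X_fun Y) 1 - flux e (X_fun Y) x0).
Proof.
move=> [w0 _ f n0 n1 _ _] e; have iu := disp_isprim c p q (X_L1 (0 : X_mu R)) w0.
have E1 : \int[mu]_(x in I01) (X_fun Y x * X_fun n x) =
    \int[mu]_(x in I01) (X_fun Y x * disp a x0 c p q 0 (X_fun (0 : X_mu R)) x).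
  apply: integral_ae01; [|exact: X_mul_L1|exact: isprim_L1M iu (X_L1 Y)].
  by apply: ae_mu01S f => x _ ->.
have E0 : energy e (X_fun Y) 0 (X_fun (0 : X_mu R)) = 0.
  by apply: energy0 => x; exact: flux_X0.
rewrite /X_mu_dot E1 (integral_mul_disp e c p q (X_L1 Y) (X_L1 _) w0) E0 prim_bend_X0.
rewrite -n1 n0 /e; field; rewrite !gt_eqF //.
Qed.

(** Orthogonality to 1 gives the condition on w'(1), then orthogonality to x gives w(1) = 0, and
    finally orthogonality to (x - x0)^+ gives w(x0) = 0. *)
Lemma kernel_orthogonal_solve n0 n1 n2 Y :
  repr0 n0 0 1 0 0 0 -> repr0 n1 0 0 1 0 0 -> repr0 n2 0 0 0 1 0 ->
  dot beta0 beta1 Y n0 = 0 -> dot beta0 beta1 Y n1 = 0 -> dot beta0 beta1 Y n2 = 0 ->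
  exists X, repr0 X Y 0 0 0 (a 0 / beta0 * X_at0 Y).
Proof.
move=> r0 r1 r2; rewrite (dot_kernel Y r0) (dot_kernel Y r1) (dot_kernel Y r2).
set e := a 0 / beta0 * X_at0 Y => h0 h1 h2.
have n0E : X_at1 n0 = 1.
  rewrite (repr_at1 r0) /disp /slope (_ : (fun _ => _) = cst 0).
    by rewrite prim_cst0 addr0.
  by apply/funext => t; rewrite prim_bend_X0 mul0r !addr0.
have g0 : flux1 e (X_fun Y) 1 + a 1 / beta1 * X_at1 Y = 0.
  by move: h0; rewrite n0E mulr1 !mul0r !subr0.
move: h1 h2; rewrite g0 !mul0r !sub0r !subr0 !mul1r => /eqP; rewrite oppr_eq0 => /eqP w1.
rewrite oppr0 sub0r w1 sub0r opprK => w0.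
apply: repr_ex => //.
- have E : beta0 / a 0 * (a 0 / beta0) = 1 by field; rewrite !gt_eqF.
  by rewrite /e mulrA E mul1r.
- have E : beta1 / a 1 * (a 1 / beta1) = 1 by field; rewrite !gt_eqF.
  by move/eqP: g0; rewrite addr_eq0 => /eqP ->; rewrite mulrN opprK mulrA E mul1r.
Qed.

Lemma repr_decomposition n0 n1 n2 X D Y c p q e :
  repr0 n0 0 1 0 0 0 -> repr0 n1 0 0 1 0 0 -> repr0 n2 0 0 0 1 0 ->
  repr0 X Y c p q e -> repr0 D Y 0 0 0 e ->
  X = c *: n0 + (p *: n1 + (q *: n2 + D)).
Proof.
move=> r0 r1 r2 r rD; apply: (repr_uniq r).
have := repr_linear c r0 (repr_linear p r1 (repr_linear q r2 rD)).
by rewrite !scaler0 !mulr1 !mulr0 !(add0r, addr0).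
Qed.

(** With s_j = a(j) / beta_j, |w'| <= |e| + |Y|_1 <= (2 + s0) N(Y); [flux_bounds] turns this into a
    bound b on the L^1 norm of u'', which then bounds u' and u since u(0) = 0 and u'(0) = 0 with no
    jump. Finally N(D)^2 <= (1 + s1) b^2. *)
Lemma dist_kernel_bound : exists2 C, 0 < C & forall D Y e,
  repr0 D Y 0 0 0 e -> N D <= C * N Y.
Proof.
have [C C0 H] := flux_bounds a_cont x0_in a_x0 a_gt0 K_range a_left a_right.
pose s0 := a 0 / beta0; pose s1 := a 1 / beta1.
have s00 : 0 < s0 by rewrite divr_gt0.
have s10 : 0 < s1 by rewrite divr_gt0.
exists ((1 + s1) * (C * (2 + s0))).
  by rewrite !mulr_gt0 // addr_gt0.
move=> D Y e r; have [w0 w1 f D0 D1 Y0 Y1] := r; have g1 := X_L1 Y.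
have NY := dotnorm_ge0 (dot beta0 beta1) Y.
have [hY hY0 _] := X_mu_dot_ge a0_gt0 a1_gt0 b0 b1 Y.
have e_le : `|e| <= (1 + s0) * N Y.
  have eE : e = s0 * X_at0 Y.
    by rewrite Y0 mul0r subr0 /s0; field; rewrite !gt_eqF.
  rewrite -(@ler_pXn2r _ 2) ?nnegrE ?mulr_ge0 ?addr_ge0 ?(ltW s00) //.
  rewrite real_normK ?num_real // eE exprMn [leRHS]exprMn (dotnorm_sqr hd).
  have : s0 * (s0 * X_at0 Y ^+ 2) <= s0 * dot beta0 beta1 Y Y by rewrite ler_pM2l.
  have : 0 <= dot beta0 beta1 Y Y by exact: (hdot_ge0 hd).
  move: (dot _ _ Y Y) (X_at0 Y) => t y t0 h; nra.
have g_le : L1_norm01 (X_fun Y) <= N Y.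
  apply/ler_addgt0Pr => d d0; have Nd : 0 < N Y + d by rewrite ltr_wpDl.
  have [||//] := @L1_norm_le_sqr _ (X_fun Y) (N Y + d) _ (L2_sqr_L1 Y.1.1) Nd.
    exact: L1_measurable.
  apply: le_trans hY _; rewrite -(dotnorm_sqr hd) ler_pXn2r ?nnegrE ?(ltW Nd) //.
  by rewrite lerDl ltW.
have iw := isprim_flux e g1.
have [b1' bC _] := H _ _ _ iw (fun x => flux1_bounded e g1) w0.
set b := L1_norm01 _ in bC.
have b_ge0 : 0 <= b by exact: L1_norm_ge0.
have s_le t : `|slope a x0 0 0 e (X_fun Y) t| <= b.
  rewrite /slope mul0r !add0r; have [t0|t0] := leP t 0.
    by rewrite prim_le0 // normr0.
  by have := prim_normr b1' (ltW t0); rewrite (prim_le0 _ (lexx 0)) subr0.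
have d_le t : 0 <= t <= 1 -> `|disp a x0 0 0 0 e (X_fun Y) t| <= b.
  move=> /andP[t0 t1]; rewrite /disp add0r.
  have := prim_lipschitz (slope_L1 0 0 g1 w0) (fun t _ => s_le t) t0.
  rewrite (prim_le0 _ (lexx 0)) !subr0 => h; apply: le_trans h _.
  by rewrite ler_piMr.
have b_le : b <= C * (2 + s0) * N Y.
  apply: le_trans bC _; rewrite -mulrA ler_pM2l //.
  by move: e_le g_le; rewrite !mulrDl; lra.
have iD := disp_isprim 0 0 0 g1 w0.
apply: (@le_trans _ _ ((1 + s1) * b)); last by rewrite -mulrA ler_pM2l // addr_gt0.
apply: (dotnorm_le hd); first by rewrite mulr_ge0 // addr_ge0 // ltW.
have sq : \int[mu]_(x in I01) X_fun D x ^+ 2 <= b ^+ 2.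
  have L : L1_01 (fun x => disp a x0 0 0 0 e (X_fun Y) x ^+ 2).
    exact: (isprim_L1M iD (isprim_self_L1 iD)).
  rewrite (@integral_ae01 _ _ (fun x => disp a x0 0 0 0 e (X_fun Y) x ^+ 2)) //.
  - apply: integral01_le => // x /andP[h0 h1].
    rewrite -real_normK ?num_real // ler_pXn2r ?nnegrE ?d_le //.
    by rewrite (ltW h0) (ltW h1).
  - by apply: ae_mu01S f => x _ ->.
  - exact: L2_sqr_L1.
have D1_le : X_at1 D ^+ 2 <= b ^+ 2.
  by rewrite D1 -real_normK ?num_real // ler_pXn2r ?nnegrE ?d_le // ler01 lexx.
rewrite X_mu_dotE D0 expr0n mulr0 addr0 -/s1.
move: sq D1_le; move: (\int[mu]_(x in I01) _) (X_at1 D) => t y; nra.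
Qed.

(** A solution X orthogonal to the kernel differs from the normalised solution D by an element of
    the kernel, so <X, X> = <X, D> and N(X) <= N(D) <= C N(Y), the bound that [range_full_kernel]
    asks for. *)
Lemma range_full_gamma0 (h : R) : 0 < h -> range_full (A beta0 beta1 0 0) h.
Proof.
move=> h0.
have [n0 r0] := kernel_ex 1 0 0; have [n1 r1] := kernel_ex 0 1 0.
have [n2 r2] := kernel_ex 0 0 1; have [C C0 HC] := dist_kernel_bound.
have al := @A_linear beta0 beta1 0 0.
have ann := A_nonnegative b0 b1 (lexx 0) (lexx 0).
apply: (range_full_all hd al ann (h := 2 * C) _ _ h0); first by rewrite mulr_gt0.
apply: (range_full_kernel hd (s := [:: n0; n1; n2]) al) => //.
- by move=> n; rewrite !inE => /or3P[]/eqP->; [exact: repr_A r0|exact: repr_A r1|exact: repr_A r2].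
- move=> Y oY; have [|||X r] := @kernel_orthogonal_solve n0 n1 n2 Y r0 r1 r2.
  + by apply: oY; rewrite !inE eqxx.
  + by apply: oY; rewrite !inE eqxx orbT.
  + by apply: oY; rewrite !inE eqxx !orbT.
  by exists X; exact: repr_A r.
move=> X Y /A_repr[c [p [q [e r]]]] oX.
have [w0 w1 f X0 X1 Y0 Y1] := r.
have [||D rD] := @repr_ex Y 0 0 0 e w0 w1.
- by rewrite Y0 mul0r subr0.
- by rewrite Y1 mul0r subr0.
apply: le_trans (HC _ _ _ rD).
have XD : dot beta0 beta1 X X = dot beta0 beta1 X D.
  rewrite [X in dot _ _ _ X = _](repr_decomposition r0 r1 r2 r rD) !(dotE hd).
  by rewrite (oX n0) ?(oX n1) ?(oX n2) ?inE ?eqxx ?orbT // !mulr0 !add0r.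
have := dot_le_dotnorm hd X D; rewrite -XD -(dotnorm_sqr hd) expr2.
have [->|d0] := eqVneq (N X) 0; first by rewrite dotnorm_ge0.
by rewrite ler_pM2l // lt_def d0 dotnorm_ge0.
Qed.

End range.

(* The equation (1 + h A) X = Y with coefficients (beta, gamma) is the one with
   coefficients (beta / (1 - h gamma), 0) and rescaled boundary values of Y. *)
Lemma range_full_A beta0 beta1 gamma0 gamma1 (h : R) : 0 < beta0 -> 0 < beta1 ->
  gamma0 <= 0 -> gamma1 <= 0 -> 0 < h ->
  range_full (A beta0 beta1 gamma0 gamma1) h.
Proof.
move=> b0 b1 g0 g1 h0 Y; pose k0 := 1 - h * gamma0; pose k1 := 1 - h * gamma1.
have k00 : 0 < k0 by rewrite /k0; nra.
have k10 : 0 < k1 by rewrite /k1; nra.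
have [X [Z [AX XZ]]] := range_full_gamma0 (divr_gt0 b0 k00) (divr_gt0 b1 k10) h0
  ((Y.1.1, X_at0 Y / k0), X_at1 Y / k1).
have {AX}[c [p [q [e [w0 w1 f X0 X1 Z0 Z1]]]]] := A_repr AX.
(* W keeps the L^2 component of Z, hence the flux, and takes the boundary values prescribed by beta
   and gamma. Then X_j + h z_j is k_j times X_j + h Z_j, which undoes the rescaling of Y. The
   property [range_full] does not involve the inner product, so the change of beta is harmless. *)
pose z0 := beta0 / a 0 * e - gamma0 * c.
pose z1 := - (beta1 / a 1 * flux1 e (X_fun Z) 1) - gamma1 * X_at1 X.
pose W : X_mu R := ((Z.1.1, z0), z1).
exists X, W; split; first by apply: (@repr_A _ _ _ _ X W c p q e).
have E0 : X_at0 X + h * z0 = X_at0 Y.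
  have : X_at0 X + h * X_at0 Z = X_at0 Y / k0.
    by rewrite -[RHS]/(X_at0 ((Y.1.1, X_at0 Y / k0), X_at1 Y / k1)) -XZ.
  move/esym/(canRL (divfK (lt0r_neq0 k00))) ->; rewrite Z0 mul0r subr0 X0 /z0 /k0.
  by field; rewrite !gt_eqF.
have E1 : X_at1 X + h * z1 = X_at1 Y.
  have : X_at1 X + h * X_at1 Z = X_at1 Y / k1.
    by rewrite -[RHS]/(X_at1 ((Y.1.1, X_at0 Y / k0), X_at1 Y / k1)) -XZ.
  move/esym/(canRL (divfK (lt0r_neq0 k10))) ->; rewrite Z1 mul0r subr0 /z1 /k1.
  by field; rewrite !gt_eqF.
have Ef : X.1.1 + h *: Z.1.1 = Y.1.1.
  by rewrite -[RHS]/((Y.1.1, X_at0 Y / k0), X_at1 Y / k1).1.1 -XZ.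
rewrite [Y]surjective_pairing [Y.1]surjective_pairing -Ef.
by rewrite -[Y.1.2]/(X_at0 Y) -[Y.2]/(X_at1 Y) -E0 -E1.
Qed.

Lemma A_maximal_nonnegative beta0 beta1 gamma0 gamma1 : 0 < beta0 -> 0 < beta1 ->
  gamma0 <= 0 -> gamma1 <= 0 ->
  maximal_nonnegative (dot beta0 beta1) (A beta0 beta1 gamma0 gamma1).
Proof.
move=> b0 b1 g0 g1; split.
- exact: A_linear.
- exact: A_symmetric.
- exact: A_nonnegative.
- by move=> Y; exact: A_functional.
- by move=> h; exact: range_full_A.
Qed.

End wentzell.

Unset Implicit Arguments.
Set Strict Implicit.

Theorem theorem3p3 (R : realType) (a : R -> R) (x0 K : R)
  (beta0 beta1 gamma0 gamma1 : R)
  (a_cont : {within `[0, 1], continuous a})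
  (x0_in : 0 < x0 < 1)
  (a_x0 : a x0 = 0)
  (a_gt0 : forall x : R, 0 <= x <= 1 -> x != x0 -> 0 < a x)
  (a_strong : ~ lebesgue_measure.-integrable `]0, 1[ (fun x : R => ((a x)^-1)%:E))
  (K_range : 1 <= K < 2)
  (a_left : {in `[0, x0[ &, nonincreasing_fun (fun x : R => `|x - x0| `^ K / a x)})
  (a_right : {in `]x0, 1] &, nondecreasing_fun (fun x : R => `|x - x0| `^ K / a x)})
  (beta0_gt0 : 0 < beta0) (beta1_gt0 : 0 < beta1)
  (gamma0_le0 : gamma0 <= 0) (gamma1_le0 : gamma1 <= 0) :
  let dot := X_mu_dot a beta0 beta1 in
  let A := A1 a x0 beta0 beta1 gamma0 gamma1 in
  [/\ nonnegative_op dot A,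
      selfadjoint_op dot A,
      densely_defined dot A &
      generates_contraction_semigroup dot (op_opp A)].
Proof.
move=> dot A.
have a0 : 0 < a 0.
  by apply: a_gt0; [rewrite lexx ler01|case/andP: x0_in => h _; rewrite lt_eqF].
have a1 : 0 < a 1.
  by apply: a_gt0; [rewrite lexx ler01|case/andP: x0_in => _ h; rewrite gt_eqF].
have hd := X_mu_hilbert a0 a1 beta0_gt0 beta1_gt0.
have mA := A_maximal_nonnegative a_cont x0_in a_x0 a_gt0 a_strong K_range
  a_left a_right beta0_gt0 beta1_gt0 gamma0_le0 gamma1_le0.
split.
- exact: mn_nonnegative mA.
- exact: maximal_nonnegative_selfadjoint hd _ mA.
- exact: maximal_nonnegative_dense hd _ mA.
- exact: maximal_nonnegative_generates hd _ mA.
Qed.
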